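(* Let $N\ge 3$, $z_0\in\mathbb{C}\setminus\{0\}$, and set $\kappa_j=\frac{z_0^{2j+1}}{2j+1}$ for $1\le j\le N-1$. Assume (standing assumption) that the Adler–Moser polynomial $\Theta_N(z)$ with these parameters has $z_0$ as a root of multiplicity $\frac{N(N-1)}{2}$ and $N$ further simple roots. Let $A\in\mathbb{C}$ be a large parameter, and take the internal parameters of $q^{[N]}$ as $$a_{2j+1}=\kappa_j A^{2j+1}+\kappa_{j,1}A,\quad 1\le j\le N-1,$$ with complex constants $\kappa_{j,1}$ and $\kappa_{N-1,1}=0$. Define real $(x_0,t_0)$ by $x_0+2\mathrm{i}t_0=z_0A$. Consider the condition $$(\ast_j)\qquad \kappa_{j,1}=-\frac{\mathrm{Re}(z_0\mathrm{e}^{\mathrm{i}\arg A})+2^{2j}\mathrm{i}\,\mathrm{Im}(z_0\mathrm{e}^{\mathrm{i}\arg A})}{(2j+1)!}\,\mathrm{e}^{-\mathrm{i}\arg A}.$$ (1) If $(\ast_j)$ holds for all $1\le j\le N-2$, then as $|A|\to\infty$, uniformly for $(x-x_0,t-t_0)$ in any fixed bounded set, $$q^{[N]}(x,t)=\hat q^{[N-1]}(x-x_0,t-t_0)\,\mathrm{e}^{2\mathrm{i}t}+O(|A|^{-1}).$$ (2) Let $1\le m\le N-2$ and suppose $(\ast_j)$ holds for $1\le j\le m-1$ but not for $j=m$. Assume all nonzero roots of the Yablonskii–Vorob'ev polynomial $Q_{N-1}^{[m]}$ are simple. For each nonzero root $\bar z_0$ of $Q^{[m]}_{N-1}$ define real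 $(\tilde x_0,\tilde t_0)$ by $$\tilde x_0+2\mathrm{i}\tilde t_0=\bar z_0\left[-\frac{2m+1}{2^{2m}}\left(\frac{\mathrm{Re}(z_0A)+2^{2m}\mathrm{i}\,\mathrm{Im}(z_0A)}{(2m+1)!}+\kappa_{m,1}A\right)\right]^{1/(2m+1)}+z_0A$$ (with a fixed branch of the $(2m+1)$-th root). Then as $|A|\to\infty$, uniformly for $(x-\tilde x_0,t-\tilde t_0)$ in any fixed bounded set, $$q^{[N]}(x,t)=\hat q^{[1]}(x-\tilde x_0,t-\tilde t_0)\,\mathrm{e}^{2\mathrm{i}t}+O(|A|^{-1/(2m+1)}),$$ and, uniformly for $(x-x_0,t-t_0)$ in any fixed bounded set, $$q^{[N]}(x,t)=\hat q^{[N_0]}(x-x_0,t-t_0)\,\mathrm{e}^{2\mathrm{i}t}+O(|A|^{-1}),$$ where $N_0$ is defined from $N-1$ and $m$ as below. The number of such points $(\tilde x_0,\tilde t_0)$ is $\Gamma_{N-1}$.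
   Context: Schur polynomials: for $\mathbf{y}=(y_1,y_2,\dots)$, $\sum_{k\ge0}S_k(\mathbf y)\epsilon^k=\exp(\sum_{k\ge1}y_k\epsilon^k)$, $S_k=0$ for $k<0$. Let $\mathbf s=(0,s_2,0,s_4,\dots)$ with $\sum_{l\ge1}s_l\epsilon^l=\ln\!\big(\frac{2}{\epsilon}\tanh\frac{\epsilon}{2}\big)$. Rogue wave solutions of the NLS equation $\mathrm{i}q_t+q_{xx}+2|q|^2q=0$: for $N\ge1$, real $x,t$, and complex internal parameters $a_3,a_5,\dots,a_{2N-1}$, set $\mathbf x^{\pm}(n)=(x_1^{\pm}(n),0,x_3^{\pm},0,x_5^{\pm},0,\dots)$ ($n=0,1$) with $x_1^{+}(n)=x+2\mathrm{i}t+n$, $x_1^-(n)=x-2\mathrm{i}t-n$, $x_{2k+1}^+=\frac{x+2^{2k+1}\mathrm{i}t}{(2k+1)!}+a_{2k+1}$, $x_{2k+1}^-=\overline{x_{2k+1}^+}$ ($k\ge1$). Let $\tau^{(n)}_{i,j}=\sum_{v=0}^{\min(i,j)}4^{-v}S_{i-v}(\mathbf x^+(n)+v\mathbf s)S_{j-v}(\mathbf x^-(n)+v\mathbf s)$, $\tau^{(n)}=\det_{1\le i,j\le N}(\tau^{(n)}_{2i-1,2j-1})$, and $q^{[N]}(x,t)=\frac{\tau^{(1)}}{\tau^{(0)}}\mathrm{e}^{2\mathrm{i}t}$. The fundamental rogue wave $\hat q^{[M]}(x,t)$ is $q^{[M]}(x,t)\mathrm{e}^{-2\mathrm{i}t}$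 with all internal parameters $a_{2k+1}=0$; $\hat q^{[0]}\equiv1$ and $\hat q^{[1]}(x,t)=1-\frac{4(4\mathrm{i}t+1)}{4x^2+16t^2+1}$. Adler–Moser polynomials: for constants $\kappa_j$, $\sum_{k\ge0}\theta_k(z)\epsilon^k=\exp(z\epsilon+\sum_{j\ge1}\kappa_j\epsilon^{2j+1})$, $\theta_k=0$ for $k<0$, $\Theta_N(z)=c_N\det_{1\le i,j\le N}(\theta_{2i-j}(z))$, $c_N=\prod_{k=1}^N(2k-1)!!$. The Yablonskii–Vorob'ev polynomial $Q^{[m]}_N(z)$ is $\Theta_N(z)$ with $\kappa_m=-\frac{2^{2m}}{2m+1}$ and all other $\kappa_j=0$. For $M\ge1$, $m\ge1$: let $r=M \bmod (2m+1)$; $N_0=r$ if $r\le m$ and $N_0=2m-r$ if $r>m$; $\Gamma_M=\frac12\big(M(M+1)-N_0(N_0+1)\big)$. Then $Q^{[m]}_M$ has a zero root of multiplicity $N_0(N_0+1)/2$ and $\Gamma_M$ nonzero roots. In the theorem, $N_0,\Gamma_{N-1}$ are these quantities with $M=N-1$. *)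

(* Defs.v *)
From HB Require Import structures.
From mathcomp Require Import all_boot all_order all_algebra.
From mathcomp Require Import all_classical all_reals all_analysis.
From mathcomp Require Import complex.
Set Implicit Arguments. Unset Strict Implicit. Unset Printing Implicit Defensive.
Import Order.TTheory GRing.Theory Num.Theory.
Local Open Scope ring_scope.
Local Open Scope complex_scope.

Section Defs.
Variable R : realType.
Local Notation C := R[i].

Definition cnorm (z : C) : R := Normc.normc z.
Definition cRe (z : C) : R := complex.Re z.
Definition cIm (z : C) : R := complex.Im z.

Definition expi (th : R) : C := Complex (cos th) (sin th).

(** Schur polynomials: S_k(y) is the coefficient of eps^k in
    exp(sum_{j>=1} y_j eps^j) = prod_j sum_{m_j} y_j^{m_j} eps^{j m_j}/m_j!,
    i.e. the sum over (m_1,...,m_k) with sum_j j m_j = k of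
    prod_j y_j^{m_j}/m_j!.  (y 0 is unused.)  Defined over any commutative
    unit ring (used with C and with {poly C}). *)
Definition schur {F : comUnitRingType} (y : nat -> F) (k : nat) : F :=
  \sum_(m : {ffun 'I_k -> 'I_k.+1} | (\sum_(j < k) j.+1 * m j)%N == k)
     \prod_(j < k) (y j.+1 ^+ m j / (m j)`!%:R).

(** s = (s_1, s_2, ...) with sum_l s_l eps^l = ln((2/eps) tanh(eps/2)):
    s_l is the l-th Taylor coefficient at 0 of the (analytic) function
    eps |-> ln((2/eps) tanh(eps/2)), extended by its limit 0 at eps = 0. *)
Definition tanhR (x : R) : R := (expR x - expR (- x)) / (expR x + expR (- x)).
Definition sgen (e : R) : R := if e == 0 then 0 else ln ((2 / e) * tanhR (e / 2)).
Definition scoef (l : nat) : R := derive1n l sgen 0 / l`!%:R.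
Definition svec (l : nat) : C := (scoef l)%:C.

Definition xplus (a : nat -> C) (x t : R) (n : nat) (k : nat) : C :=
  if k == 1%N then (x%:C + 2%:R * 'i * t%:C + n%:R)
  else if odd k && (3 <= k)%N then
    (x%:C + 2%:R ^+ k * 'i * t%:C) / k`!%:R + a k
  else 0.
Definition xminus (a : nat -> C) (x t : R) (n : nat) (k : nat) : C :=
  if k == 1%N then (x%:C - 2%:R * 'i * t%:C - n%:R)
  else if odd k && (3 <= k)%N then
    conjc ((x%:C + 2%:R ^+ k * 'i * t%:C) / k`!%:R + a k)
  else 0.

Definition tau_entry (a : nat -> C) (x t : R) (n i j : nat) : C :=
  \sum_(0 <= v < (minn i j).+1)
    (4%:R ^- v) * schur (fun l => xplus a x t n l + v%:R * svec l) (i - v)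
                * schur (fun l => xminus a x t n l + v%:R * svec l) (j - v).

Definition tau (N : nat) (a : nat -> C) (x t : R) (n : nat) : C :=
  \det (\matrix_(i < N, j < N) tau_entry a x t n (2 * i).+1 (2 * j).+1).

Definition qN (N : nat) (a : nat -> C) (x t : R) : C :=
  tau N a x t 1 / tau N a x t 0 * expi (2%:R * t).

Definition qhat (M : nat) (x t : R) : C :=
  qN M (fun _ => 0) x t * expi (- (2%:R * t)).

Definition theta_poly (kap : nat -> C) (k : nat) : {poly C} :=
  schur (fun l => if l == 1%N then 'X
                  else if odd l then (kap l./2)%:P else 0) k.
Fixpoint dfact (n : nat) : nat :=
  match n with 0 => 1 | 1 => 1 | (n'.+2) as n => (n * dfact n')%N end.
Definition cN (N : nat) : nat := (\prod_(1 <= k < N.+1) dfact (2 * k - 1))%N.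
(* entry (i,j), 1-based: theta_{2i-j}; 0-based i,j: index 2i+1-j, 0 if < 0 *)
Definition AdlerMoser (kap : nat -> C) (N : nat) : {poly C} :=
  (cN N)%:R *: \det (\matrix_(i < N, j < N)
     (if (j <= (2 * i).+1)%N then theta_poly kap ((2 * i).+1 - j) else 0)).

Definition YV (m N : nat) : {poly C} :=
  AdlerMoser (fun j => if j == m then - (2%:R ^+ (2 * m) / (2 * m).+1%:R) else 0) N.

End Defs.

Definition N0of (M m : nat) : nat :=
  let r := (M %% (2 * m).+1)%N in if (r <= m)%N then r else (2 * m - r)%N.
Definition Gammaof (M m : nat) : nat :=
  ((M * M.+1 - N0of M m * (N0of M m).+1) %/ 2)%N.

(* Main.v *)
(* tau is det (Phi^+ (Phi^-)^T), where row i of Phi^+ collects coefficients of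
   eps^(2i+1) of exponential generating series.  As kappa_j = z0^(2j+1)/(2j+1),
   the large parameters add up to artanh(z0 A eps), whose exponential is
   1 + z0 A eps times an even series, and even series act on the odd rows by
   unipotent row operations.  Up to a factor common to tau^(0) and tau^(1), only
   a seed matrix X survives, with entries S_(2i-k) + (z0 A)^-1 S_(2i+1-k) in the
   remaining parameters; the rest of the determinant stays bounded.

   If a set J of N columns dominates, X_J^-1 X tends to the selection matrix of
   J; when J = {0, .., p-1} + {p+1, p+3, .., p+2n-1}, the determinant is a
   multiple of that of the fundamental rogue wave of order n.  Dominance is a
   weight count.  Near (x0, t0), the weight of column k keeps the quotient of k
   by 2m+1 and halves its residue, and J consists of the N lightest columns; the
   entries of X_J^-1 X being rational in |A|, they converge at rate 1/|A|.
   Part (1) is the case m = N-1.  Near the outer points the weight of column k is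
   k; the minor of the lightest columns is Q(zbar_0) = 0 to leading order and
   J = {0, .., N-2, N} has a minor proportional to Q'(zbar_0), whence n = 1.
   The same weights give the multiplicity of 0 as a root of Q. *)

(* With weight k for column k the rescaled seed matrix converges near (x0, t0) too, even to the same
   limit, but the minor of the N lightest columns is then Q(0) up to a nonzero factor, which
   vanishes as soon as N0 > 0. The way out: entry (i, k) of the limit is nonzero only if k = 2i
   modulo 2m+1, so columns of different residues do not interact and their weights can be offset
   independently. The offsets are chosen so that the j-th lightest column has the residue of 2j.
   Each residue class then has as many columns in J as rows, and each square block, with entries
   proportional to 1/(l_i - k)!, is a Vandermonde matrix in disguise.

   Near the outer points, column N-1 is lighter than column N of J, so the weights alone would let
   one entry grow like om, where |om| has size |A|^(1/(2m+1)). The limit of that entry is 0 because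
   Q(zbar_0) = 0, and the error |om|^-2 of the seed matrix pays for the excess weight, leaving
   |om|^-1.

   Dividing by tau^(0) takes a lower bound uniform in x and t. It comes from reading tau^(0) as a
   Gram determinant with a triangular minor free of x and t. *)
From HB Require Import structures.
From mathcomp Require Import all_boot all_order all_algebra all_fingroup.
From mathcomp Require Import all_classical all_reals all_analysis.
From mathcomp Require Import complex.
From mathcomp Require Import zify ring lra.
Require Import Defs.
Set Implicit Arguments. Unset Strict Implicit. Unset Printing Implicit Defensive.
Import Order.TTheory GRing.Theory Num.Theory.
Local Open Scope ring_scope.
Local Open Scope complex_scope.

(** * Schur polynomials *)

Section Schur.
Variable F : comUnitRingType.
Hypothesis natU : forall n, n.+1%:R \is a @GRing.unit F.

Definition cauchy_prod (f g : nat -> F) (n : nat) : F := \sum_(i < n.+1) f i * g (n - i)%N.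

(* coefficient of eps^i in exp(y_n eps^n) *)
Definition exp_coef (y : nat -> F) (n i : nat) : F :=
  if (n %| i)%N then y n ^+ (i %/ n) / (i %/ n)`!%:R else 0.

(** In [schur] the same k bounds the number of factors, the exponents and the degree. Separating
    these roles lets the product of exponentials be built one factor at a time. *)
Definition exp_prod (y : nat -> F) (d n : nat) : {poly F} :=
  \prod_(j < n) \sum_(m < d.+1) (y j.+1 ^+ m / m`!%:R) *: 'X^(j.+1 * m).

Definition exp_prod_coef (y : nat -> F) (n k : nat) : F := (exp_prod y k n)`_k.

Lemma schur_exp_prod_coef (y : nat -> F) (k : nat) : schur y k = exp_prod_coef y k k.
Proof.
rewrite /exp_prod_coef /exp_prod bigA_distr_bigA coef_sum /schur [LHS]big_mkcond /=.
apply: eq_bigr => f _.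
rewrite scaler_prod -(big_morph (GRing.exp 'X) (exprD 'X) (expr0 'X)).
rewrite coefZ coefXn eq_sym.
by case: eqP; rewrite ?mulr1 ?mulr0.
Qed.

Lemma coef_exp_sum y d n i : (i <= d)%N ->
  (\sum_(m < d.+1) (y n.+1 ^+ m / m`!%:R) *: 'X^(n.+1 * m))`_i = exp_coef y n.+1 i.
Proof.
move=> led; rewrite coef_sum /exp_coef.
case: ifPn => [/dvdnP [q iE] | ndvd].
  rewrite iE in led *.
  have qd : (q < d.+1)%N by nia.
  rewrite mulnK // (bigD1 (Ordinal qd)) //= coefZ coefXn mulnC eqxx mulr1.
  rewrite big1 ?addr0 // => m /eqP neq; rewrite coefZ coefXn.
  rewrite [_ == _](_ : _ = false) ?mulr0 //; apply/eqP => e; apply: neq.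
  by apply: val_inj => /=; nia.
rewrite big1 // => m _; rewrite coefZ coefXn.
case: eqP => [e|]; rewrite ?mulr0 //.
by rewrite e dvdn_mulr in ndvd.
Qed.

Lemma exp_prod_stable y d n k : (k <= d)%N -> (exp_prod y d n)`_k = exp_prod_coef y n k.
Proof.
rewrite /exp_prod_coef; elim: n d k => [|n IH] d k kd; rewrite /exp_prod.
  by rewrite !big_ord0.
rewrite !(big_ord_recr n) /= !coefM; apply: eq_bigr => i _.
have ik : (i <= k)%N by have := ltn_ord i.
rewrite !coef_exp_sum ?(leq_trans _ kd) ?leq_subr //.
by rewrite -/(exp_prod y d n) -/(exp_prod y k n) (IH d) ?(IH k) ?(leq_trans ik).
Qed.

Lemma exp_prod_coefS y n k : exp_prod_coef y n.+1 k = cauchy_prod (exp_prod_coef y n) (exp_coef y n.+1) k.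
Proof.
rewrite {1}/exp_prod_coef /exp_prod (big_ord_recr n) /= coefM; apply: eq_bigr => i _.
have ik : (i <= k)%N by have := ltn_ord i.
by rewrite coef_exp_sum ?leq_subr // -/(exp_prod y k n) exp_prod_stable.
Qed.

Lemma exp_prod_coef_large y n k : (k <= n)%N -> exp_prod_coef y n k = schur y k.
Proof.
rewrite schur_exp_prod_coef => /subnK <-; elim: (n - k)%N => [|d IH] //.
rewrite addSn exp_prod_coefS /cauchy_prod big_ord_recr /= subnn /exp_coef dvdn0 div0n.
rewrite expr0 fact0 divr1 mulr1 IH big1 ?add0r // => i _.
have ik := ltn_ord i.
by rewrite gtnNdvd ?mulr0 //; lia.
Qed.

(** Leibniz rule for the derivation eps d/deps, which multiplies the coefficient of eps^k by k. *)
Lemma cauchy_prod_degree (f g : nat -> F) n :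
  n%:R * cauchy_prod f g n = cauchy_prod (fun k => k%:R * f k) g n + cauchy_prod f (fun k => k%:R * g k) n.
Proof.
rewrite -big_split mulr_sumr; apply: eq_bigr => i _ /=.
have ik := ltn_ord i.
rewrite -{1}(subnKC (_ : i <= n)%N) // natrD; ring.
Qed.

(** Multiplication of a generating series by c eps^p. *)
Definition shift_scale (c : F) (p : nat) (f : nat -> F) (k : nat) : F :=
  if (p <= k)%N then c * f (k - p)%N else 0.

Lemma cauchy_prod_shift c p f g n : cauchy_prod f (shift_scale c p g) n = shift_scale c p (cauchy_prod f g) n.
Proof.
rewrite /cauchy_prod /shift_scale; case: ifPn => [pn|].
  rewrite mulr_sumr (big_ord_widen n.+1 (fun i => c * (f i * g (n - p - i)%N))); last first.
    by rewrite ltnS leq_subr.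
  rewrite [RHS]big_mkcond; apply: eq_bigr => i _.
  have ik := ltn_ord i.
  case: ifPn => h1; case: ifPn => h2; rewrite ?mulr0 //; try lia.
  by rewrite subnAC; ring.
rewrite -ltnNge => np; apply: big1 => i _; rewrite ifF ?mulr0 //; lia.
Qed.

(** The differential equation of exp(y eps^n) under eps d/deps. *)
Lemma exp_coef_degree y n k : k%:R * exp_coef y n.+1 k = shift_scale (n.+1%:R * y n.+1) n.+1 (exp_coef y n.+1) k.
Proof.
rewrite /shift_scale /exp_coef; case: (ltnP n k) => [nk|kn].
  have [d ->] : exists d, k = (d + n.+1)%N by exists (k - n.+1)%N; rewrite subnK.
  rewrite addnK dvdn_addl //.
  case: ifPn => [/dvdnP [q ->]|]; last by rewrite !mulr0.
  rewrite divnDr // divnn /= mulnK // addn1 exprS factS [in LHS]natrM.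
  have uf : q`!%:R \is a @GRing.unit F by move: (natU q`!.-1); rewrite prednK ?fact_gt0.
  rewrite invrM ?natU // (_ : (q * n.+1 + n.+1)%:R = n.+1%:R * q.+1%:R); last first.
    by rewrite -natrM; congr _%:R; lia.
  rewrite -!mulrA; congr (_ * _); rewrite mulrCA; congr (_ * _).
  by rewrite mulrCA; congr (_ * _); rewrite mulrCA divrr ?natU // mulr1.
case: k kn => [|k] kn; first by rewrite mul0r.
by rewrite gtnNdvd ?mulr0.
Qed.

Lemma exp_prod_coef_newton y n k :
  k%:R * exp_prod_coef y n k = \sum_(j < n) shift_scale (j.+1%:R * y j.+1) j.+1 (exp_prod_coef y n) k.
Proof.
elim: n k => [|n IH] k.
  rewrite big_ord0 /exp_prod_coef /exp_prod big_ord0 coef1; case: k => [|k]; by rewrite ?mul0r ?mulr0.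
rewrite exp_prod_coefS cauchy_prod_degree big_ord_recr /=; congr (_ + _).
  transitivity (\sum_(i < k.+1) \sum_(j < n)
      shift_scale (j.+1%:R * y j.+1) j.+1 (exp_prod_coef y n) i * exp_coef y n.+1 (k - i)).
    by apply: eq_bigr => i _; rewrite -mulr_suml -IH.
  rewrite exchange_big; apply: eq_bigr => j _ /=.
  rewrite /shift_scale; case: ifPn => [jk|jk].
    rewrite exp_prod_coefS /cauchy_prod mulr_sumr.
    have E : k.+1 = (j.+1 + (k - j.+1).+1)%N by lia.
    rewrite -(big_mkord xpredT (fun i => (if (j < i)%N then j.+1%:R * y j.+1 * exp_prod_coef y n (i - j.+1) else 0)
       * exp_coef y n.+1 (k - i))) (big_cat_nat (n := j.+1)) //=; last by lia.
    rewrite big_nat big1 ?add0r; last by move=> i ij; rewrite ifF ?mul0r //; lia.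
    rewrite -{1}[j.+1]add0n big_addn big_mkord.
    have -> : (k.+1 - j.+1 = (k - j.+1).+1)%N by lia.
    apply: eq_bigr => i _; rewrite ifT; last by lia.
    by rewrite addnK mulrA; congr (_ * exp_coef _ _ _); lia.
  by apply: big1 => i _; have ? := ltn_ord i; rewrite ifF ?mul0r //; lia.
rewrite /cauchy_prod; under eq_bigr => i _ do rewrite exp_coef_degree.
by rewrite -[LHS]/(cauchy_prod _ _ k) cauchy_prod_shift /shift_scale; case: ifP => // _; rewrite exp_prod_coefS.
Qed.

Lemma schur0 (y : nat -> F) : schur y 0 = 1.
Proof. by rewrite schur_exp_prod_coef /exp_prod_coef /exp_prod big_ord0 coef1. Qed.

Lemma schur_newton (y : nat -> F) (k : nat) :
  k%:R * schur y k = \sum_(j < k) j.+1%:R * y j.+1 * schur y (k - j.+1).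
Proof.
rewrite schur_exp_prod_coef exp_prod_coef_newton; apply: eq_bigr => j _.
rewrite /shift_scale ltn_ord exp_prod_coef_large // leq_subr //.
Qed.

(** Positive integers being invertible, the recursion is a first-order differential equation with
    one solution of constant term 1. Identities between exponentials ([schurD], [schur_single],
    [schur_log]) are then proved by differentiating both sides. *)
Lemma schur_unique (y f : nat -> F) (n : nat) : f 0%N = 1 ->
  (forall k, (0 < k <= n)%N ->
     k%:R * f k = \sum_(j < k) j.+1%:R * y j.+1 * f (k - j.+1)%N) ->
  forall k, (k <= n)%N -> f k = schur y k.
Proof.
move=> f0 fS k; elim/ltn_ind: k => -[|k] IH kn; first by rewrite f0 schur0.
apply: (mulrI (natU k)); rewrite fS ?kn // schur_newton; apply: eq_bigr => j _.
by rewrite IH //; have := ltn_ord j; lia.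
Qed.

Lemma eq_schur (y z : nat -> F) (k : nat) :
  (forall j, (0 < j <= k)%N -> y j = z j) -> schur y k = schur z k.
Proof.
move=> yz; rewrite /schur; apply: eq_bigr => m _; apply: eq_bigr => j _.
by rewrite yz //= ltn_ord.
Qed.

Lemma schurD (y z : nat -> F) (k : nat) :
  schur (fun j => y j + z j) k = \sum_(i < k.+1) schur y i * schur z (k - i).
Proof.
symmetry; apply: (@schur_unique _ (cauchy_prod (schur y) (schur z)) k _ _ k) => //.
  by rewrite /cauchy_prod big_ord1 !schur0 mulr1.
move=> n /andP [n0 _]; rewrite cauchy_prod_degree.
pose shs (y f : nat -> F) k := \sum_(j < n) shift_scale (j.+1%:R * y j.+1) j.+1 f k.
have E u i : (i <= n)%N -> i%:R * schur u i = shs u (schur u) i.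
  move=> ni; rewrite schur_newton /shs (big_ord_widen n (fun j => j.+1%:R * u j.+1 * schur u (i - j.+1))) //.
  by rewrite big_mkcond; apply: eq_bigr => j _; rewrite /shift_scale.
have cauchy_prodC f g i : cauchy_prod f g i = cauchy_prod g f i.
  rewrite /cauchy_prod (reindex_inj rev_ord_inj); apply: eq_bigr => j _ /=.
  by rewrite subSS mulrC subKn // -ltnS ltn_ord.
have D u f : cauchy_prod f (fun k => k%:R * schur u k) n = shs u (cauchy_prod f (schur u)) n.
  rewrite {1}/cauchy_prod (eq_bigr (fun i : 'I_n.+1 => f i * shs u (schur u) (n - i)%N)); last first.
    by move=> i _; rewrite E ?leq_subr.
  rewrite /shs; under eq_bigr do rewrite mulr_sumr.
  rewrite exchange_big; apply: eq_bigr => j _ /=.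
  by rewrite -cauchy_prod_shift.
rewrite cauchy_prodC D D /shs -big_split; apply: eq_bigr => j _ /=.
rewrite /shift_scale ltn_ord (cauchy_prodC (schur z)); ring.
Qed.

Lemma schurZ (c : F) (y : nat -> F) (k : nat) :
  schur (fun j => c ^+ j * y j) k = c ^+ k * schur y k.
Proof.
rewrite /schur mulr_sumr; apply: eq_bigr => m /eqP mk.
have -> : c ^+ k = \prod_(j < k) c ^+ (j.+1 * m j).
  by rewrite -(big_morph (GRing.exp c) (exprD c) (expr0 c)) mk.
rewrite -big_split; apply: eq_bigr => j _ /=.
by rewrite exprMn -exprM mulrA.
Qed.

Lemma schur_supp_dvd (d : nat) (y : nat -> F) (k : nat) :
  (forall j, ~~ (d %| j)%N -> y j = 0) -> ~~ (d %| k)%N -> schur y k = 0.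
Proof.
move=> y0; rewrite /schur => dk; apply: big1 => m /eqP mk.
case: (pickP (fun j : 'I_k => ~~ (d %| j.+1)%N && (m j != 0 :> nat))) => [j /andP [h1 h2]|all0].
  by rewrite (bigD1 j) //= y0 // expr0n (negbTE h2) mul0r mul0r.
case/negP: dk; rewrite -mk; apply: dvdn_sum => j _.
move: (all0 j); case: (boolP (d %| j.+1)%N) => [h _|h] /=; first by rewrite dvdn_mulr.
by move=> /negbFE /eqP ->; rewrite muln0.
Qed.

Lemma schur_single (d : nat) (c : F) (k : nat) : (0 < d)%N ->
  schur (fun j => if j == d then c else 0) k =
    if (d %| k)%N then c ^+ (k %/ d) / (k %/ d)`!%:R else 0.
Proof.
case: d => // d _; symmetry.
pose y := fun j => if j == d.+1 then c else 0.
transitivity (exp_coef y d.+1 k); first by rewrite /exp_coef /y eqxx.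
apply: (@schur_unique y _ k _ _ k) => //.
  by rewrite /exp_coef dvdn0 div0n expr0 fact0 divr1.
move=> n _; rewrite exp_coef_degree /shift_scale.
case: ifPn => [dn|nd].
  rewrite (bigD1 (Ordinal dn)) //= big1 ?addr0 // => j /eqP jd.
  rewrite {1}/y eqSS ifF ?mulr0 ?mul0r //.
  by apply/eqP => e; apply: jd; apply: val_inj.
by rewrite big1 // => j _; rewrite /y eqSS ifF ?mulr0 ?mul0r //; have := ltn_ord j; lia.
Qed.

(* These parameters are the coefficients of ln(1 + c eps). *)
Lemma schur_log (c : F) (k : nat) :
  schur (fun j => (-1) ^+ j.+1 * c ^+ j / j%:R) k =
    if k == 0%N then 1 else if k == 1%N then c else 0.
Proof.
symmetry; pose f k : F := if k == 0%N then 1 else if k == 1%N then c else 0.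
apply: (@schur_unique _ f k _ _ k) => // -[|[|n]] // _.
  by rewrite big_ord1 /f /= divr1 -signr_odd /= expr0 !mul1r expr1 mulr1.
rewrite !big_ord_recr /= big1 ?add0r; last first.
  move=> j _; rewrite /f ifF ?ifF ?mulr0 //; have := ltn_ord j; lia.
rewrite /f subnn subSS subSnn /= mulr0 mulr1.
rewrite ![_.+1%:R * _]mulrC !mulrVK //.
by rewrite !exprS; ring.
Qed.

End Schur.

Lemma rmorph_schur (F F' : comUnitRingType) (f : {rmorphism F -> F'})
    (y : nat -> F) (k : nat) :
  (forall n, n.+1%:R \is a @GRing.unit F) ->
  f (schur y k) = schur (f \o y) k.
Proof.
move=> natU; rewrite /schur rmorph_sum; apply: eq_bigr => m _.
rewrite rmorph_prod; apply: eq_bigr => j _ /=.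
rewrite rmorph_div; first by rewrite rmorphXn rmorph_nat.
by move: (natU (m j)`!.-1); rewrite prednK ?fact_gt0.
Qed.

(** * Factorization of tau *)

Lemma natU_num (F : numFieldType) (n : nat) : n.+1%:R \is a @GRing.unit F.
Proof. by rewrite unitfE pnatr_eq0. Qed.

Lemma sum_even_odd (V : nmodType) (n : nat) (f : nat -> V) :
  \sum_(k < n.*2) f k = \sum_(i < n) (f i.*2 + f i.*2.+1).
Proof.
elim: n => [|n IH]; first by rewrite !big_ord0.
by rewrite doubleS !big_ord_recr /= IH addrA.
Qed.

Lemma det_unitriangular (F : comNzRingType) (n : nat) (A : 'M[F]_n) :
  (forall i j : 'I_n, (i < j)%N -> A i j = 0) -> (forall i, A i i = 1) -> \det A = 1.
Proof.
move=> A0 A1; rewrite det_trig; first by rewrite big1.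
by apply/is_trig_mxP => i j; apply: A0.
Qed.

Lemma det_mulmx_tr_factor (F : comNzRingType) (n l : nat) (U V : 'M[F]_n) (A B : 'M[F]_(n, l)) :
  \det (U *m A *m (V *m B)^T) = \det U * \det V * \det (A *m B^T).
Proof. by rewrite trmx_mul mulmxA -(mulmxA U) !det_mulmx det_tr mulrAC. Qed.

Section Psi.
Variable F : numFieldType.
Variable s : nat -> F.
Hypothesis s_odd : forall j, odd j -> s j = 0.
Let natU := @natU_num F.
Implicit Types (b y : nat -> F) (k v n l : nat).

(* The coefficient of eps^k in (eps/2)^v exp(sum_j (y_j + v s_j) eps^j), so that
   tau_entry pairs two such rows. *)
Definition psi y k v : F :=
  if (v <= k)%N then 2%:R ^- v * schur (fun j => y j + v%:R * s j) (k - v) else 0.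

Lemma eq_psi y z k v : (forall j, (0 < j <= k)%N -> y j = z j) -> psi y k v = psi z k v.
Proof.
move=> yz; rewrite /psi; case: ifP => // vk; congr (_ * _).
by apply: eq_schur => j jk; rewrite yz //; lia.
Qed.

Lemma psiD b y k v :
  psi (fun j => b j + y j) k v = \sum_(i < k.+1) schur b (k - i) * psi y i v.
Proof.
rewrite /psi; case: leqP => [vk|kv]; last first.
  by rewrite big1 // => i _; have ? := ltn_ord i; rewrite ifF ?mulr0 //; lia.
rewrite (eq_schur (z := fun j => b j + (y j + v%:R * s j))); last by move=> j _; rewrite addrA.
rewrite (schurD natU) mulr_sumr.
rewrite -(big_mkord xpredT (fun i => schur b (k - i) *
  (if (v <= i)%N then 2%:R ^- v * schur (fun j => y j + v%:R * s j) (i - v) else 0))).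
rewrite (big_cat_nat (n := v)) //=; last by lia.
symmetry; rewrite big_nat big1 ?add0r; last by move=> i iv /=; rewrite ifF ?mulr0 //; lia.
symmetry; rewrite (big_addn 0 k.+1 v) big_mkord subSn // (reindex_inj rev_ord_inj).
apply: eq_bigr => i _ /=; have ? := ltn_ord i.
rewrite ifT ?leq_addl // addnK mulrCA; congr (schur _ _ * (_ * schur _ _)); lia.
Qed.

Definition oddrows n l y : 'M[F]_(n, l) := \matrix_(i, v) psi y i.*2.+1 v.

Definition even_toeplitz n b : 'M[F]_n :=
  \matrix_(i, j) if (j <= i)%N then schur b (i - j).*2 else 0.

Lemma det_even_toeplitz n b : \det (even_toeplitz n b) = 1.
Proof.
apply: det_unitriangular => [i j ij|i]; rewrite mxE; first by rewrite leqNgt ij.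
by rewrite leqnn subnn schur0.
Qed.

(* exp of an even series is even, so it acts on the odd coefficients by a row operation. *)
Lemma oddrows_even n l b y : (forall j, odd j -> b j = 0) ->
  oddrows n l (fun j => b j + y j) = even_toeplitz n b *m oddrows n l y.
Proof.
move=> b0; apply/matrixP => i v; rewrite !mxE psiD.
have S0 k : odd k -> schur b k = 0.
  move=> ok; apply: (@schur_supp_dvd _ 2) => [j|]; rewrite dvdn2 ?negbK //; exact: b0.
under [RHS]eq_bigr do rewrite !mxE.
rewrite (sum_even_odd i.+1 (fun k => schur b (i.*2.+1 - k) * psi y k v)).
rewrite (big_ord_widen n (fun j => schur b (i.*2.+1 - j.*2) * psi y j.*2 v
   + schur b (i.*2.+1 - j.*2.+1) * psi y j.*2.+1 v)) // big_mkcond.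
apply: eq_bigr => j _; rewrite ltnS; case: ifP => ij; last by rewrite mul0r.
rewrite S0 ?mul0r ?add0r; last by rewrite subSn ?leq_double // /= -doubleB odd_double.
by rewrite subSS doubleB.
Qed.

(* Entry (i, k) is the coefficient of eps^(2i+1) in (eps + mu) eps^k exp(sum_j b_j eps^j). *)
Definition seed b (mu : F) n l : 'M[F]_(n, l) :=
  \matrix_(i, k) ((if (k <= i.*2)%N then schur b (i.*2 - k) else 0)
    + mu * (if (k <= i.*2.+1)%N then schur b (i.*2.+1 - k) else 0)).

Definition psimx l y : 'M[F]_l := \matrix_(k, v) psi y k v.

(* artanh(c eps) = ln(1 + c eps) - ln(1 - (c eps)^2) / 2, and the last term is even. *)
Lemma oddrows_atanh n b y c : c != 0 ->
  oddrows n n.*2 (fun j => (if odd j then c ^+ j / j%:R else 0) + b j + y j)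
  = even_toeplitz n (fun j => if odd j then 0 else c ^+ j / j%:R)
    *m (c *: (seed b c^-1 n n.*2 *m psimx n.*2 y)).
Proof.
move=> c0.
pose e j : F := if odd j then 0 else c ^+ j / j%:R.
pose lg j := (-1) ^+ j.+1 * c ^+ j / j%:R.
transitivity (oddrows n n.*2 (fun j => e j + ((lg j + b j) + y j))).
  apply/matrixP => i v; rewrite !mxE; apply: eq_psi => j _.
  rewrite !addrA; congr (_ + _ + _); rewrite /e /lg -signr_odd /=.
  by case: (odd j) => /=; rewrite ?expr0 ?expr1 ?mul1r ?add0r // mulN1r mulNr subrr.
rewrite oddrows_even; last by move=> j oj; rewrite /e oj.
congr (_ *m _); apply/matrixP => i v; rewrite !mxE psiD.
rewrite mulr_sumr (big_ord_widen n.*2 (fun k => schur (fun j => lg j + b j) (i.*2.+1 - k) * psi y k v)); last first.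
  by have ? := ltn_ord i; lia.
rewrite big_mkcond; apply: eq_bigr => k _; rewrite !mxE.
have S m : schur (fun j => lg j + b j) m = schur b m + (if m is m'.+1 then c * schur b m' else 0).
  rewrite (schurD natU); case: m => [|m].
    by rewrite big_ord1 addr0 schur_log // mul1r.
  rewrite 2!big_ord_recl /= big1 ?addr0; last by move=> q _; rewrite schur_log //= mul0r.
  by rewrite !schur_log //= mul1r subn0 subSS subn0.
rewrite ltnS mulrA; case: (leqP k i.*2.+1) => [ki|ki]; last first.
  by rewrite ifF ?mulr0 ?addr0 ?mulr0 ?mul0r //; lia.
congr (_ * _); rewrite S mulrDr mulrA divff // mul1r addrC; congr (_ + _).
case: leqP => [ki'|ki']; first by rewrite subSn.
by rewrite (_ : (_ - _)%N = 0%N) ?mulr0 //; lia.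
Qed.

Lemma det_oddrows_atanh n b b' y y' c c' : c != 0 -> c' != 0 ->
  \det (oddrows n n.*2 (fun j => (if odd j then c ^+ j / j%:R else 0) + b j + y j) *m
    (oddrows n n.*2 (fun j => (if odd j then c' ^+ j / j%:R else 0) + b' j + y' j))^T) =
  (c * c') ^+ n * \det ((seed b c^-1 n n.*2 *m psimx n.*2 y) *m
    (seed b' c'^-1 n n.*2 *m psimx n.*2 y')^T).
Proof.
move=> c0 c0'; rewrite !oddrows_atanh // det_mulmx_tr_factor !det_even_toeplitz !mul1r.
by rewrite linearZ /= -scalemxAl -scalemxAr scalerA detZ.
Qed.

(* Increasing enumeration of 0, .., p-1, p+1, p+3, p+5, ... *)
Definition core p i := (if i < p then i else p + (i - p).*2.+1)%N.

Definition corerows p n l y : 'M[F]_(p + n, l) := \matrix_(i, v) psi y (core p i) v.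

(** The first p rows are triangular. In row p + 2i + 1, moving the columns by p multiplies by
    (eps/2)^p and adds p s to the parameters. As s is even, [oddrows_even] absorbs this shift, so
    that the odd rows of a problem of size n remain. *)
Lemma corerowsE p n l y : exists A : 'M[_]_p, exists B : 'M[_]_(n, p),
   \det A = \prod_(i < p) 2%:R ^- i /\
   corerows p n (p + l) y = block_mx A 0 B 1%:M *m
     block_mx 1%:M 0 0 (2%:R ^- p *: (even_toeplitz n (fun j => p%:R * s j) *m oddrows n l y)).
Proof.
exists (\matrix_(i, v) psi y i v); exists (\matrix_(i, v) psi y (p + i.*2.+1) v).
split.
  rewrite det_trig; last by apply/is_trig_mxP => i j ij; rewrite mxE /psi leqNgt ij.
  by apply: eq_bigr => i _; rewrite mxE /psi leqnn subnn schur0 mulr1.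
rewrite mulmx_block !mulmx0 !mul0mx !addr0 ?add0r !mulmx1 mul1mx.
rewrite -[LHS]submxK; congr block_mx; apply/matrixP => i v; rewrite !mxE /core /=.
- by rewrite ltn_ord.
- rewrite ltn_ord /psi ifF //; have ? := ltn_ord i; lia.
- by rewrite ifF ?addKn //; lia.
rewrite ifF; last by lia.
have := @oddrows_even n l (fun j => p%:R * s j) y.
move=> /(_ _)/matrixP /(_ i v) E; rewrite !mxE in E; rewrite -E; last first.
  by move=> j oj; rewrite s_odd ?mulr0.
rewrite addKn /psi leq_add2l; case: ifP => _; rewrite ?mulr0 //.
rewrite exprD invfM -mulrA subnDl; congr (_ * (_ * _)).
by apply: eq_schur => j _; rewrite natrD; ring.
Qed.

Lemma det_corerows p n l y z :
  \det (corerows p n (p + l) y *m (corerows p n (p + l) z)^T) =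
  (\prod_(i < p) 2%:R ^- i) ^+ 2 * (2%:R ^- p) ^+ n ^+ 2 *
  \det (oddrows n l y *m (oddrows n l z)^T).
Proof.
have [A [B [dA ->]]] := corerowsE p n l y; have [A' [B' [dA' ->]]] := corerowsE p n l z.
rewrite det_mulmx_tr_factor !det_lblock dA dA' !det1 !mulr1.
rewrite tr_block_mx mulmx_block !trmx1 !trmx0 !mulmx0 !mul0mx !mulmx1 !addr0 add0r det_ublock det1 mul1r.
rewrite linearZ /= -scalemxAl -scalemxAr !detZ det_mulmx_tr_factor !det_even_toeplitz; ring.
Qed.

End Psi.

(** * Uniform asymptotics *)

Section Normc.
Variable R : rcfType.
Implicit Types x y : R[i].
Local Notation normc := (@Normc.normc R).

Lemma normc_ge0 x : 0 <= normc x.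
Proof. by case: x => a b; apply: sqrtr_ge0. Qed.

Lemma normc_eq0 x : (normc x == 0) = (x == 0).
Proof. by apply/eqP/eqP => [/Normc.eq0_normc|->] //; rewrite Normc.normc0. Qed.

Lemma normc_gt0 x : (0 < normc x) = (x != 0).
Proof. by rewrite lt_def normc_ge0 andbT normc_eq0. Qed.

Lemma normcX x n : normc (x ^+ n) = normc x ^+ n.
Proof. by elim: n => [|n IH]; rewrite ?expr0 ?Normc.normc1 // !exprS Normc.normcM IH. Qed.

Lemma normcR (a : R) : normc a%:C = `|a|.
Proof. by rewrite /= expr0n addr0 sqrtr_sqr. Qed.

Lemma normc_nat n : normc n%:R = n%:R.
Proof. by rewrite -(rmorph_nat (real_complex R)) normcR ger0_norm. Qed.

Lemma normcJ x : normc (conjc x) = normc x.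
Proof. by case: x => a b /=; rewrite sqrrN. Qed.

Lemma normc_Re x : `|complex.Re x| <= normc x.
Proof. by case: x => a b /=; rewrite -sqrtr_sqr ler_sqrt ?lerDl ?sqr_ge0 // addr_ge0 ?sqr_ge0. Qed.

Lemma normc_Im x : `|complex.Im x| <= normc x.
Proof. by case: x => a b /=; rewrite -sqrtr_sqr ler_sqrt ?lerDr ?sqr_ge0 // addr_ge0 ?sqr_ge0. Qed.

End Normc.

Section Appx.
Variables (R : rcfType) (U : Type) (D : U -> Prop) (eta : R -> R).
Local Notation normc := (@Normc.normc R).
Implicit Types (f g h : R -> U -> R[i]) (P Q : R -> U -> Prop).

(* Eventually in r, uniformly in the u satisfying D. *)
Definition evt P := exists r0, forall r, r0 <= r -> forall u, D u -> P r u.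

Lemma evt_and P Q : evt P -> evt Q -> evt (fun r u => P r u /\ Q r u).
Proof.
move=> [a Pa] [b Qb]; exists (Num.max a b) => r; rewrite ge_max => /andP [ar br] u Du.
by split; [apply: Pa | apply: Qb].
Qed.

Lemma evt_imp P Q : (forall r u, D u -> P r u -> Q r u) -> evt P -> evt Q.
Proof. by move=> PQ [a Pa]; exists a => r ar u Du; apply: PQ => //; apply: Pa. Qed.

Lemma evt_all P : (forall r u, D u -> P r u) -> evt P.
Proof. by move=> HP; exists 0 => r _; apply: HP. Qed.

Hypothesis eta01 : evt (fun r _ => 0 <= eta r <= 1).

(* f = g + O(eta), with g bounded. *)
Definition appx f g := exists K, 0 <= K /\
  evt (fun r u => normc (g r u) <= K /\ normc (f r u - g r u) <= K * eta r).

Definition bnd f := exists K, evt (fun r u => normc (f r u) <= K).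

Lemma appx_bnd f : bnd f -> appx f f.
Proof.
move=> [K HK]; exists (Num.max K 0); split; first by rewrite le_max lexx orbT.
move: eta01 => /(evt_and HK); apply: evt_imp => r u _ [fK /andP [e0 _]].
by rewrite le_max fK subrr Normc.normc0 mulr_ge0 // le_max lexx orbT.
Qed.

Lemma appx_cst (c : R[i]) : appx (fun _ _ => c) (fun _ _ => c).
Proof. by apply: appx_bnd; exists (normc c); apply: evt_all. Qed.

Lemma appx_bndl f g : appx f g -> bnd f.
Proof.
move=> [K [K0 H]]; exists (K + K); move: eta01 => /(evt_and H).
apply: evt_imp => r u _ [[gK fgK] /andP [e0 e1]].
rewrite -[f r u](subrK (g r u)); apply: le_trans (le_normcD _ _) _.
by apply: lerD => //; apply: le_trans fgK _; rewrite ler_piMr.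
Qed.

Lemma appx_O f K : evt (fun r u => normc (f r u) <= K * eta r) -> appx f (fun _ _ => 0).
Proof.
move=> H; exists (Num.max K 0); split; first by rewrite le_max lexx orbT.
move: eta01 => /(evt_and H); apply: evt_imp => r u _ [fK /andP [e0 _]].
rewrite Normc.normc0 le_max lexx orbT subr0; split=> //.
by apply: le_trans fK _; rewrite ler_wpM2r // le_max lexx.
Qed.

Lemma appx_ext f f' g g' : appx f g -> evt (fun r u => f' r u = f r u /\ g' r u = g r u) ->
  appx f' g'.
Proof.
move=> [K [K0 H]] /(evt_and H) H'; exists K; split => //.
by apply: evt_imp H' => r u _ [[? ?] [-> ->]].
Qed.

Lemma appx_eq f f' g g' : appx f g -> (forall r u, f' r u = f r u) ->
  (forall r u, g' r u = g r u) -> appx f' g'.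
Proof. by move=> fg e1 e2; apply: appx_ext fg _; apply: evt_all. Qed.

Lemma appxD f f' g g' : appx f g -> appx f' g' ->
  appx (fun r u => f r u + f' r u) (fun r u => g r u + g' r u).
Proof.
move=> [K [K0 H]] [K' [K'0 H']]; exists (K + K'); split; first exact: addr_ge0.
apply: evt_imp (evt_and H H') => r u _ [[a b] [a' b']]; split.
  by apply: le_trans (le_normcD _ _) _; apply: lerD.
rewrite opprD addrACA mulrDl; apply: le_trans (le_normcD _ _) _; exact: lerD.
Qed.

Lemma appxM f f' g g' : appx f g -> appx f' g' ->
  appx (fun r u => f r u * f' r u) (fun r u => g r u * g' r u).
Proof.
move=> /[dup] [[K [K0 H]]] /appx_bndl [L HL] [K' [K'0 H']].
exists (Num.max L 0 * K' + K * K'); split; first by rewrite addr_ge0 ?mulr_ge0 // le_max lexx orbT.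
move: eta01 => /(evt_and (evt_and HL (evt_and H H'))).
apply: evt_imp => r u _ [[l [[a b] [a' b']]] /andP [e0 e1]].
have l' : normc (f r u) <= Num.max L 0 by rewrite le_max l.
have L0 : 0 <= Num.max L 0 by rewrite le_max lexx orbT.
split; first by rewrite Normc.normcM ler_wpDl ?mulr_ge0 // ler_pM // normc_ge0.
have -> : f r u * f' r u - g r u * g' r u = f r u * (f' r u - g' r u) + (f r u - g r u) * g' r u.
  by ring.
apply: le_trans (le_normcD _ _) _; rewrite !Normc.normcM mulrDl; apply: lerD.
  by rewrite -mulrA ler_pM // normc_ge0.
by rewrite mulrAC ler_pM // normc_ge0.
Qed.

Lemma appxZ c f g : appx f g -> appx (fun r u => c * f r u) (fun r u => c * g r u).
Proof. by apply: appxM; apply: appx_cst. Qed.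

Lemma appxN f g : appx f g -> appx (fun r u => - f r u) (fun r u => - g r u).
Proof. by move=> fg; apply: (appx_eq (appxZ (-1) fg)) => r u; rewrite mulN1r. Qed.

Lemma appxB f f' g g' : appx f g -> appx f' g' ->
  appx (fun r u => f r u - f' r u) (fun r u => g r u - g' r u).
Proof. by move=> fg fg'; apply: appxD => //; apply: appxN. Qed.

Lemma appxJ f g : appx f g -> appx (fun r u => conjc (f r u)) (fun r u => conjc (g r u)).
Proof.
move=> [K [K0 H]]; exists K; split => //; apply: evt_imp H => r u _.
by rewrite -rmorphB !normcJ.
Qed.

Lemma appxX n f g : appx f g -> appx (fun r u => f r u ^+ n) (fun r u => g r u ^+ n).
Proof.
move=> fg; elim: n => [|n IH]; first exact: appx_cst.
by apply: (appx_eq (appxM fg IH)) => r u; rewrite exprS.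
Qed.

Lemma appx_sum (J : Type) (s : seq J) (P : pred J) (f g : J -> R -> U -> R[i]) :
  (forall j, P j -> appx (f j) (g j)) ->
  appx (fun r u => \sum_(j <- s | P j) f j r u) (fun r u => \sum_(j <- s | P j) g j r u).
Proof.
move=> fg; elim: s => [|j s IH].
  by apply: (appx_eq (appx_cst 0)) => r u; rewrite big_nil.
case: (boolP (P j)) => Pj; last by apply: (appx_eq IH) => r u; rewrite big_cons (negbTE Pj).
by apply: (appx_eq (appxD (fg _ Pj) IH)) => r u; rewrite big_cons Pj.
Qed.

Lemma appx_prod (J : Type) (s : seq J) (P : pred J) (f g : J -> R -> U -> R[i]) :
  (forall j, P j -> appx (f j) (g j)) ->
  appx (fun r u => \prod_(j <- s | P j) f j r u) (fun r u => \prod_(j <- s | P j) g j r u).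
Proof.
move=> fg; elim: s => [|j s IH].
  by apply: (appx_eq (appx_cst 1)) => r u; rewrite big_nil.
case: (boolP (P j)) => Pj; last by apply: (appx_eq IH) => r u; rewrite big_cons (negbTE Pj).
by apply: (appx_eq (appxM (fg _ Pj) IH)) => r u; rewrite big_cons Pj.
Qed.

Lemma appxV f g (c : R) : 0 < c -> evt (fun r u => c <= normc (g r u)) ->
  evt (fun r u => c <= normc (f r u)) -> appx f g ->
  appx (fun r u => (f r u)^-1) (fun r u => (g r u)^-1).
Proof.
move=> c0 Hg Hf [K [K0 H]]; exists (c^-1 + c^-1 * c^-1 * K).
have ci : 0 < c^-1 by rewrite invr_gt0.
split; first by rewrite addr_ge0 ?mulr_ge0 // ltW.
move: eta01 => /(evt_and (evt_and H (evt_and Hg Hf))).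
apply: evt_imp => r u _ [[[a b] [cg cf]] /andP [e0 e1]].
have gi : normc (g r u)^-1 <= c^-1.
  by rewrite Normc.normcV lef_pV2 // posrE (lt_le_trans c0).
have fi : normc (f r u)^-1 <= c^-1.
  by rewrite Normc.normcV lef_pV2 // posrE (lt_le_trans c0).
split; first by rewrite ler_wpDr // ?mulr_ge0 // ltW.
have f0 : f r u != 0 by rewrite -normc_gt0 (lt_le_trans c0).
have g0 : g r u != 0 by rewrite -normc_gt0 (lt_le_trans c0).
have -> : (f r u)^-1 - (g r u)^-1 = (f r u)^-1 * (g r u)^-1 * - (f r u - g r u).
  by field; rewrite f0 g0.
rewrite !Normc.normcM normcN mulrDl; apply: ler_wpDl; first by rewrite mulr_ge0 // ltW.
rewrite -[leRHS]mulrA; apply: ler_pM; rewrite ?mulr_ge0 ?normc_ge0 //.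
by apply: ler_pM; rewrite ?normc_ge0.
Qed.

Lemma appx_schur (y z : nat -> R -> U -> R[i]) k :
  (forall j, (0 < j <= k)%N -> appx (y j) (z j)) ->
  appx (fun r u => schur (fun j => y j r u) k) (fun r u => schur (fun j => z j r u) k).
Proof.
move=> yz; rewrite /schur; apply: appx_sum => m _; apply: appx_prod => j _.
apply: appxM; last exact: appx_cst.
by apply: appxX; apply: yz; rewrite /= ltn_ord.
Qed.

Definition appx_mx m n (A B : R -> U -> 'M[R[i]]_(m, n)) :=
  forall i j, appx (fun r u => A r u i j) (fun r u => B r u i j).

Lemma appx_mulmx m n p (A A' : R -> U -> 'M[_]_(m, n)) (B B' : R -> U -> 'M[_]_(n, p)) :
  appx_mx A A' -> appx_mx B B' ->
  appx_mx (fun r u => A r u *m B r u) (fun r u => A' r u *m B' r u).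
Proof.
move=> AA BB i j.
have H : appx (fun r u => \sum_k A r u i k * B r u k j) (fun r u => \sum_k A' r u i k * B' r u k j).
  by apply: appx_sum => k _; apply: appxM.
by apply: (appx_eq H) => r u; rewrite mxE.
Qed.

Lemma appx_trmx m n (A A' : R -> U -> 'M[_]_(m, n)) :
  appx_mx A A' -> appx_mx (fun r u => (A r u)^T) (fun r u => (A' r u)^T).
Proof. by move=> AA i j; apply: (appx_eq (AA j i)) => r u; rewrite mxE. Qed.

Lemma appx_det n (A A' : R -> U -> 'M[_]_n) :
  appx_mx A A' -> appx (fun r u => \det (A r u)) (fun r u => \det (A' r u)).
Proof.
move=> AA; apply: appx_sum => s _; apply: appxM; first exact: appx_cst.
by apply: appx_prod => i _; apply: AA.
Qed.

Lemma appx_adj n (A A' : R -> U -> 'M[_]_n) :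
  appx_mx A A' -> appx_mx (fun r u => \adj (A r u)) (fun r u => \adj (A' r u)).
Proof.
move=> AA i j.
have H : appx (fun r u => cofactor (A r u) j i) (fun r u => cofactor (A' r u) j i).
  apply: appxM; first exact: appx_cst.
  apply: appx_det => i' j'; apply: (appx_eq (AA (lift j i') (lift i j'))) => r u; by rewrite !mxE.
by apply: (appx_eq H) => r u; rewrite mxE.
Qed.

End Appx.

(** * Gram determinants and cores *)

(* Cauchy-Binet, summed over all maps instead of the increasing ones. *)
Lemma det_mulmx_tr_sum (F : comNzRingType) n l (A B : 'M[F]_(n, l)) :
  n`!%:R * \det (A *m B^T) =
  \sum_(f : {ffun 'I_n -> 'I_l}) \det (colsub f A) * \det (colsub f B).
Proof.
have E : \det (A *m B^T) =
    \sum_(f : {ffun 'I_n -> 'I_l}) (\prod_i A i (f i)) * \det (colsub f B).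
  rewrite {1}/determinant.
  transitivity (\sum_(s : 'S_n) \sum_(f : {ffun 'I_n -> 'I_l})
      (-1) ^+ s * ((\prod_i A i (f i)) * \prod_i B (s i) (f i))).
    apply: eq_bigr => s _; rewrite -mulr_sumr; congr (_ * _).
    under eq_bigr do rewrite mxE.
    rewrite bigA_distr_bigA; apply: eq_bigr => f _; rewrite -big_split.
    by apply: eq_bigr => i _; rewrite mxE.
  rewrite exchange_big; apply: eq_bigr => f _ /=; rewrite -[in RHS]det_tr /determinant mulr_sumr.
  apply: eq_bigr => s _; rewrite mulrCA; congr (_ * (_ * _)).
  by apply: eq_bigr => i _; rewrite !mxE.
have perm (M : 'M[F]_(n, l)) (f : {ffun 'I_n -> 'I_l}) (s : 'S_n) :
    \det (colsub [ffun i => f (s i)] M) = (-1) ^+ s * \det (colsub f M).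
  rewrite (_ : colsub _ M = col_perm s (colsub f M)).
    by rewrite col_permE det_mulmx det_perm odd_permV mulrC.
  by apply/matrixP => i j; rewrite !mxE ffunE.
(* The factor n! is spent as a sum over permutations s. Reindexing f by s turns the product over i
   into a term of the determinant of [colsub f A]. *)
rewrite -card_Sn -sum1_card natr_sum mulr_suml.
transitivity (\sum_(s : 'S_n) \sum_(f : {ffun 'I_n -> 'I_l})
   (\prod_i A i (f (s i))) * ((-1) ^+ s * \det (colsub f B))).
  rewrite (eq_bigl xpredT); last by move=> s; rewrite inE.
  apply: eq_bigr => s _; rewrite mul1r E.
  pose g (h : {ffun 'I_n -> 'I_l}) := [ffun i => h (s i)].
  rewrite (reindex g) /=; last first.
    exists (fun h : {ffun 'I_n -> 'I_l} => [ffun i => h ((s^-1)%g i)]) => h _; apply/ffunP => i;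
      by rewrite !ffunE ?permKV ?permK.
  apply: eq_bigr => f _; rewrite perm; congr (_ * _).
  by apply: eq_bigr => i _; rewrite ffunE.
rewrite exchange_big; apply: eq_bigr => f _ /=.
under eq_bigr do rewrite mulrA.
rewrite -mulr_suml; congr (_ * _); apply: eq_bigr => s _.
by rewrite mulrC; congr (_ * _); apply: eq_bigr => i _; rewrite !mxE.
Qed.

(** Each summand of [det_mulmx_tr_sum] is here a squared modulus, so any single one is a lower
    bound. *)
Lemma normc_det_gram (R : rcfType) n l (A : 'M[R[i]]_(n, l)) (f : 'I_n -> 'I_l) :
  Normc.normc (\det (colsub f A)) ^+ 2 / n`!%:R <=
  Normc.normc (\det (A *m (map_mx conjc A)^T)).
Proof.
have n0 : 0 < n`!%:R :> R by rewrite ltr0n fact_gt0.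
rewrite ler_pdivrMr // mulrC -[n`!%:R]normc_nat -Normc.normcM det_mulmx_tr_sum.
pose a (g : {ffun 'I_n -> 'I_l}) := Normc.normc (\det (colsub g A)) ^+ 2.
have -> : \sum_(g : {ffun 'I_n -> 'I_l}) \det (colsub g A) * \det (colsub g (map_mx conjc A))
    = (\sum_g a g)%:C.
  rewrite rmorph_sum; apply: eq_bigr => g _.
  have -> : colsub g (map_mx conjc A) = map_mx conjc (colsub g A).
    by apply/matrixP => i j; rewrite !mxE.
  by rewrite det_map_mx -sqr_normc /a rmorphXn.
rewrite normcR ger0_norm; last by apply: sumr_ge0 => g _; rewrite exprn_ge0 ?normc_ge0.
rewrite (bigD1 (finfun f)) //= /a.
rewrite (_ : colsub (finfun f) A = colsub f A); last by apply/matrixP => i j; rewrite !mxE ffunE.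
by rewrite lerDl sumr_ge0 // => g _; rewrite exprn_ge0 ?normc_ge0.
Qed.

Section CorePerm.
Variables (F : numFieldType) (s : nat -> F) (p n l : nat) (J : 'I_(p + n) -> nat).
Hypotheses (J_inj : injective J) (J_core : forall j, exists i : 'I_(p + n), J j = core p i).

(** The sign of the permutation that sorts J occurs twice. *)
Lemma det_core_perm (y z : nat -> F) :
  \det ((\matrix_(j, v) psi s y (J j) v) *m (\matrix_(j, v) psi s z (J j) v : 'M[_]_(_, l))^T) =
  \det (corerows s p n l y *m (corerows s p n l z)^T).
Proof.
have [f fE] := fin_all_exists J_core.
have f_inj : injective f by move=> i j e; apply: J_inj; rewrite !fE e.
have E u : \matrix_(j, v) psi s u (J j) v = perm_mx (perm f_inj) *m corerows s p n l u.
  by rewrite -row_permE; apply/matrixP => i j; rewrite !mxE permE fE.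
rewrite !E det_mulmx_tr_factor det_perm.
by rewrite -expr2 -exprM mulnC exprM sqrrN expr1n expr1n mul1r.
Qed.

(** Compared with 0, .., p+n-1, the last n elements are larger by 1, 2, .., n. This excess is the
    multiplicity of the root 0 of Q in [mup0_YV]. *)
Lemma sum_core : (\sum_j J j)%N = ((n * n.+1)./2 + \sum_(j < p + n) j)%N.
Proof.
have [f fE] := fin_all_exists J_core.
have f_inj : injective f by move=> i j e; apply: J_inj; rewrite !fE e.
rewrite (eq_bigr _ (fun j _ => fE j)) -(@reindex_inj _ _ _ _ f xpredT (fun i => core p i) f_inj) /=.
rewrite !big_split_ord /= (eq_bigr (fun i : 'I_p => i : nat)); last first.
  by move=> i _; rewrite /core /= ltn_ord.
rewrite addnCA; congr addn.
elim: n => [|m IH]; first by rewrite !big_ord0.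
rewrite !big_ord_recr /= IH /core ifF; lia.
Qed.
End CorePerm.

(** * Limits of row spaces *)

Lemma evt_norm_ge (R : rcfType) (U : Type) (D : U -> Prop) (eta : R -> R)
    (f g : R -> U -> R[i]) (c : R) :
  (forall e, 0 < e -> evt D (fun r _ => 0 <= eta r <= e)) ->
  appx D eta f g -> 0 < c -> evt D (fun r u => c <= Normc.normc (g r u)) ->
  evt D (fun r u => c / 2 <= Normc.normc (f r u)).
Proof.
move=> eta0 [K [K0 H]] c0 Hc.
have e0 : 0 < c / 2 / (K + 1) by rewrite !divr_gt0 // ltr_wpDl.
apply: evt_imp (evt_and (eta0 _ e0) (evt_and H Hc)) => r u _ [/andP [e1 e2] [[_ fg] cg]].
have : K * eta r <= c / 2.
  apply: (@le_trans _ _ ((K + 1) * (c / 2 / (K + 1)))); first by rewrite ler_pM // lerDl.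
  by rewrite mulrC divfK // gt_eqF // ltr_wpDl.
have := le_normcD (f r u) (g r u - f r u); rewrite addrCA subrr addr0.
rewrite -(normcN (g r u - f r u)) opprB.
move: (Normc.normc (g r u)) (Normc.normc (f r u)) (Normc.normc (f r u - g r u)) cg fg => a b d.
by lra.
Qed.

Lemma unitmx_diag_factor (F : fieldType) n (a b : 'rV[F]_n) (A : 'M[F]_n) :
  \det (diag_mx a *m A *m diag_mx b) != 0 -> A \in unitmx.
Proof.
by rewrite !det_mulmx unitmxE unitfE; apply: contraNneq => ->; rewrite mulr0 mul0r.
Qed.

Lemma unitmx_scale (F : fieldType) n (a : F) (A : 'M[F]_n) :
  a != 0 -> A \in unitmx -> a *: A \in unitmx.
Proof. by rewrite !unitmxE !unitfE detZ => a0 A0; rewrite mulf_neq0 ?expf_neq0. Qed.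

Section RowLimit.
Variables (R : rcfType) (U : Type) (D : U -> Prop) (eta : R -> R).
Hypothesis eta0 : forall e, 0 < e -> evt D (fun r _ => 0 <= eta r <= e).
Variables (N L : nat) (X : R -> 'M[R[i]]_(N, L)) (X0 : 'M[R[i]]_(N, L)).
Variables (om : R -> R[i]) (w : nat -> nat) (lam : 'I_N -> nat) (J : 'I_N -> 'I_L).
Hypothesis om1 : evt D (fun r _ => 1 <= Normc.normc (om r)).
Let eta01 := eta0 ltr01.

Let W r : 'M[R[i]]_(N, L) := \matrix_(i, k) (X r i k * om r ^+ w k / om r ^+ lam i).
Hypothesis XW : appx_mx D eta (fun r _ => W r) (fun _ _ => X0).
Hypothesis X0J : \det (colsub J X0) != 0.
Hypothesis J_inj : injective J.
Hypothesis wJ : forall j k, (forall j', k != J j') ->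
  (w (J j) < w k)%N \/
  [/\ w (J j) = (w k).+1, (invmx (colsub J X0) *m X0) j k = 0 &
     evt D (fun r _ => eta r * Normc.normc (om r) ^+ 2 <= 1)].

Let WJ : appx_mx D eta (fun r _ => colsub J (W r)) (fun _ _ => colsub J X0).
Proof.
move=> i j; apply: (appx_eq (XW i (J j))) => r u; by rewrite mxE.
Qed.

Let detW : evt D (fun r _ => Normc.normc (\det (colsub J X0)) / 2 <= Normc.normc (\det (colsub J (W r)))).
Proof.
apply: (evt_norm_ge eta0 (appx_det eta01 WJ)); first by rewrite normc_gt0.
by apply: evt_all.
Qed.

Let om_neq0 r : 1 <= Normc.normc (om r) -> om r != 0.
Proof. by move=> h; rewrite -normc_gt0 (lt_le_trans ltr01). Qed.

Let WE r : 1 <= Normc.normc (om r) -> colsub J (W r) =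
  diag_mx (\row_i (om r ^+ lam i)^-1) *m colsub J (X r) *m diag_mx (\row_j om r ^+ w (J j)).
Proof.
move=> h; apply/matrixP => i j; rewrite mul_diag_mx mul_mx_diag !mxE; ring.
Qed.

Lemma colsub_unit : evt D (fun r _ => colsub J (X r) \in unitmx).
Proof.
apply: evt_imp (evt_and detW om1) => r u _ [dW o1].
have : \det (colsub J (W r)) != 0.
  by rewrite -normc_gt0; apply: lt_le_trans dW; rewrite divr_gt0 // normc_gt0.
rewrite (WE o1); exact: unitmx_diag_factor.
Qed.

Let WZ : appx_mx D eta (fun r _ => invmx (colsub J (W r)) *m W r)
  (fun _ _ => invmx (colsub J X0) *m X0).
Proof.
have E (A : 'M[R[i]]_N) (B : 'M[_]_(N, L)) j k : \det A != 0 ->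
    (invmx A *m B) j k = (\det A)^-1 * (\adj A *m B) j k.
  by move=> dA; rewrite /invmx unitmxE unitfE dA -scalemxAl mxE.
move=> j k.
have dV : appx D eta (fun r _ => (\det (colsub J (W r)))^-1) (fun _ _ => (\det (colsub J X0))^-1).
  apply: (appxV (c := Normc.normc (\det (colsub J X0)) / 2) eta01).
  - by rewrite divr_gt0 // normc_gt0.
  - by apply: evt_all => _ _ _; rewrite ler_pdivrMr // ler_peMr ?normc_ge0 // ler1n.
  - exact: detW.
  exact: (appx_det eta01 WJ).
have := appxM eta01 dV (appx_mulmx eta01 (appx_adj eta01 WJ) XW j k).
move/appx_ext; apply; apply: evt_imp detW => r u _ dW.
rewrite !E // -normc_gt0; apply: lt_le_trans dW.
by rewrite divr_gt0 // normc_gt0.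
Qed.

Let XE r : 1 <= Normc.normc (om r) -> colsub J (X r) \in unitmx ->
  \det (colsub J (W r)) != 0 -> forall j k,
  (invmx (colsub J (X r)) *m X r) j k =
  (invmx (colsub J (W r)) *m W r) j k * om r ^+ w (J j) / om r ^+ w k.
Proof.
move=> o1 XJ dW j k.
pose Y : 'M[_]_(N, L) := \matrix_(j, k)
  ((invmx (colsub J (W r)) *m W r) j k * om r ^+ w (J j) / om r ^+ w k).
have o0 q : om r ^+ q != 0 by rewrite expf_neq0 // om_neq0.
suff : colsub J (X r) *m Y = X r.
  by have := mulKmx XJ Y => YE XY; rewrite XY in YE; rewrite YE mxE.
have YE : Y = diag_mx (\row_j om r ^+ w (J j)) *m (invmx (colsub J (W r)) *m W r) *m
    diag_mx (\row_k (om r ^+ w k)^-1).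
  by apply/matrixP => a b; rewrite mul_mx_diag mul_diag_mx !mxE mulrAC mulrC; ring.
have XJE : colsub J (X r) = diag_mx (\row_i (om r ^+ lam i)) *m colsub J (W r) *m
    diag_mx (\row_j (om r ^+ w (J j))^-1).
  by apply/matrixP => a b; rewrite mul_mx_diag mul_diag_mx !mxE; field; rewrite !o0.
have DD : diag_mx (\row_j (om r ^+ w (J j))^-1) *m diag_mx (\row_j om r ^+ w (J j)) = 1%:M.
  by apply/matrixP => a b; rewrite mul_diag_mx !mxE mulrnAr mulVf.
rewrite YE XJE !mulmxA -[_ *m diag_mx _ *m diag_mx _]mulmxA DD mulmx1.
rewrite -[_ *m invmx _]mulmxA mulmxV ?mulmx1; last by rewrite unitmxE unitfE.
by apply/matrixP => a b; rewrite mul_mx_diag mul_diag_mx !mxE; field; rewrite !o0.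
Qed.

(** In X_J^-1 X the row scaling cancels and the column scaling leaves om^(w (J j) - w k) on entry
    (j, k): decay when k is heavier. In the second case of [wJ], column k is lighter by one, but the
    limit entry is 0, so only the error eta remains, and eta |om| is at most |om|^-1. *)
Lemma row_limit :
  appx_mx D (fun r => (Normc.normc (om r))^-1)
    (fun r _ => invmx (colsub J (X r)) *m X r) (fun _ _ => \matrix_(j, k) (k == J j)%:R).
Proof.
have oV01 : evt D (fun r _ => 0 <= (Normc.normc (om r))^-1 <= 1).
  by apply: evt_imp om1 => r _ _ o1; rewrite invr_ge0 normc_ge0 /= invf_le1 // (lt_le_trans ltr01).
move=> j k; case: (pickP (fun j' => k == J j')) => [j' /eqP ->|nJ].
  apply: (@appx_ext _ _ _ _ (fun _ _ => (J j' == J j)%:R) _ (fun _ _ => (J j' == J j)%:R)).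
    exact: appx_cst.
  apply: evt_imp colsub_unit => r _ _ XJ; split; last by rewrite mxE.
  transitivity ((invmx (colsub J (X r)) *m colsub J (X r)) j j').
    by rewrite !mxE; apply: eq_bigr => q _; rewrite !mxE.
  by rewrite mulVmx // mxE (inj_eq J_inj) eq_sym.
have kJ : forall j', k != J j' by move=> j'; rewrite nJ.
have [K HK] : exists K, evt D (fun r _ =>
    Normc.normc ((invmx (colsub J (X r)) *m X r) j k) <= K * (Normc.normc (om r))^-1).
  have [K0 [K00 HK0]] := WZ j k.
  have H := evt_and (evt_and om1 HK0) (evt_and colsub_unit detW).
  have dn r : Normc.normc (\det (colsub J X0)) / 2 <= Normc.normc (\det (colsub J (W r))) ->
      \det (colsub J (W r)) != 0.
    by move=> d; rewrite -normc_gt0; apply: lt_le_trans d; rewrite divr_gt0 // normc_gt0.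
  case: (wJ j kJ) => [wlt|[weq Z0 etaom]].
    exists (K0 + K0); move: eta01 => /(evt_and H).
    apply: evt_imp => r u _ [ [ [ o1 [Zb ZZ]] [XJ /dn dW]] /andP [e0 e1]].
    rewrite XE // !Normc.normcM Normc.normcV !normcX.
    set o := Normc.normc (om r) in o1 *; have o0 : 0 < o := lt_le_trans ltr01 o1.
    have -> : w k = (w (J j) + (w k - w (J j)).-1.+1)%N by rewrite prednK ?subn_gt0 // subnKC // ltnW.
    rewrite exprD exprS; move: (_.-1) => q.
    rewrite !invfM -mulrA mulVKf; last by rewrite expf_neq0 // gt_eqF.
    rewrite ler_pM ?normc_ge0 ?mulr_ge0 ?invr_ge0 ?exprn_ge0 ?(ltW o0) //.
      rewrite -[X in Normc.normc X](subrK ((invmx (colsub J X0) *m X0) j k)).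
      apply: le_trans (le_normcD _ _) _; rewrite lerD //.
      by apply: le_trans ZZ _; rewrite ler_piMr.
    by rewrite ler_piMr ?invr_ge0 ?(ltW o0) // invf_le1 ?exprn_gt0 // exprn_ege1.
  exists K0; apply: evt_imp (evt_and H etaom) => r u _ [ [ [ o1 [Zb ZZ]] [XJ /dn dW]] eo].
  rewrite XE // !Normc.normcM Normc.normcV !normcX.
  set o := Normc.normc (om r) in o1 eo *; have o0 : 0 < o := lt_le_trans ltr01 o1.
  move: ZZ; rewrite Z0 subr0 => ZZ.
  rewrite weq exprS mulrA mulfK; last by rewrite expf_neq0 // gt_eqF.
  rewrite ler_pdivlMr // -mulrA -expr2.
  apply: le_trans (_ : K0 * eta r * o ^+ 2 <= _); first by rewrite ler_wpM2r // exprn_ge0 // ltW.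
  by rewrite -mulrA ler_piMr.
have := appx_O oV01 HK; move/appx_eq; apply => r u //.
by rewrite mxE (negbTE (kJ j)).
Qed.
End RowLimit.

(** * Falling factorials and weights *)

Section FallingFactorials.
Variable F : numFieldType.

Let ffpoly (k : nat) : {poly F} := \prod_(t <- iota 0 k) ('X - (t%:R)%:P).

Let horner_ffpoly k l : (ffpoly k).[l%:R] = (l ^_ k)%:R.
Proof.
rewrite /ffpoly; elim: k => [|k IH]; first by rewrite big_nil hornerC ffactn0.
rewrite -addn1 iotaD big_cat /= big_seq1 hornerM IH hornerXsubC addn1 ffactnSr natrM.
case: (leqP k l) => [kl|lk]; first by rewrite natrB.
by rewrite ffact_small ?mul0r.
Qed.

(** Falling factorials of order k < n are polynomials of degree below n, so a combination that
    vanishes at n points is the zero polynomial. *)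
Lemma ffact_free (n : nat) (l : nat -> nat) (b : nat -> F) :
  (forall i j, (i < n)%N -> (j < n)%N -> l i = l j -> i = j) ->
  (forall i, (i < n)%N -> \sum_(k < n) b k * (l i ^_ k)%:R = 0) ->
  forall k, (k < n)%N -> b k = 0.
Proof.
move=> l_inj lb.
pose g := \sum_(k < n) b k *: ffpoly k.
have gE q : g.[q%:R] = \sum_(k < n) b k * (q ^_ k)%:R.
  by rewrite horner_sum; apply: eq_bigr => k _; rewrite hornerZ horner_ffpoly.
have g0 : g = 0.
  apply: (roots_geq_poly_eq0 (rs := [seq (l i)%:R | i <- iota 0 n])).
  - rewrite all_map; apply/allP => i; rewrite mem_iota => /= ni.
    by rewrite /root gE lb.
  - rewrite map_inj_in_uniq ?iota_uniq // => i j; rewrite !mem_iota /= => ni nj /eqP.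
    by rewrite eqr_nat => /eqP; apply: l_inj.
  rewrite size_map size_iota; apply: (leq_trans (size_sum _ _ _)).
  apply/bigmax_leqP => k _; apply: (leq_trans (size_scale_leq _ _)).
  by rewrite size_prod_XsubC size_iota.
(* At the point k the falling factorials of larger order vanish and those of smaller order have
   coefficient 0 by induction, which isolates b k. *)
move=> k; elim/ltn_ind: k => k IH kn.
have := gE k; rewrite g0 horner0 (bigD1 (Ordinal kn)) //= big1 => [|j /eqP jk].
  by rewrite addr0 ffactnn => /esym/eqP; rewrite mulf_eq0 pnatr_eq0 eqn0Ngt fact_gt0 orbF => /eqP.
case: (ltngtP j k) => [jlt|jgt|e]; first by rewrite IH ?mul0r // ltn_ord.
  by rewrite ffact_small // mulr0.
by case: jk; apply: val_inj.
Qed.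

Lemma inv_fact_ffact l k : (if (k <= l)%N then (l - k)`!%:R^-1 else 0) = (l ^_ k)%:R / l`!%:R :> F.
Proof.
have nz q : q`!%:R != 0 :> F by rewrite pnatr_eq0 -lt0n fact_gt0.
case: leqP => [kl|lk]; last by rewrite ffact_small // mul0r.
by rewrite -(ffact_fact kl) natrM invfM mulrA divff ?mul1r // pnatr_eq0 -lt0n ffact_gt0.
Qed.

(** Multiplying row i by (l i)! turns the entries into falling factorials of l i, a Vandermonde
    matrix up to unipotent column operations. *)
Lemma det_inv_fact (n : nat) (l : 'I_n -> nat) : injective l ->
  \det (\matrix_(i, k < n) (if (k <= l i)%N then (l i - k)`!%:R^-1 else 0)) != 0 :> F.
Proof.
move=> l_inj; rewrite -det_tr; apply/det0P => -[v v0 vA]; case/negP: v0.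
pose l' q := if insub q is Some i then l i else 0%N.
have l'E (i : 'I_n) : l' i = l i by rewrite /l' valK.
pose b q := if insub q is Some i then v 0 i else 0.
have bE (i : 'I_n) : b i = v 0 i by rewrite /b valK.
apply/eqP/rowP => k; rewrite -bE mxE.
apply: (@ffact_free n l' b) => // [i j ni nj|i ni].
  have := l'E (Ordinal ni); have := l'E (Ordinal nj); rewrite /= => -> -> /l_inj e.
  exact: (congr1 val e).
have fnz : (l (Ordinal ni))`!%:R^-1 != 0 :> F.
  by rewrite invr_eq0 pnatr_eq0 -lt0n fact_gt0.
have /rowP /(_ (Ordinal ni)) := vA; rewrite !mxE => e.
have := l'E (Ordinal ni); rewrite /= => ->.
apply: (mulIf fnz); rewrite mul0r -[RHS]e mulr_suml; apply: eq_bigr => q _.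
by rewrite !mxE inv_fact_ffact bE mulrA.
Qed.
End FallingFactorials.

Section Weights.
Variable m : nat.
Hypothesis m0 : (0 < m)%N.
Local Notation T := m.*2.+1.

(* [wt] halves the residue modulo [2m+1] and keeps the quotient. *)
Definition wt k := ((if odd (k %% T) then m.+1 + (k %% T)./2 else (k %% T)./2) + k %/ T * T)%N.
(** As [wt] is a bijection of the natural numbers, this is the only column of weight j, and j < N
    runs through the N lightest columns. *)
Definition wtinv j := ((if j %% T <= m then (j %% T).*2 else (j %% T).*2 - T) + j %/ T * T)%N.

Let decomp k : exists q r, (r < T)%N /\ k = (q * T + r)%N.
Proof. by exists (k %/ T)%N, (k %% T)%N; rewrite ltn_mod -divn_eq. Qed.

Lemma wtE q r : (r < T)%N -> wt (q * T + r) = ((if odd r then m.+1 + r./2 else r./2) + q * T)%N.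
Proof. by move=> rT; rewrite /wt modnMDl modn_small // divnMDl // divn_small // addn0. Qed.

Lemma wtinvE q r : (r < T)%N -> wtinv (q * T + r) = ((if (r <= m)%N then r.*2 else r.*2 - T) + q * T)%N.
Proof. by move=> rT; rewrite /wtinv modnMDl modn_small // divnMDl // divn_small // addn0. Qed.

Lemma wtinvK : cancel wtinv wt.
Proof.
move=> j; have [q [r [rT ->]]] := decomp j; rewrite wtinvE // addnC wtE; last by case: ifP; lia.
by case: (leqP r m) => h1; case: ifP => h2; lia.
Qed.

Lemma wtK : cancel wt wtinv.
Proof.
move=> j; have [q [r [rT ->]]] := decomp j; rewrite wtE // addnC wtinvE; last by case: ifP; lia.
by case: (boolP (odd r)) => h1; case: ifP => h2; lia.
Qed.

Lemma wtinv_le j : (wtinv j <= j.*2)%N.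
Proof. by have [q [r [rT ->]]] := decomp j; rewrite wtinvE //; case: ifP => h; lia. Qed.

Lemma wt_sub a : (T <= a)%N -> wt a = (wt (a - T) + T)%N.
Proof.
have [q [r [rT ->]]] := decomp a; case: q => [|q] aT; first by lia.
rewrite (_ : (_ - T)%N = (q * T + r)%N); last by lia.
by rewrite !wtE //; lia.
Qed.

(** A parameter of degree p > 2m+1 is as large as the one of degree 2m+1, namely om^(2m+1); this
    inequality makes it negligible. If the quotient drops by one, the residue also drops by the even
    number p - (2m+1), with the same parity. If it drops by two or more, the weights differ by at
    least 2(2m+1) - 2m. *)
Lemma wt_sub_odd a p : odd p -> (T < p <= a)%N -> (wt (a - p) + T < wt a)%N.
Proof.
move=> op /andP [Tp pa]; have [q [r [rT aE]]] := decomp a; have [q' [r' [rT' aE']]] := decomp (a - p).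
rewrite aE' aE !wtE //.
have qq : (q' < q)%N by rewrite ltnNge; apply/negP => qq; have := leq_mul qq (leqnn T); lia.
have [e|qq'] : q = q'.+1 \/ (q'.+1 < q)%N by lia.
  have E : (r = r' + (p - T))%N by rewrite e mulSn in aE; lia.
  have oE : odd r = odd r' by rewrite E oddD oddB ?op /= ?odd_double ?addbF // ltnW.
  by rewrite oE e mulSn; case: ifP => h; lia.
by have := leq_mul qq' (leqnn T); do 2!case: ifP; lia.
Qed.

(** Makes the mu term of the seed matrix negligible: it costs at most 2m in weight, while mu has
    size om^-(2m+1). *)
Lemma wt_succ a : (wt a.+1 <= wt a + m.*2)%N.
Proof.
have [q [r [rT ->]]] := decomp a; have [rT'|rE] : (r.+1 < T)%N \/ r = m.*2 by lia.
  by rewrite -addnS !wtE //; do 2!case: ifP; lia.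
rewrite rE (_ : (_ + _).+1 = (q.+1 * T + 0)%N); last by lia.
by rewrite !wtE //=; case: ifP; lia.
Qed.

Lemma wt_mod_lt k j : (k %% T = j %% T)%N -> (wt k < wt j)%N -> (k < j)%N.
Proof.
have [q [r [rT ->]]] := decomp k; have [q' [r' [rT' ->]]] := decomp j.
rewrite !modnMDl !modn_small // => rr; subst r'; rewrite !wtE // ltn_add2l ltn_pmul2r // => qq.
by rewrite ltn_add2r ltn_pmul2r.
Qed.

(** Write N-1 = Q(2m+1) + S. The complete blocks contribute every column below Q(2m+1). In the last
    block the doubled residues are 0, 2, .., 2S if S <= m. Otherwise they are all the even ones and
    1, 3, .., 2S - (2m+1), which fill an initial segment and leave 2m - S isolated even residues
    above it. *)
Lemma wtinv_core N j : (j < N)%N -> (0 < N)%N ->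
  let n := let r := (N.-1 %% T)%N in if (r <= m)%N then r else (m.*2 - r)%N in
  (n <= N)%N /\ exists2 i, (i < N)%N & wtinv j = core (N - n) i.
Proof.
move=> jN N0 n.
have [q [r [rT jE]]] := decomp j; have [Q [S [ST NE]]] := decomp N.-1.
have nE : n = if (S <= m)%N then S else (m.*2 - S)%N.
  by rewrite /n NE modnMDl modn_small.
have NE' : N = (Q * T + S).+1 by lia.
have nN : (n <= N)%N by rewrite nE; case: ifP; lia.
split => //; rewrite jE wtinvE //.
have qQ : (q <= Q)%N by rewrite leqNgt; apply/negP => qq; have := leq_mul qq (leqnn T); lia.
set k := (_ + _)%N; have kE : k = ((if (r <= m)%N then r.*2 else r.*2 - T) + q * T)%N by [].
clearbody k; have [p pE] : exists p, p = (N - n)%N by exists (N - n)%N.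
rewrite -pE; case: (ltnP k p) => kp.
  by exists k; rewrite /core ?kp //; lia.
have e : q = Q.
  case: (ltnP q Q) => qq; last by lia.
  have := leq_mul qq (leqnn T); rewrite mulSn => qq'.
  by case: (leqP r m) kE => h1 kE; case: (leqP S m) nE => h2 nE; lia.
subst q; exists (p + (k - p)./2)%N; rewrite /core ?ifF; try lia;
  by case: (leqP r m) kE => h1 kE; case: (leqP S m) nE => h2 nE; lia.
Qed.
End Weights.

Lemma sum_residue (V : nmodType) (N n T s : nat) (f : nat -> V) : (s < T)%N ->
  (forall k, (k * T + s < N)%N = (k < n)%N) ->
  (forall j, (j < N)%N -> (j %% T)%N <> s -> f j = 0) ->
  \sum_(j < N) f j = \sum_(k < n) f (k * T + s)%N.
Proof.
move=> sT nE f0; rewrite (bigID (fun j : 'I_N => (j %% T)%N == s)) /=.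
rewrite [X in _ + X]big1 ?addr0; last by move=> j /eqP; apply: f0.
case: n nE => [|n] nE.
  rewrite big_ord0 big1 // => j /eqP js; have := nE (j %/ T)%N.
  by rewrite -js -divn_eq ltn_ord.
pose h (k : 'I_n.+1) : 'I_N := Ordinal (etrans (nE k) (ltn_ord k)).
rewrite (reindex_onto h (fun j => inord (j %/ T))) /=; last first.
  move=> j /eqP js; have jn : (j %/ T < n.+1)%N by rewrite -nE -js -divn_eq.
  by apply: val_inj; rewrite /= inordK // -js -divn_eq.
apply: eq_bigl => k; rewrite modnMDl modn_small // eqxx /=.
by apply/eqP/val_inj; rewrite /= divnMDl ?(leq_ltn_trans _ sT) // divn_small // addn0 inordK.
Qed.

Section HomogeneousLimit.
Variables (F : numFieldType) (m N L : nat) (c : F).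
Hypothesis c0 : c != 0.
Local Notation T := m.*2.+1.
Let natU := @natU_num F.

(* The seed matrix when b has c in degree 2m+1 as its only parameter and mu = 0. *)
Definition homog : 'M[F]_(N, L) := \matrix_(i, k)
  if (k <= i.*2)%N then schur (fun j => if j == T then c else 0) (i.*2 - k) else 0.

Lemma homog_eq0 (i : 'I_N) (k : 'I_L) : homog i k != 0 -> (k = i.*2 %[mod T])%N.
Proof.
rewrite mxE; case: leqP => [ki|]; last by rewrite eqxx.
rewrite (schur_single natU) //; case: ifP => [d _|]; last by rewrite eqxx.
by apply/eqP; rewrite eq_sym eqn_mod_dvd.
Qed.

Let double_mod s : (s < T)%N -> (s.*2 %% T = if s <= m then s.*2 else s.*2 - T)%N.
Proof.
move=> sT; case: (leqP s m) => sm; first by rewrite modn_small // ltnS leq_double.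
have Ts : (T <= s.*2)%N by lia.
by rewrite -{1}(subnK Ts) modnDr modn_small //; lia.
Qed.

Let mod_double_inj j k : (j.*2 = k.*2 %[mod T])%N -> (j = k %[mod T])%N.
Proof.
have E x : (x.*2 %% T = (x %% T).*2 %% T)%N by rewrite -!muln2 modnMml.
rewrite (E j) (E k) !double_mod ?ltn_mod //.
have := ltn_pmod j (ltn0Sn m.*2); have := ltn_pmod k (ltn0Sn m.*2).
move: (j %% T)%N (k %% T)%N => a b ha hb.
by case: leqP => h1; case: leqP => h2; lia.
Qed.

(** The balance behind the weights: the j-th lightest column has the residue of 2j, the degree
    attached to row j. *)
Lemma wtinv_mod j : (wtinv m j = j.*2 %[mod T])%N.
Proof.
have [q [r [rT ->]]] : exists q r, (r < T)%N /\ j = (q * T + r)%N.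
  by exists (j %/ T)%N, (j %% T)%N; rewrite ltn_mod -divn_eq.
rewrite wtinvE // addnC modnMDl.
have -> : ((q * T + r).*2 = q.*2 * T + r.*2)%N by rewrite doubleD doubleMl.
by rewrite modnMDl -(double_mod rT) modn_mod.
Qed.

(** The matrix splits into square blocks by the residue s of the row index. In block s, with h the
    quotient of 2s by 2m+1, row q and column k carry c^(l-k)/(l-k)! where l = 2q + h. A vector of
    the kernel is therefore killed by [ffact_free]. *)
Lemma det_homog (J : 'I_N -> 'I_L) : (forall j, J j = wtinv m j :> nat) ->
  \det (colsub J homog) != 0.
Proof.
move=> JE; rewrite -det_tr; apply/det0P => -[v v0 vA]; case/negP: v0.
apply/eqP/rowP => j0; rewrite [RHS]mxE.
pose vn q : F := if insub q is Some i then v 0 i else 0.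
have vE (j : 'I_N) : vn j = v 0 j by rewrite /vn valK.
pose s := (j0 %% T)%N; pose k0 := (j0 %/ T)%N.
have sT : (s < T)%N by rewrite ltn_mod.
have jE : (j0 = k0 * T + s :> nat)%N by rewrite -divn_eq.
have sN : (s <= N.-1)%N by have := ltn_ord j0; lia.
pose n := ((N.-1 - s) %/ T).+1.
have nE k : (k * T + s < N)%N = (k < n)%N.
  rewrite ltnS leq_divRL //; have := ltn_ord j0.
  by move: (k * T)%N => kT ?; apply/idP/idP; lia.
pose h := (s.*2 %/ T)%N; pose rho := (s.*2 %% T)%N.
have rhoE : rho = (if s <= m then s.*2 else s.*2 - T)%N by apply: double_mod.
have rhoT : (rho < T)%N by rewrite ltn_mod.
have sE : (s.*2 = h * T + rho)%N by rewrite /h /rho -divn_eq.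
have entry q k (i j : 'I_N) : i = (q * T + s)%N :> nat -> j = (k * T + s)%N :> nat ->
    homog i (J j) = c ^+ (q.*2 + h) / (q.*2 + h)`!%:R * (c ^- k * ((q.*2 + h) ^_ k)%:R).
  move=> iE jE'; rewrite mxE JE.
  have -> : wtinv m j = (k * T + rho)%N.
    by rewrite jE' wtinvE // addnC rhoE.
  have -> : (i.*2 = (q.*2 + h) * T + rho)%N by rewrite iE doubleD doubleMl sE addnA -mulnDl.
  move: (q.*2 + h)%N => l; rewrite leq_add2r leq_pmul2r // subnDr -mulnBl (schur_single natU) // dvdn_mull // mulnK //.
  have := inv_fact_ffact F l k; case: leqP => kl E; last first.
    by rewrite ffact_small // mulr0 mulr0.
  have lE : c ^+ l = c ^+ (l - k) * c ^+ k by rewrite -exprD subnK.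
  by rewrite E lE; field; rewrite expf_neq0 // pnatr_eq0 -lt0n fact_gt0.
pose b k := vn (k * T + s)%N * c ^- k.
have b0 k : (k < n)%N -> b k = 0.
  apply: (@ffact_free F n (fun q => q.*2 + h)%N); first by move=> i j _ _ /addIn /double_inj.
  move=> q qn; have qN : (q * T + s < N)%N by rewrite nE.
  have /rowP /(_ (Ordinal qN)) := vA; rewrite !mxE => vAq.
  set l := (q.*2 + h)%N.
  have lnz : c ^+ l / l`!%:R != 0.
    by rewrite mulf_neq0 ?expf_neq0 // invr_eq0 pnatr_eq0 -lt0n fact_gt0.
  pose f j := if insub j is Some i then v 0 i * homog (Ordinal qN) (J i) else 0.
  have fE (j : 'I_N) : f j = v 0 j * homog (Ordinal qN) (J j) by rewrite /f valK.
  apply: (mulfI lnz); rewrite mulr0 -[RHS]vAq.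
  transitivity (\sum_(j < N) f j); last first.
    by apply: eq_bigr => j _; rewrite fE !mxE.
  rewrite (sum_residue sT nE); last first.
    move=> j jN js; rewrite -[j]/(val (Ordinal jN)) fE.
    case: (eqVneq (homog (Ordinal qN) (J (Ordinal jN))) 0) => [->|/homog_eq0]; first by rewrite mulr0.
    rewrite JE wtinv_mod /= => /mod_double_inj e; case: js.
    by rewrite e modnMDl modn_small.
  rewrite mulr_sumr; apply: eq_bigr => t _.
  have tN : (t * T + s < N)%N by rewrite nE.
  rewrite -[(t * T + s)%N]/(val (Ordinal tN)) fE (entry q t) //= /b -[(t * T + s)%N]/(val (Ordinal tN)) vE -/l.
  ring.
have k0n : (k0 < n)%N by rewrite -nE -jE.
have := b0 k0 k0n; rewrite /b -jE vE => /eqP.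
by rewrite mulf_eq0 invr_eq0 expf_eq0 (negbTE c0) andbF orbF => /eqP.
Qed.
End HomogeneousLimit.

(** * Asymptotics of the seed matrix *)

Section Asymptotics.
Variables (R : rcfType) (U : Type) (D : U -> Prop) (m : nat).
Hypothesis m0 : (0 < m)%N.
Local Notation T := m.*2.+1.
Variables (om : R -> R[i]) (mu : R -> R[i]).
Let natU := @natU_num (R[i] : numFieldType).

Section NearOrigin.
Variables (c : nat -> R[i]) (mu0 : R[i]).
Let eta r := (Normc.normc (om r))^-1.
Hypothesis om1 : evt D (fun r _ => 1 <= Normc.normc (om r)).
Hypothesis omT : evt D (fun r _ => om r ^+ T = r%:C).
Hypothesis muE : evt D (fun r _ => mu r * om r ^+ T = mu0).

Let eta01 : evt D (fun r _ => 0 <= eta r <= 1).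
Proof.
by apply: evt_imp om1 => r _ _ o1; rewrite invr_ge0 normc_ge0 /= invf_le1 // (lt_le_trans ltr01).
Qed.

Let om_neq0 r q : 1 <= Normc.normc (om r) -> om r ^+ q != 0.
Proof. by move=> h; rewrite expf_neq0 // -normc_gt0 (lt_le_trans ltr01). Qed.

Let om_ratio q q' : (q < q')%N -> appx D eta (fun r _ => om r ^+ q / om r ^+ q') (fun _ _ => 0).
Proof.
move=> qq; apply: (@appx_O _ _ _ _ eta01 _ 1).
apply: evt_imp om1 => r _ _ o1; rewrite mul1r /eta.
have -> : q' = (q + (q' - q).-1.+1)%N by lia.
rewrite exprD exprSr !invfM mulVKf ?om_neq0 // Normc.normcM !Normc.normcV normcX.
by rewrite ler_piMl ?invr_ge0 ?normc_ge0 // invf_le1 ?exprn_gt0 ?(lt_le_trans ltr01) // exprn_ege1.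
Qed.

(** The parameters left over at (x0, t0) when (star_j) holds for j < m: those of degree at least
    2m+1 are proportional to r = |A|. *)
Definition near_param r j : R[i] := if odd j && (T <= j)%N then c j./2 * r%:C else 0.

(** [wt] is not additive, so no rescaling of the parameters absorbs it and the power of om depends
    on both a and a - n. In Newton's recursion the term of degree 2m+1 reproduces the recursion of
    the limit by [wt_sub], and the terms of higher degree decay by [wt_sub_odd]. *)
Lemma near_schur n a : (n <= a)%N ->
  appx D eta (fun r _ => schur (near_param r) n * om r ^+ wt m (a - n) / om r ^+ wt m a)
    (fun _ _ => schur (fun j => if j == T then c m else 0) n).
Proof.
elim/ltn_ind: n a => -[|n] IH a na.
  apply: (appx_ext (appx_cst eta01 1)); apply: evt_imp om1 => r _ _ o1.
  by rewrite !schur0 subn0 mul1r divff ?om_neq0.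
have nz : n.+1%:R != 0 :> R[i] by rewrite pnatr_eq0.
pose y0 j := if j == T then c m else 0.
have SE (y : nat -> R[i]) : schur y n.+1 =
    n.+1%:R^-1 * \sum_(j < n.+1) j.+1%:R * y j.+1 * schur y (n.+1 - j.+1).
  by rewrite -(schur_newton natU) mulKf.
suff H : appx D eta (fun r _ => n.+1%:R^-1 * \sum_(j < n.+1) j.+1%:R * near_param r j.+1 *
      schur (near_param r) (n.+1 - j.+1) * om r ^+ wt m (a - n.+1) / om r ^+ wt m a)
    (fun _ _ => n.+1%:R^-1 * \sum_(j < n.+1) j.+1%:R * y0 j.+1 * schur y0 (n.+1 - j.+1)).
  by apply: (appx_eq H) => r u; rewrite SE // -mulrA -[LHS]mulrA; congr (_ * _);
    rewrite mulr_suml; apply: eq_bigr => j _; rewrite mulrA.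
apply: (appxZ eta01); apply: (appx_sum eta01) => j _.
have jn := ltn_ord j.
have [e|ne] := eqVneq j.+1 T.
  have Ha : (T <= a)%N by rewrite -e; lia.
  have := IH (n.+1 - T)%N _ (a - T)%N _; move=> /(_ _ _)H.
  have {}H := H ltac:(lia) ltac:(lia).
  have := appxZ eta01 (T%:R * c m) H; move/appx_ext; apply.
  apply: evt_imp (evt_and om1 omT) => r _ _ [ o1 oT].
  have Th : T./2 = m by rewrite /= uphalf_double.
  have To : odd T by rewrite /= odd_double.
  rewrite /y0 /near_param e eqxx leqnn To Th /= -oT (wt_sub m0 Ha).
  rewrite (_ : (a - T - (n.+1 - T))%N = (a - n.+1)%N); last by lia.
  split => //; rewrite exprD; have := om_neq0 T o1; have := om_neq0 (wt m (a - T)) o1.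
  move: (om r ^+ T) (om r ^+ wt m (a - T)) => z x x0 z0; field.
  by rewrite x0 z0.
have y0E : y0 j.+1 = 0 by rewrite /y0 (negbTE ne).
have [/andP [oj Tj]|h] := boolP (odd j.+1 && (T <= j.+1)%N); last first.
  apply: (appx_eq (appx_cst eta01 0)) => r _; rewrite ?y0E /near_param ?(negbTE h) ?mulr0 ?mul0r //.
have ja : (T < j.+1 <= a)%N by lia.
have := IH (n.+1 - j.+1)%N _ (a - j.+1)%N _; move=> /(_ _ _)H.
have {}H := H ltac:(lia) ltac:(lia).
have := appxM eta01 (appxZ eta01 (j.+1%:R * c j.+1./2) H) (om_ratio (wt_sub_odd m0 oj ja)).
move/appx_ext; apply; apply: evt_imp (evt_and om1 omT) => r _ _ [ o1 oT].
rewrite y0E !mulr0 mul0r; split => //.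
rewrite /near_param oj Tj /= -oT (_ : (a - j.+1 - (n.+1 - j.+1))%N = (a - n.+1)%N); last by lia.
rewrite exprD; have := om_neq0 T o1; have := om_neq0 (wt m (a - j.+1)) o1; have := om_neq0 (wt m a) o1.
move: (om r ^+ T) (om r ^+ wt m (a - j.+1)) (om r ^+ wt m a) => z x y x0 y0' z0 /=; field.
by rewrite x0 y0'.
Qed.

Lemma near_seed N L : appx_mx D eta
  (fun r _ => \matrix_(i < N, k < L) (seed (near_param r) (mu r) N L i k * om r ^+ wt m k / om r ^+ wt m i.*2))
  (fun _ _ => homog m N L (c m)).
Proof.
move=> i k.
have H1 : appx D eta (fun r _ =>
    (if (k <= i.*2)%N then schur (near_param r) (i.*2 - k) else 0) * om r ^+ wt m k / om r ^+ wt m i.*2)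
    (fun _ _ => homog m N L (c m) i k).
  case: (leqP k i.*2) => ki; last first.
    by apply: (appx_eq (appx_cst eta01 0)) => r _; rewrite ?mul0r // mxE leqNgt ki.
  have := near_schur (leq_subr k i.*2); rewrite subKn // => /appx_eq; apply => // r _.
  by rewrite mxE ki.
have H2 : appx D eta (fun r _ =>
    mu r * (if (k <= i.*2.+1)%N then schur (near_param r) (i.*2.+1 - k) else 0)
      * om r ^+ wt m k / om r ^+ wt m i.*2) (fun _ _ => 0).
  case: (leqP k i.*2.+1) => ki; last first.
    by apply: (appx_eq (appx_cst eta01 0)) => r _; rewrite ?mulr0 ?mul0r.
  have := near_schur (leq_subr k i.*2.+1); rewrite subKn // => H.
  have lt : (wt m i.*2.+1 < wt m i.*2 + T)%N by have := wt_succ m0 i.*2; lia.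
  have := appxM eta01 (appxZ eta01 mu0 H) (om_ratio lt).
  move/appx_ext; apply; apply: evt_imp (evt_and om1 muE) => r _ _ [ o1 mE].
  rewrite !mulr0; split => //; rewrite -mE exprD.
  have := om_neq0 T o1; have := om_neq0 (wt m i.*2) o1; have := om_neq0 (wt m i.*2.+1) o1.
  move: (om r ^+ T) (om r ^+ wt m i.*2) (om r ^+ wt m i.*2.+1) => z x y x0 y0 z0; field.
  by rewrite x0 y0 z0.
have H := appxD H1 H2.
apply: (appx_eq H) => r _; rewrite ?addr0 // !mxE.
by rewrite !mulrDl.
Qed.
End NearOrigin.

Section FarField.
Variables (mu0 : R[i]) (y : R -> nat -> R[i]) (y0 : nat -> R[i]) (N L : nat).
Let eta r := (Normc.normc (om r))^-2.
Hypothesis om1 : evt D (fun r _ => 1 <= Normc.normc (om r)).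
Hypothesis muE : evt D (fun r _ => mu r * om r ^+ T = mu0).
Hypothesis yE : forall j, (0 < j < N.*2)%N ->
  appx D eta (fun r _ => y r j / om r ^+ j) (fun _ _ => y0 j).

Let eta01 : evt D (fun r _ => 0 <= eta r <= 1).
Proof.
apply: evt_imp om1 => r _ _ o1; rewrite /eta.
by rewrite invr_ge0 exprn_ge0 ?normc_ge0 //= invf_le1 ?exprn_gt0 ?exprn_ege1 // (lt_le_trans ltr01).
Qed.

Let om_neq0 r q : 1 <= Normc.normc (om r) -> om r ^+ q != 0.
Proof. by move=> h; rewrite expf_neq0 // -normc_gt0 (lt_le_trans ltr01). Qed.

(** Here the weight is the degree, which is additive, so [schurZ] moves it into the parameters. *)
Lemma far_schur n : (n < N.*2)%N ->
  appx D eta (fun r _ => schur (y r) n / om r ^+ n) (fun _ _ => schur y0 n).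
Proof.
move=> nN.
have := @appx_schur _ _ _ _ eta01 (fun j r _ => y r j / om r ^+ j) (fun j _ _ => y0 j) n.
have yE' j : (0 < j <= n)%N -> appx D eta (fun r _ => y r j / om r ^+ j) (fun _ _ => y0 j).
  by move=> jn; apply: yE; lia.
move=> /(_ yE')/appx_ext; apply; apply: evt_imp om1 => r _ _ o1; split => //.
rewrite mulrC -exprVn -schurZ.
by apply: eq_schur => j _; rewrite exprVn mulrC.
Qed.

(** The mu term is of order om^(1-(2m+1)) = om^-2m, which is within the error |om|^-2 because m >=
    1. *)
Lemma far_seed : appx_mx D eta
  (fun r _ => \matrix_(i < N, k < L) (seed (y r) (mu r) N L i k * om r ^+ k / om r ^+ i.*2))
  (fun _ _ => \matrix_(i < N, k < L) if (k <= i.*2)%N then schur y0 (i.*2 - k) else 0).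
Proof.
move=> i k; have iN := ltn_ord i.
have H1 : appx D eta (fun r _ =>
    (if (k <= i.*2)%N then schur (y r) (i.*2 - k) else 0) * om r ^+ k / om r ^+ i.*2)
    (fun _ _ => if (k <= i.*2)%N then schur y0 (i.*2 - k) else 0).
  case: (leqP k i.*2) => ki; last first.
    by apply: (appx_eq (appx_cst eta01 0)) => r _; rewrite ?mul0r.
  have := @far_schur (i.*2 - k)%N ltac:(lia); move/appx_ext; apply.
  apply: evt_imp om1 => r _ _ o1; split => //.
  have -> : om r ^+ i.*2 = om r ^+ (i.*2 - k) * om r ^+ k by rewrite -exprD subnK.
  have := om_neq0 (i.*2 - k)%N o1; have := om_neq0 k o1.
  move: (om r ^+ k) (om r ^+ (i.*2 - k)) => z x x0 z0; field.
  by rewrite x0 z0.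
have H2 : appx D eta (fun r _ =>
    mu r * (if (k <= i.*2.+1)%N then schur (y r) (i.*2.+1 - k) else 0)
      * om r ^+ k / om r ^+ i.*2) (fun _ _ => 0).
  case: (leqP k i.*2.+1) => ki; last first.
    by apply: (appx_eq (appx_cst eta01 0)) => r _; rewrite ?mulr0 ?mul0r.
  have H := @far_schur (i.*2.+1 - k)%N ltac:(lia).
  have O : appx D eta (fun r _ => om r ^- m.*2) (fun _ _ => 0).
    apply: (@appx_O _ _ _ _ eta01 _ 1); apply: evt_imp om1 => r _ _ o1.
    rewrite mul1r Normc.normcV normcX /eta lef_pV2 ?posrE ?exprn_gt0 ?(lt_le_trans ltr01) //.
    by rewrite ler_weXn2l //; lia.
  have := appxM eta01 (appxZ eta01 mu0 H) O.
  move/appx_ext; apply; apply: evt_imp (evt_and om1 muE) => r _ _ [ o1 mE].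
  rewrite !mulr0; split => //; rewrite -mE.
  have -> : om r ^+ i.*2 = om r ^+ (i.*2.+1 - k) * om r ^+ k / om r.
    by rewrite -exprD subnK // exprSr mulfK // -[om r]expr1 om_neq0.
  rewrite exprS; have := om_neq0 m.*2 o1; have := om_neq0 k o1; have := om_neq0 1%N o1.
  have := om_neq0 (i.*2.+1 - k)%N o1; rewrite expr1.
  move: (om r ^+ m.*2) (om r ^+ k) (om r ^+ (i.*2.+1 - k)) (om r) => q1 q2 q3 q4 h1 h2 h3 h4; field.
  by rewrite h1 h2 h3 h4.
have H := appxD H1 H2.
apply: (appx_eq H) => r _; rewrite ?addr0 ?mxE // .
by rewrite !mulrDl.
Qed.
End FarField.
End Asymptotics.

Lemma natU_poly (F : numFieldType) (n : nat) : n.+1%:R \is a @GRing.unit {poly F}.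
Proof.
by rewrite poly_unitE -polyC_natr size_polyC coefC eqxx pnatr_eq0 unitfE pnatr_eq0.
Qed.

(** * Decay rates of rational functions of the large parameter *)

Section RationalDecay.
Variables (R : rcfType) (U : Type) (D : U -> Prop).
Let eta (r : R) := r^-1.

Lemma inv_eta0 e : 0 < e -> evt D (fun r _ => 0 <= eta r <= e).
Proof.
move=> e0; exists e^-1 => r er u _; have r0 : 0 < r by apply: lt_le_trans er; rewrite invr_gt0.
by rewrite /eta invr_ge0 ltW //= -[e]invrK lef_pV2 // posrE invr_gt0.
Qed.

Lemma evt_ge (a : R) : evt D (fun r _ => a <= r).
Proof. by exists a. Qed.

Let eta01 := inv_eta0 ltr01.

Lemma poly_leading (p : {poly R[i]}) :
  appx D eta (fun r _ => p.[r%:C] / r%:C ^+ (size p).-1) (fun _ _ => lead_coef p).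
Proof.
have [->|p0] := eqVneq p 0.
  by apply: (appx_eq (appx_cst eta01 0)) => r _; rewrite ?lead_coef0 // horner0 mul0r.
set d := (size p).-1; have sp : size p = d.+1 by rewrite prednK // size_poly_gt0.
have H : appx D eta (fun r _ => \sum_(i < d.+1) p`_i * (r%:C ^+ i / r%:C ^+ d))
    (fun _ _ => \sum_(i < d.+1) p`_i * (i == d :> nat)%:R).
  apply: (appx_sum eta01) => i _; apply: (appxZ eta01).
  have [e|ne] := eqVneq (i : nat) d.
    apply: (appx_ext (appx_cst eta01 1)); apply: evt_imp (evt_ge 1) => r _ _ r1.
    by rewrite e divff // expf_neq0 // -normc_gt0 normcR normr_gt0 gt_eqF // (lt_le_trans ltr01).
  apply: (@appx_O _ _ _ _ eta01 _ 1); apply: evt_imp (evt_ge 1) => r _ _ r1.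
  have r0 : 0 < r := lt_le_trans ltr01 r1.
  have id : (i < d)%N by have := ltn_ord i; lia.
  rewrite Normc.normcM Normc.normcV !normcX normcR gtr0_norm // mul1r /eta.
  have -> : r ^+ d = r ^+ i * (r ^+ (d - i).-1 * r).
    by rewrite -exprSr -exprD; congr (_ ^+ _); lia.
  rewrite !invfM mulVKf ?expf_neq0 ?gt_eqF //.
  by rewrite ler_piMl ?invr_ge0 ?(ltW r0) // invf_le1 ?exprn_gt0 // exprn_ege1.
apply: (appx_eq H) => r _.
  rewrite horner_coef sp mulr_suml; apply: eq_bigr => i _; by rewrite mulrA.
rewrite big_ord_recr /= eqxx mulr1 big1 ?add0r // => i _.
by rewrite lt_eqF ?mulr0 // ltEnat /=.
Qed.

(** A quotient p/q that tends to 0, however slowly, has deg p < deg q and so is O(1/r). This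
    upgrades the rate r^(-1/(2m+1)) supplied by [row_limit]. *)
Lemma rational_decay (p q : {poly R[i]}) (f : R -> U -> R[i]) (eta' : R -> R) :
  (exists u, D u) ->
  (forall e, 0 < e -> evt D (fun r _ => 0 <= eta' r <= e)) ->
  evt D (fun r u => f r u * q.[r%:C] = p.[r%:C]) -> q != 0 ->
  appx D eta' f (fun _ _ => 0) -> appx D eta f (fun _ _ => 0).
Proof.
move=> [u0 Du0] eta'0 fpq q0 f0.
have lq0 : 0 < Normc.normc (lead_coef q) by rewrite normc_gt0 lead_coef_eq0.
have Hq : evt D (fun r _ => Normc.normc (lead_coef q) / 2 <=
    Normc.normc (q.[r%:C] / r%:C ^+ (size q).-1)).
  apply: (evt_norm_ge inv_eta0 (poly_leading q)) => //; exact: evt_all.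
have [p0|p0] := eqVneq p 0.
  apply: (appx_ext (appx_cst eta01 0)); apply: evt_imp (evt_and fpq Hq) => r u _ [e hq].
  split => //; move/eqP: e; rewrite p0 horner0 mulf_eq0 => /orP[/eqP //|/eqP qr].
  by move: hq; rewrite qr mul0r Normc.normc0 leNgt divr_gt0.
have lp0 : 0 < Normc.normc (lead_coef p) by rewrite normc_gt0 lead_coef_eq0.
have Hp : evt D (fun r _ => Normc.normc (lead_coef p) / 2 <=
    Normc.normc (p.[r%:C] / r%:C ^+ (size p).-1)).
  apply: (evt_norm_ge inv_eta0 (poly_leading p)) => //; exact: evt_all.
have [Kq Hq'] := appx_bndl eta01 (poly_leading q).
have [Kp Hp'] := appx_bndl eta01 (poly_leading p).
have [K [K0 HK]] := f0.
pose dp := (size p).-1; pose dq := (size q).-1.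
have dpq : (dp < dq)%N.
  rewrite ltnNge; apply/negP => dqp.
  (* So small that, if deg p >= deg q, a single large r0 would give |lead p| / 2 <= |lead p| / 4. *)
  pose e := Normc.normc (lead_coef p) / 4 / (K * Num.max Kq 0 + 1).
  have KK0 : 0 <= K * Num.max Kq 0 by rewrite mulr_ge0 // le_max lexx orbT.
  have e0 : 0 < e by rewrite !divr_gt0 // ltr_wpDl.
  have [r0 H] := evt_and (evt_and (evt_and fpq Hp) (evt_and Hq' HK)) (evt_and (evt_ge 1) (eta'0 _ e0)).
  have [[[fr hp] [hq [_ hf]]] [r1 /andP [er0 er]]] := H r0 (lexx _) u0 Du0.
  have rp : 0 < r0 := lt_le_trans ltr01 r1.
  have xp n : 0 < r0 ^+ n by rewrite exprn_gt0.
  move: hp hq hf; rewrite subr0 -fr !Normc.normcM !Normc.normcV !normcX normcR (gtr0_norm rp) => hp hq hf.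
  have hq2 : Normc.normc q.[r0%:C] <= Num.max Kq 0 * r0 ^+ dp.
    apply: (@le_trans _ _ (Num.max Kq 0 * r0 ^+ dq)).
      by rewrite -ler_pdivrMr //; apply: le_trans hq _; rewrite le_max lexx.
    by rewrite ler_wpM2l ?le_max ?lexx ?orbT // ler_weXn2l.
  move: hp; rewrite ler_pdivlMr // => hp.
  have : Normc.normc (lead_coef p) / 2 * r0 ^+ dp <= K * e * (Num.max Kq 0 * r0 ^+ dp).
    apply: le_trans hp _; rewrite ler_pM ?normc_ge0 //.
    by apply: le_trans hf _; rewrite ler_wpM2l.
  rewrite mulrA ler_pM2r // => h.
  have : K * e * Num.max Kq 0 <= Normc.normc (lead_coef p) / 4.
    have -> : K * e * Num.max Kq 0 = (Normc.normc (lead_coef p) / 4) *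
       (K * Num.max Kq 0 / (K * Num.max Kq 0 + 1)) by rewrite /e; ring.
    rewrite ler_piMr ?divr_ge0 ?(ltW lp0) // ler_pdivrMr ?ltr_wpDl // mul1r; lra.
  by move: h lp0; lra.
apply: (@appx_O _ _ _ _ eta01 _ (Num.max Kp 0 / (Normc.normc (lead_coef q) / 2))).
apply: evt_imp (evt_and (evt_and fpq Hq) (evt_and Hp' (evt_ge 1))) => r u _ [[fr hq] [hp r1]].
have rp : 0 < r := lt_le_trans ltr01 r1.
have xp n : 0 < r ^+ n by rewrite exprn_gt0.
move: hp hq; rewrite -fr !Normc.normcM !Normc.normcV !normcX normcR (gtr0_norm rp).
rewrite -/dp -/dq ler_pdivrMr // ler_pdivlMr // => hp hq.
have qp : 0 < Normc.normc q.[r%:C] by apply: lt_le_trans hq; rewrite mulr_gt0 ?divr_gt0.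
rewrite -(ler_pM2r qp); apply: le_trans hp _.
apply: (@le_trans _ _ (Num.max Kp 0 * r ^+ dp)); first by rewrite ler_wpM2r ?(ltW (xp _)) // le_max lexx.
rewrite -mulrA -[leRHS]mulrA ler_wpM2l ?le_max ?lexx ?orbT // mulrC.
rewrite ler_pdivlMr ?divr_gt0 // mulrC.
apply: le_trans (_ : r^-1 * (Normc.normc (lead_coef q) / 2 * r ^+ dq) <= _); last first.
  by rewrite ler_pM2l ?invr_gt0.
rewrite mulrCA ler_pM2l ?divr_gt0 //.
have -> : dq = (dq.-1 - dp + dp).+1 by rewrite subnK ?prednK //; [apply: leq_ltn_trans dpq | rewrite -ltnS prednK // (leq_ltn_trans _ dpq)].
rewrite exprS mulKf ?gt_eqF // ler_weXn2l //; lia.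
Qed.
End RationalDecay.

Section RootLarge.
Variables (R : rcfType) (U : Type) (D : U -> Prop) (om : R -> R[i]) (K : R) (n : nat).
Hypotheses (K0 : 0 < K) (n0 : (0 < n)%N).
Hypothesis omn : evt D (fun r _ => Normc.normc (om r) ^+ n = K * r).

Lemma root_large b : evt D (fun r _ => b <= Normc.normc (om r)).
Proof.
have H := evt_and omn (evt_ge D (Num.max b 0 ^+ n / K)).
apply: evt_imp H => r _ _ [ oE]; rewrite ler_pdivrMr // mulrC -oE => h.
have : Num.max b 0 <= Normc.normc (om r).
  by rewrite -(ler_pXn2r n0) ?nnegrE ?normc_ge0 // le_max lexx orbT.
by apply: le_trans; rewrite le_max lexx.
Qed.

Lemma root_inv_eta0 q e : 0 < e ->
  evt D (fun r _ => 0 <= (Normc.normc (om r) ^+ q.+1)^-1 <= e).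
Proof.
move=> e0; apply: evt_imp (evt_and (root_large 1) (root_large e^-1)) => r _ _ [ o1 oe].
have o0 : 0 < Normc.normc (om r) := lt_le_trans ltr01 o1.
rewrite invr_ge0 exprn_ge0 ?(ltW o0) //= -[e]invrK lef_pV2 ?posrE ?invr_gt0 ?exprn_gt0 //.
by apply: le_trans oe _; rewrite exprS ler_peMr ?(ltW o0) // exprn_ege1.
Qed.
End RootLarge.

Section NearRows.
Variables (R : rcfType) (U : Type) (D : U -> Prop) (m N L : nat).
Hypothesis m0 : (0 < m)%N.
Local Notation T := m.*2.+1.
Variables (om : R -> R[i]) (c : nat -> R[i]) (mu1 : R[i]) (J : 'I_N -> 'I_L).
Hypothesis D0 : exists u, D u.
Hypothesis omT : evt D (fun r _ => om r ^+ T = r%:C).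
Hypothesis cm0 : c m != 0.
Hypothesis JE : forall j, J j = wtinv m j :> nat.

Let X r := seed (near_param m c r) (mu1 / r%:C) N L.

Let om_norm : evt D (fun r _ => Normc.normc (om r) ^+ T = 1 * r).
Proof.
apply: evt_imp (evt_and omT (evt_ge D 0)) => r _ _ [ oT r0].
by rewrite -normcX oT normcR ger0_norm // mul1r.
Qed.

Let om1 := root_large ltr01 (ltn0Sn _) om_norm 1.

Let eta0 e : 0 < e -> evt D (fun r _ => 0 <= (Normc.normc (om r))^-1 <= e).
Proof. by move/(root_inv_eta0 ltr01 (ltn0Sn _) om_norm 0); apply: evt_imp => r _ _; rewrite expr1. Qed.

Let muE : evt D (fun r _ => mu1 / r%:C * om r ^+ T = mu1).
Proof.
apply: evt_imp (evt_and omT (evt_ge D 1)) => r _ _ [-> r1].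
by rewrite divfK // -normc_gt0 normcR normr_gt0 gt_eqF // (lt_le_trans ltr01).
Qed.

Let XW : appx_mx D (fun r => (Normc.normc (om r))^-1)
  (fun r _ => \matrix_(i < N, k < L) (X r i k * om r ^+ wt m k / om r ^+ wt m i.*2))
  (fun _ _ => homog m N L (c m)).
Proof. by move=> i k; apply: (near_seed m0 c om1 omT muE). Qed.

Let J_inj : injective J.
Proof.
move=> i j e; apply: val_inj; apply: (can_inj (wtinvK m0)).
by rewrite -!JE e.
Qed.

Let wJ j (k : 'I_L) : (forall j', k != J j') ->
  (wt m (J j) < wt m k)%N \/
  [/\ wt m (J j) = (wt m k).+1, (invmx (colsub J (homog m N L (c m))) *m homog m N L (c m)) j k = 0 &
     evt D (fun r _ => (Normc.normc (om r))^-1 * Normc.normc (om r) ^+ 2 <= 1)].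
Proof.
move=> kJ; left; rewrite JE wtinvK //; apply: leq_trans (ltn_ord j) _.
rewrite leqNgt; apply/negP => kN; have /eqP := kJ (Ordinal kN); apply.
by apply: val_inj => /=; rewrite JE /= wtK.
Qed.

Let detJ := det_homog cm0 JE.

Lemma near_unit : evt D (fun r _ => colsub J (X r) \in unitmx).
Proof. exact: (colsub_unit eta0 om1 XW detJ). Qed.

(** The seed matrix times r: this factor clears the denominator of mu = mu1 / r and leaves
    polynomials in r. *)
Let XP : 'M[{poly R[i]}]_(N, L) :=
  let y j := if odd j && (T <= j)%N then (c j./2)%:P * 'X else 0 in
  \matrix_(i, k) ('X * (if (k <= i.*2)%N then schur y (i.*2 - k) else 0)
    + mu1%:P * (if (k <= i.*2.+1)%N then schur y (i.*2.+1 - k) else 0)).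

Let XPE r : r != 0 -> map_mx (horner_eval r%:C) XP = r%:C *: X r.
Proof.
move=> r0; have rC : r%:C != 0 by rewrite -normc_gt0 normcR normr_gt0.
have S n : horner_eval r%:C (schur (fun j => if odd j && (T <= j)%N then (c j./2)%:P * 'X else 0) n)
    = schur (near_param m c r) n.
  rewrite (rmorph_schur (horner_eval r%:C) _ _ (@natU_poly _)); apply: eq_schur => j _ /=.
  by rewrite /near_param horner_evalE; case: ifP => _; rewrite ?horner0 // hornerM hornerC hornerX.
apply/matrixP => i k; rewrite !mxE !rmorphD !rmorphM /= !horner_evalE hornerX hornerC.
rewrite mulrDr mulrA [r%:C * (_ / _)]mulrC divfK //.
by congr (_ * _ + _ * _); case: ifP => _; rewrite ?horner0 //; exact: S.
Qed.

(** [row_limit] gives convergence at rate |om|^-1 only. Cramer's rule writes each entry outside J as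
    a quotient of polynomials in r, to which [rational_decay] applies. *)
Lemma near_rows : appx_mx D (fun r => r^-1)
  (fun r _ => invmx (colsub J (X r)) *m X r) (fun _ _ => \matrix_(j, k) (k == J j)%:R).
Proof.
have lim := row_limit eta0 om1 XW detJ J_inj wJ.
have eta01 := inv_eta0 D (@ltr01 R).
move=> j k; case: (pickP (fun j' => k == J j')) => [j' /eqP ->|nJ].
  apply: (appx_ext (appx_cst eta01 (J j' == J j)%:R)).
  apply: evt_imp near_unit => r _ _ XJ; split; last by rewrite mxE.
  transitivity ((invmx (colsub J (X r)) *m colsub J (X r)) j j').
    by rewrite !mxE; apply: eq_bigr => q _; rewrite !mxE.
  by rewrite mulVmx // mxE (inj_eq J_inj) eq_sym.
have kJ j' : k != J j' by rewrite nJ.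
have H : appx D (fun r => r^-1) (fun r _ => (invmx (colsub J (X r)) *m X r) j k) (fun _ _ => 0).
  have E : evt D (fun r u => (invmx (colsub J (X r)) *m X r) j k * (\det (colsub J XP)).[r%:C] =
     ((\adj (colsub J XP) *m XP) j k).[r%:C] /\ (\det (colsub J XP)).[r%:C] != 0).
    apply: evt_imp (evt_and near_unit (evt_ge D 1)) => r _ _ [XJ r1].
    have r0 : r != 0 by rewrite gt_eqF // (lt_le_trans ltr01).
    have rC : r%:C != 0 by rewrite -normc_gt0 normcR normr_gt0.
    have EJ : map_mx (horner_eval r%:C) (colsub J XP) = r%:C *: colsub J (X r).
      have /matrixP XE := XPE r0.
      by apply/matrixP => a b; have := XE a (J b); rewrite !mxE.
    have dE : (\det (colsub J XP)).[r%:C] = \det (r%:C *: colsub J (X r)).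
      by rewrite -EJ det_map_mx.
    have aE : ((\adj (colsub J XP) *m XP) j k).[r%:C] =
        ((\adj (r%:C *: colsub J (X r))) *m (r%:C *: X r)) j k.
      by rewrite -EJ -XPE // -map_mx_adj -map_mxM [RHS]mxE.
    have uJ : r%:C *: colsub J (X r) \in unitmx.
      exact: unitmx_scale.
    rewrite aE dE; split; last by rewrite -unitfE -unitmxE.
    have -> : invmx (colsub J (X r)) *m X r = invmx (r%:C *: colsub J (X r)) *m (r%:C *: X r).
      by rewrite invmxZ // -scalemxAl -scalemxAr scalerA mulVf // scale1r.
    rewrite /invmx uJ -scalemxAl mxE mulrAC mulVf ?mul1r //.
  have /appx_eq lim0 := lim j k.
  have {}lim0 := lim0 (fun r _ => (invmx (colsub J (X r)) *m X r) j k) (fun _ _ => 0) (fun _ _ => erefl) _.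
  apply: (rational_decay D0 eta0 _ _ (lim0 _)).
  - by apply: evt_imp E => r u _ [e _]; exact: e.
  - have [r0 Er] := E; have [u0 Du0] := D0; apply/eqP => q0.
    by have [_] := Er r0 (lexx _) u0 Du0; rewrite q0 horner0 eqxx.
  by move=> r u; rewrite mxE (negbTE (kJ j)).
by apply: (appx_eq H) => r u //; rewrite mxE (negbTE (kJ j)).
Qed.
End NearRows.

(** * Yablonskii-Vorob'ev determinants *)

Lemma deriv_prod_seq (F : comNzRingType) (I : eqType) (s : seq I) (f : I -> {poly F}) : uniq s ->
  (\prod_(i <- s) f i)^`() =
  \sum_(j <- s) \prod_(i <- s) (if i == j then (f i)^`() else f i).
Proof.
elim: s => [|a s IH] /=; first by rewrite !big_nil derivC.
move=> /andP [as_ us]; rewrite !big_cons derivM IH // eqxx; congr (_ * _ + _).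
  rewrite big_seq [RHS]big_seq; apply: eq_bigr => i si.
  by rewrite ifN //; apply: contraNneq as_ => <-.
rewrite mulr_sumr [LHS]big_seq [RHS]big_seq; apply: eq_bigr => j sj.
by rewrite big_cons ifN //; apply: contraNneq as_ => ->.
Qed.

Lemma deriv_det (F : comNzRingType) n (A : 'M[{poly F}]_n) :
  (\det A)^`() = \sum_j \det (\matrix_(i, k) if i == j then (A i k)^`() else A i k).
Proof.
rewrite /determinant raddf_sum exchange_big; apply: eq_bigr => s _ /=.
have E (p : {poly F}) : (-1) ^+ s * p = ((-1) ^+ s : F) *: p.
  by rewrite -mul_polyC rmorph_sign.
rewrite E linearZ /= deriv_prod_seq ?index_enum_uniq // scaler_sumr.
apply: eq_bigr => j _; rewrite E; congr (_ *: _).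
by apply: eq_bigr => i _; rewrite mxE.
Qed.

Lemma prod_top_coef (F : comNzRingType) n (f : 'I_n -> {poly F}) (d : 'I_n -> nat) :
  (forall i, (size (f i) <= (d i).+1)%N) ->
  (size (\prod_i f i)%R <= (\sum_i d i).+1)%N /\
  (\prod_i f i)`_(\sum_i d i)%N = \prod_i (f i)`_(d i).
Proof.
elim: n f d => [|n IH] f d fd; first by rewrite !big_ord0 size_poly1 coef1.
rewrite !big_ord_recl; have [] := IH (fun i => f (lift ord0 i)) (fun i => d (lift ord0 i)) (fun i => fd _).
set P := \prod_(i < n) _; set D := (\sum_(i < n) _)%N => sP <-.
have f0 := fd ord0.
split.
  by apply: leq_trans (size_polyMleq _ _) _; lia.
rewrite coefM (bigD1 (inord (d ord0))) //= inordK ?ltnS ?leq_addr // addKn big1 ?addr0 // => i ne.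
have [lt|gt|e] := ltngtP i (d ord0).
- by rewrite [P`_ _]nth_default ?mulr0 //; apply: leq_trans sP _; lia.
- by rewrite nth_default ?mul0r //; apply: leq_trans f0 _.
by case/eqP: ne; apply: val_inj; rewrite /= inordK ?ltnS ?leq_addr.
Qed.

Section ThetaDet.
Variables (F : numFieldType) (m : nat) (c : F).
Hypothesis m0 : (0 < m)%N.
Hypothesis c0 : c != 0.
Local Notation T := m.*2.+1.
Let natU := @natU_num F.
Let natUP := @natU_poly F.

Definition theta (k : nat) : {poly F} :=
  schur (fun l => if l == 1%N then 'X else if l == T then c%:P else 0) k.

Let e := schur (fun l => if l == T then c else 0).

Lemma thetaE k : theta k = \sum_(i < k.+1) (i`!%:R^-1 * e (k - i)) *: 'X^i.
Proof.
pose y1 l : {poly F} := if l == 1%N then 'X else 0.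
pose yT l : {poly F} := if l == T then c%:P else 0.
rewrite /theta (eq_schur (z := fun l => y1 l + yT l)); last first.
  move=> l _; rewrite /y1 /yT; case: (eqVneq l 1%N) => [->|_]; last by rewrite add0r.
  by rewrite ifF ?addr0 //; lia.
rewrite (schurD natUP); apply: eq_bigr => i _.
rewrite /y1 (schur_single natUP) // dvd1n divn1.
have -> : schur yT (k - i) = (e (k - i))%:P.
  rewrite /e (rmorph_schur (polyC : {rmorphism F -> {poly F}}) _ _ natU).
  by apply: eq_schur => j _; rewrite /= /yT; case: eqP => // _; rewrite polyC0.
have -> : i`!%:R^-1 = (i`!%:R^-1)%:P :> {poly F}.
  have u : i`!%:R \is a @GRing.unit {poly F}.
    by move: (natUP i`!.-1); rewrite prednK ?fact_gt0.
  have nz : i`!%:R != 0 :> F by rewrite pnatr_eq0 -lt0n fact_gt0.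
  by apply: (mulrI u); rewrite divrr // -polyC_natr -polyCM divff ?polyC1.
by rewrite -mulrA -polyCM mulrC mul_polyC.
Qed.

Lemma horner_theta k z : (theta k).[z] =
  schur (fun l => if l == 1%N then z else if l == T then c else 0) k.
Proof.
rewrite -[LHS]/(horner_eval z (theta k)) (rmorph_schur (horner_eval z) _ _ natUP).
apply: eq_schur => j _ /=; rewrite /horner_eval /=.
by case: ifP => _; rewrite ?hornerX //; case: ifP => _; rewrite ?hornerC ?horner0.
Qed.

Lemma size_theta k : (size (theta k) <= k.+1)%N.
Proof.
rewrite thetaE; apply: leq_trans (size_sum _ _ _) _; apply/bigmax_leqP => i _.
by apply: leq_trans (size_scale_leq _ _) _; rewrite size_polyXn.
Qed.

Lemma theta_top k : (theta k)`_k = k`!%:R^-1.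
Proof.
rewrite thetaE coef_sum big_ord_recr /= coefZ coefXn eqxx subnn /e schur0 !mulr1.
rewrite big1 ?add0r // => i _; rewrite coefZ coefXn gtn_eqF ?mulr0 //.
Qed.

Lemma deriv_theta k : (theta k)^`() = if k is k'.+1 then theta k' else 0.
Proof.
rewrite !thetaE raddf_sum; case: k => [|k].
  by rewrite big_ord1 /= derivZ derivXn mulr0n scaler0.
rewrite big_ord_recl /= derivZ derivXn mulr0n scaler0 add0r thetaE.
apply: eq_bigr => i _; rewrite derivZ derivXn -scaler_nat scalerA /= /bump add1n subSS.
congr (_ *: _); rewrite factS natrM invfM mulrAC; congr (_ * _).
by rewrite mulrAC mulVf ?mul1r // pnatr_eq0.
Qed.

(** Indexed by 2i - v from 0, as in the limit of the seed matrix. Compared with the Adler-Moser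
    matrix of size n-1 it has an additional first row and column. *)
Definition theta_mx n l : 'M[{poly F}]_(n, l) :=
  \matrix_(i, v) if (v <= i.*2)%N then theta (i.*2 - v) else 0.

Variable N : nat.

Let D := \det (theta_mx N N).

(** Since theta_k' = theta_(k-1), differentiating column v gives column v+1. Every term has two
    equal columns except the one that differentiates the last column. *)
Lemma deriv_theta_det : (0 < N)%N ->
  D^`() = \det (\matrix_(i < N, v < N)
    let v' := if v.+1 == N then N else v in if (v' <= i.*2)%N then theta (i.*2 - v') else 0).
Proof.
case: N @D => // n D' _; rewrite /D' -det_tr deriv_det (bigD1 ord_max) //= big1 => [|v vn].
  rewrite addr0 -[RHS]det_tr; congr (\det _); apply/matrixP => v i; rewrite !mxE.
  rewrite -val_eqE /= eqSS; case: eqP => [->|//].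
  case: (leqP n i.*2) => ni; last by rewrite linear0 ifN // -ltnNge; lia.
  rewrite deriv_theta; case: (leqP n.+1 i.*2) => ni'; last by rewrite (_ : (i.*2 - n)%N = 0%N) //; lia.
  by rewrite (_ : (i.*2 - n)%N = (i.*2 - n.+1).+1) //; lia.
have vn' : (v.+1 < n.+1)%N.
  rewrite ltnS ltn_neqAle -ltnS ltn_ord andbT.
  by apply: contraNneq vn => e'; apply/eqP/val_inj.
apply: (determinant_alternate (i1 := v) (i2 := Ordinal vn')).
  by rewrite -val_eqE /= ltn_eqF.
move=> i; rewrite !mxE eqxx (_ : (Ordinal vn' == v) = false); last by rewrite -val_eqE /= gtn_eqF.
case: (leqP v i.*2) => vi; last by rewrite linear0 ifN // -ltnNge /=; lia.
rewrite deriv_theta /=; case: (ltnP v i.*2) => vi'; last by rewrite (_ : (i.*2 - v)%N = 0%N) //; lia.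
by rewrite (_ : (i.*2 - v)%N = (i.*2 - v.+1).+1) //; lia.
Qed.

(** In each nonzero term of the Leibniz formula the degrees 2i - s(i) add up to the same number, the
    sum of all i < N. The coefficient there is the determinant of the 1/(2i - v)!, which is nonzero
    by [det_inv_fact]. *)
Lemma size_theta_det : size D = ((\sum_(i < N) i).+1)%N.
Proof.
pose d := (\sum_(i < N) i)%N.
have dE (s : 'S_N) : (forall i, s i <= i.*2)%N -> (\sum_(i < N) (i.*2 - s i))%N = d.
  have ds : d = (\sum_(i < N) s i)%N by rewrite /d (reindex_inj (@perm_inj _ s)).
  move=> si; apply/eqP; rewrite -(eqn_add2r d) {1}ds -big_split /= /d -big_split /=.
  by apply/eqP; apply: eq_bigr => i _; rewrite subnK // addnn.
have prodE (s : 'S_N) : (size (\prod_i theta_mx N N i (s i))%R <= d.+1)%N /\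
    (\prod_i theta_mx N N i (s i))`_d =
    \prod_i (if (s i <= i.*2)%N then (i.*2 - s i)`!%:R^-1 else 0).
  case: (pickP (fun i : 'I_N => (i.*2 < s i)%N)) => [i si|all].
    have Z : theta_mx N N i (s i) = 0 by rewrite mxE leqNgt si.
    rewrite (bigD1 i) //= Z mul0r size_poly0 coef0; split => //.
    by rewrite (bigD1 i) //= leqNgt si mul0r.
  have si (i : 'I_N) : (s i <= i.*2)%N by rewrite leqNgt all.
  have [] := @prod_top_coef _ N (fun i => theta_mx N N i (s i)) (fun i : 'I_N => i.*2 - s i)%N.
    by move=> i; rewrite mxE si size_theta.
  rewrite dE // => -> ->; split => //; apply: eq_bigr => i _.
  by rewrite mxE si theta_top.
have E (s : 'S_N) (p : {poly F}) : (-1) ^+ s * p = ((-1) ^+ s : F) *: p.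
  by rewrite -mul_polyC rmorph_sign.
apply/eqP; rewrite eqn_leq; apply/andP; split.
  apply: leq_trans (size_sum _ _ _) _; apply/bigmax_leqP => s _; rewrite E.
  by apply: leq_trans (size_scale_leq _ _) _; case: (prodE s).
rewrite ltnNge; apply/negP => sd.
have : D`_d = 0 by rewrite nth_default.
rewrite coef_sum; apply/eqP.
have := @det_inv_fact F N (fun i : 'I_N => i.*2) (fun i j e => val_inj (double_inj e)).
rewrite /determinant; congr (_ != _); apply: eq_bigr => s _; rewrite E coefZ.
congr (_ * _); case: (prodE s) => _ ->.
by apply: eq_bigr => i _; rewrite mxE.
Qed.

(** Splitting off exp(z eps) gives theta_mx = h G, with G its Toeplitz matrix, and h = h_J Y.
    Multiplying column v of Y G by z^v makes row j divisible by z^(J j). The quotient H has entries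
    1/(J j - v)! at z = 0, hence det H does not vanish there, and the order of vanishing is read off
    from the powers of z. *)
Lemma mup_theta_det (L : nat) (J : 'I_N -> 'I_L) : (N.*2 <= L)%N ->
  (forall j, J j = wtinv m j :> nat) ->
  (mup 0 D + \sum_(j < N) j = \sum_(j < N) J j)%N.
Proof.
move=> NL JE.
pose h := homog m N L c; pose hJ := colsub J h.
have dJ : \det hJ != 0 by apply: det_homog.
have uJ : hJ \in unitmx by rewrite unitmxE unitfE.
pose Y := invmx hJ *m h.
have hY : h = hJ *m Y by rewrite mulKVmx.
have J_inj : injective J.
  move=> i j ij; apply: val_inj; apply: (can_inj (wtinvK m0)).
  by rewrite -!JE ij.
have YJ j j' : Y j (J j') = (j == j')%:R.
  transitivity ((invmx hJ *m hJ) j j'); first by rewrite !mxE; apply: eq_bigr => q _; rewrite !mxE.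
  by rewrite mulVmx // mxE.
clearbody Y.
(* h intertwines the diagonal matrix of column residues with that of the residues of 2i. The same
   holds for h_J, hence Y = h_J^-1 h intertwines the residues of k and J j, which are distinct as
   elements of F when they are distinct as numbers. *)
have Ymod j k : Y j k != 0 -> (k = J j %[mod T])%N.
  pose ph (k : nat) : F := (k %% T)%:R.
  have hph : h *m diag_mx (\row_k ph k) = diag_mx (\row_(i < N) ph i.*2) *m h.
    apply/matrixP => i q.
    have E : h i q * ph q = ph i.*2 * h i q.
      have [->|/homog_eq0 E] := eqVneq (h i q) 0; first by rewrite mulr0 mul0r.
      by rewrite /ph E mulrC.
    rewrite mul_mx_diag mul_diag_mx [LHS]mxE [RHS]mxE.
    by rewrite [X in h i q * X]mxE [X in X * h i q]mxE.
  have hphJ : hJ *m diag_mx (\row_j ph (J j)) = diag_mx (\row_(i < N) ph i.*2) *m hJ.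
    move/matrixP: hph => hph; apply/matrixP => i q; have := hph i (J q).
    by rewrite !mul_mx_diag !mul_diag_mx [LHS]mxE [RHS]mxE => E; rewrite [LHS]mxE [RHS]mxE mxE;
      move: E; rewrite [X in h i (J q) * X]mxE [X in X * h i (J q)]mxE => E; rewrite !mxE in E *.
  have Yph : Y *m diag_mx (\row_k ph k) = diag_mx (\row_j ph (J j)) *m Y.
    apply: (can_inj (mulKmx uJ)).
    by rewrite mulmxA -hY hph {1}hY [RHS]mulmxA hphJ mulmxA.
  move/matrixP/(_ j k): Yph; rewrite mul_mx_diag mul_diag_mx [LHS]mxE [RHS]mxE.
  rewrite [X in Y j k * X]mxE [X in X * Y j k]mxE mulrC => E Y0.
  by apply/eqP; rewrite -(eqr_nat F); apply/eqP; apply: (mulIf Y0).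
(* Y only mixes columns of equal residue, where weights increase with the index. *)
have Ylt j k : Y j k != 0 -> (J j <= k)%N.
  move=> Y0; have [[j' kE]|nJ] : (exists j', k = J j') \/ (forall j', k != J j').
    case: (pickP (fun j' => k == J j')) => [j' /eqP ->|no]; first by left; exists j'.
    by right => j'; rewrite no.
    by move: Y0; rewrite kE YJ; case: (eqVneq j j') => [->|_]; rewrite ?eqxx.
  apply/ltnW/(@wt_mod_lt m); first by rewrite (Ymod _ _ Y0).
  rewrite JE wtinvK //; apply: leq_trans (ltn_ord j) _.
  rewrite leqNgt; apply/negP => kN; have /eqP := nJ (Ordinal kN); apply.
  by apply: val_inj => /=; rewrite JE /= wtK.
pose G : 'M[{poly F}]_(L, N) := \matrix_(k, v) if (v <= k)%N then (k - v)`!%:R^-1 *: 'X^(k - v) else 0.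
have thG : theta_mx N N = map_mx polyC h *m G.
  apply/matrixP => i v; rewrite !mxE.
  rewrite (eq_bigr (fun k : 'I_L => if (v <= k <= i.*2)%N then
     ((k - v)`!%:R^-1 * e (i.*2 - k)) *: 'X^(k - v) else 0)); last first.
    move=> k _; rewrite !mxE; case: (leqP k i.*2) => ki; last by rewrite polyC0 mul0r andbF.
    by rewrite andbT; case: ifP => _; rewrite ?mulr0 // mul_polyC scalerA mulrC.
  case: leqP => [vi|iv]; last by rewrite big1 // => k _; rewrite ifF //; lia.
  rewrite thetaE -(big_mkord xpredT (fun k => if (v <= k <= i.*2)%N then
     ((k - v)`!%:R^-1 * e (i.*2 - k)) *: 'X^(k - v) else 0)).
  have iN := ltn_ord i; have vN := ltn_ord v.
  rewrite (big_cat_nat (n := v)) //=; last by lia.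
  rewrite [X in _ = X + _]big_nat_cond [X in _ = X + _]big1 ?add0r; last first.
    by move=> k kv; rewrite ifF //; lia.
  rewrite (big_cat_nat (n := i.*2.+1)) //=; [|by lia|by lia].
  rewrite [X in _ = _ + X]big_nat_cond [X in _ = _ + X]big1 ?addr0; last first.
    by move=> k kv; rewrite ifF //; lia.
  rewrite (big_addn 0 i.*2.+1 v) big_mkord subSn //; apply: eq_bigr => k _.
  have ki := ltn_ord k; rewrite ifT; last by lia.
  by rewrite addnK; congr ((_ * e _) *: _); lia.
have DE : D = (\det hJ)%:P * \det (map_mx polyC Y *m G).
  by rewrite /D thG hY map_mxM -mulmxA det_mulmx det_map_mx.
pose H : 'M[{poly F}]_N := \matrix_(j, v) \sum_(k < L)
  if (v <= k)%N then (Y j k / (k - v)`!%:R) *: 'X^(k - J j) else 0.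
have HE : map_mx polyC Y *m G *m diag_mx (\row_(v < N) 'X^v) = diag_mx (\row_j 'X^(J j)) *m H.
  apply/matrixP => j v; rewrite mul_mx_diag mul_diag_mx !mxE mulr_suml mulr_sumr.
  apply: eq_bigr => k _; rewrite !mxE.
  case: ifP => vk; last by rewrite !mulr0 mul0r.
  have [->|Y0] := eqVneq (Y j k) 0; first by rewrite polyC0 !mul0r scale0r mulr0.
  rewrite mul_polyC scalerA -scalerAl -scalerAr -!exprD subnK // subnKC //.
  exact: Ylt.
have H0 : ~~ root (\det H) 0.
  rewrite /root -[_.[0]]/(horner_eval 0 (\det H)) -det_map_mx.
  have := @det_inv_fact F N (fun j => J j) (fun i j e => J_inj _ _ (val_inj e)).
  congr (\det _ != _); apply/matrixP => j v; rewrite !mxE rmorph_sum.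
  rewrite (bigD1 (J j)) //= /horner_eval big1 ?addr0 => [|k kj].
    case: ifP => _; last by rewrite horner0.
    by rewrite subnn expr0 alg_polyC hornerC YJ eqxx mul1r.
  case: ifP => _; last by rewrite horner0.
  rewrite hornerZ hornerXn; have [->|Y0] := eqVneq (Y j k) 0; first by rewrite mul0r mul0r.
  rewrite expr0n (_ : (_ - _ == 0)%N = false) ?mulr0 //.
  by have := Ylt _ _ Y0; move: kj; rewrite -val_eqE /=; lia.
have dY0 : D != 0 by rewrite -size_poly_gt0 size_theta_det.
have := congr1 determinant HE; rewrite !det_mulmx !det_diag.
rewrite (eq_bigr (fun v : 'I_N => 'X^v)) => [|v _]; last by rewrite mxE.
rewrite [in RHS](eq_bigr (fun j : 'I_N => 'X^(J j))) => [|j _]; last by rewrite mxE.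
rewrite -!(big_morph (GRing.exp 'X) (exprD 'X) (expr0 'X)) => E.
have {}E : D * 'X^(\sum_(v < N) v) = (\det hJ) *: 'X^(\sum_(j < N) J j) * \det H.
  by rewrite DE -mulrA E mul_polyC scalerAl.
have := congr1 (mup 0) E.
have muX q : mup 0 ('X^q : {poly F}) = q.
  by have := mup_XsubCX q (0 : F) 0; rewrite subr0 eqxx.
rewrite mupM ?polyXn_eq0 // ?monic_neq0 ?monicXn // muX => ->.
rewrite mupMl // -mul_polyC mupMr ?muX //.
by rewrite rootC.
Qed.
End ThetaDet.

(** * Parity of the coefficients of ln((2/eps) tanh(eps/2)) *)

Section Parity.
Import numFieldNormedType.Exports.
Local Open Scope classical_set_scope.
Local Open Scope ring_scope.

Variable R : realType.

Lemma fmap_dnbhs0_opp (V : Type) (q : R -> V) :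
  ((fun h => q (- h)) @ (0 : R)^')%classic = (q @ (0 : R)^')%classic.
Proof.
apply/seteqP; split => A; rewrite /fmap /= => HA.
  by rewrite -oppr0 dnbhsN /=; eexists; first exact: HA; apply/seteqP; split => x /=;
     [move=> [y Ay <-] | move=> Ax; exists (- x); rewrite ?opprK].
rewrite -oppr0 dnbhsN /=; eexists; first exact: HA.
by apply/seteqP; split => x /=; [move=> [y Ay <-]; rewrite opprK | move=> Ax; exists (- x); rewrite ?opprK].
Qed.

(* Holds also where the limit does not exist, both sides being 0 there. *)
Lemma lim_opp (f : R -> R) (F : set_system R) : ProperFilter F ->
  lim ((fun h => - f h) @ F)%classic = - lim (f @ F)%classic :> R.
Proof.
move=> PF; have [cf|ncf] := pselect (cvg (f @ F)%classic); first exact: limN.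
have ncf' : ~ cvg ((- f) @ F)%classic by rewrite is_cvgNE.
rewrite (dvgP ncf) (dvgP ncf').
exact: esym (oppr0 R).
Qed.

(** The substitution h -> -h carries the difference quotients at -x to those at x up to sign and
    preserves the punctured neighbourhoods of 0, whether or not the limit exists. *)
Lemma derive1_parity (g : R -> R) (b : bool) :
  (forall x, g (- x) = (-1) ^+ b * g x) ->
  forall x, derive1 g (- x) = (-1) ^+ (~~ b) * derive1 g x.
Proof.
move=> gb x; rewrite /derive1 -fmap_dnbhs0_opp.
have E h : (- h)^-1 *: (g (- h - x) - g (- x)) = (-1) ^+ (~~ b) * (h^-1 *: (g (h + x) - g x)).
  rewrite -opprD !gb invrN -!mulrBr !scaleNr.
  by case: b {gb} => /=; rewrite ?expr0 ?expr1 ?mul1r ?mulN1r ?scalerN ?opprK.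
under [in LHS]eq_fun do rewrite E.
case: b {gb E} => /=; first by under eq_fun do rewrite expr0 mul1r; rewrite expr0 mul1r.
by under eq_fun do rewrite expr1 mulN1r; rewrite lim_opp expr1 mulN1r.
Qed.

Lemma sgen_even (x : R) : sgen (- x) = sgen x.
Proof.
rewrite /sgen oppr_eq0; case: eqP => // _; rewrite /tanhR mulNr opprK; congr (ln _).
set b := expR (- (x / 2)); set a := expR (x / 2).
rewrite invrN mulrN mulNr -mulrN -[in LHS](opprB a b) mulNr opprK.
by rewrite (addrC b a).
Qed.

Lemma derive1n_sgen_parity n (x : R) : derive1n n (@sgen R) (- x) = (-1) ^+ (odd n) * derive1n n (@sgen R) x.
Proof.
elim: n x => [|n IH] x; first by rewrite expr0 mul1r; exact: sgen_even.
by rewrite derive1nS; exact: derive1_parity.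
Qed.

Lemma svec_odd l : odd l -> svec R l = 0.
Proof.
move=> ol; rewrite /svec /scoef; have := derive1n_sgen_parity l 0.
rewrite oppr0 ol expr1 mulN1r => /eqP; rewrite -subr_eq0 opprK -mulr2n mulrn_eq0 => /eqP ->.
by rewrite mul0r.
Qed.
End Parity.

(** * Rogue waves *)

Section Tau.
Variable R : realType.
Local Notation C := R[i].
Local Notation normc := (@Normc.normc R).
Let s := @svec R.

(** The factor 4^-v is shared equally between the two rows. Columns beyond 2N-1 are zero; keeping l
    free matches the p + 2n columns that survive in [det_core_rows]. *)
Lemma tauE N l (a : nat -> C) (x t : R) n : (N.*2 <= l)%N ->
  tau N a x t n = \det (oddrows s N l (xplus a x t n) *m (oddrows s N l (xminus a x t n))^T).
Proof.
move=> Nl; congr (\det _); apply/matrixP => i j; rewrite !mxE /tau_entry !mul2n big_mkord.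
have iN := ltn_ord i; have jN := ltn_ord j.
rewrite (big_ord_widen l (fun v => 4%:R ^- v *
  schur (fun k => xplus a x t n k + v%:R * svec R k) (i.*2.+1 - v) *
  schur (fun k => xminus a x t n k + v%:R * svec R k) (j.*2.+1 - v))); last by lia.
rewrite big_mkcond; apply: eq_bigr => v _; rewrite !mxE /psi ltnS leq_min.
case: leqP => vi; case: leqP => vj //=; rewrite ?mul0r ?mulr0 //.
have -> : 4%:R ^- v = 2%:R ^- v * 2%:R ^- v :> C.
  by rewrite -invfM -exprMn -natrM.
by rewrite /s; ring.
Qed.

Lemma xplus_n (a : nat -> C) (x t : R) n k :
  xplus a x t n k = xplus a x t 0 k + (if k == 1%N then n%:R else 0).
Proof. by rewrite /xplus; case: eqP => _; rewrite ?addr0 //. Qed.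

Lemma xminus_conj (a : nat -> C) (x t : R) n k :
  xminus a x t n k = conjc (xplus a x t 0 k) - (if k == 1%N then n%:R else 0).
Proof.
rewrite /xminus /xplus; case: eqP => _; last by case: ifP => _; rewrite subr0 ?rmorph0.
have Ji : conjc 'i = - 'i :> C by apply/eqP; rewrite eq_complex /= oppr0 !eqxx.
rewrite addr0; congr (_ - _).
have -> : conjc (x%:C + 2%:R * 'i * t%:C) = conjc x%:C + conjc 2%:R * conjc 'i * conjc t%:C :> C.
  by rewrite rmorphD !rmorphM.
by rewrite conjc_nat !conjc_real Ji mulrN mulNr.
Qed.

Lemma conj_svec k : conjc (s k) = s k.
Proof. by rewrite /s /svec conjc_real. Qed.

(* x + 2^k i t for the real x and t such that z = x + 2 i t. *)
Definition lin k (z : C) : C := (complex.Re z)%:C + 2%:R ^+ k * 'i * (complex.Im z / 2)%:C.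

Lemma linD k : {morph lin k : y z / y + z}.
Proof.
move=> y z; rewrite /lin; case: y => a b; case: z => c d /=.
by rewrite mulrDl !rmorphD /=; ring.
Qed.

Lemma lin1 z : lin 1 z = z.
Proof.
rewrite /lin expr1 fmorph_div rmorph_nat [RHS]complexE; congr (_ + _).
by rewrite [2%:R * 'i]mulrC -mulrA; congr (_ * _); rewrite mulrC divfK.
Qed.

Lemma normc_lin k z : normc (lin k z) <= (1 + 2 ^+ k) * normc z.
Proof.
rewrite /lin; apply: le_trans (le_normcD _ _) _; rewrite mulrDl mul1r; apply: lerD.
  by rewrite normcR normc_Re.
rewrite !Normc.normcM normcX normc_nat normcR -mulrA ler_pM2l ?exprn_gt0 ?ltr0n //.
rewrite [normc 'i](_ : _ = 1) ?mul1r; last by rewrite /= expr0n expr1n add0r sqrtr1.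
rewrite normrM; apply: le_trans (normc_Im z).
by rewrite ler_piMr ?normr_ge0 // ger0_norm ?invr_ge0 // invf_le1 // ler1n.
Qed.

Section Factor.
Variables (N : nat) (a : nat -> C) (b : nat -> C) (c zeta : C).
Hypothesis c0 : c != 0.
Hypothesis aE : forall k, odd k -> (2 < k < N.*2)%N ->
  a k + lin k (zeta + c) / k`!%:R = c ^+ k / k%:R + b k.
Hypothesis b1 : b 1%N = zeta.
Hypothesis b_even : forall k, ~~ odd k -> b k = 0.

Let X := seed b c^-1 N N.*2.

(** zeta + c is the value of x + 2it at the centre. In degree 1, artanh(c eps) takes the part c and
    leaves zeta to b. *)
Lemma xplus_factor (x t : R) k : (0 < k < N.*2)%N ->
  xplus a (complex.Re (zeta + c) + x) (complex.Im (zeta + c) / 2 + t) 0 k =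
  (if odd k then c ^+ k / k%:R else 0) + b k + xplus (fun _ => 0) x t 0 k.
Proof.
move=> k0; rewrite /xplus; case: eqP => [->|k1].
  rewrite /= b1 expr1 divr1 !addr0 -[2%:R]expr1 -[in RHS](addrC zeta) -[in RHS](lin1 (zeta + c)) /lin.
  by rewrite !rmorphD /=; ring.
case: (boolP (odd k)) => ok /=; last by rewrite b_even // !addr0.
have k3 : (2 < k)%N by move: k1 ok k0; case: k => [|[|[|]]].
rewrite k3 addr0 -aE //; last by lia.
rewrite /lin !rmorphD /=; ring.
Qed.

Let seedJ : map_mx conjc X = seed (fun k => conjc (b k)) (conjc c)^-1 N N.*2.
Proof.
have S k : conjc (schur b k) = schur (fun j => conjc (b j)) k.
  exact: (rmorph_schur (conjc : {rmorphism C -> C}) b k (@natU_num C)).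
apply/matrixP => i k; rewrite !mxE rmorphD rmorphM fmorphV /= -!S.
by congr (_ + _ * _); case: ifP => _; rewrite ?rmorph0.
Qed.

Lemma tau_seed (x t : R) n :
  tau N a (complex.Re (zeta + c) + x) (complex.Im (zeta + c) / 2 + t) n =
  (c * conjc c) ^+ N *
  \det ((X *m psimx s N.*2 (xplus (fun _ => 0) x t n)) *m
        (map_mx conjc X *m psimx s N.*2 (xminus (fun _ => 0) x t n))^T).
Proof.
rewrite (tauE _ _ _ _ (leqnn _)).
have E1 : oddrows s N N.*2 (xplus a (complex.Re (zeta + c) + x) (complex.Im (zeta + c) / 2 + t) n) =
   oddrows s N N.*2 (fun k => (if odd k then c ^+ k / k%:R else 0) + b k + xplus (fun _ => 0) x t n k).
  apply/matrixP => i v; rewrite !mxE; apply: eq_psi => k k0.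
  by rewrite xplus_n xplus_factor -?addrA -?xplus_n //; have := ltn_ord i; lia.
have E2 : oddrows s N N.*2 (xminus a (complex.Re (zeta + c) + x) (complex.Im (zeta + c) / 2 + t) n) =
   oddrows s N N.*2 (fun k => (if odd k then (conjc c) ^+ k / k%:R else 0) + conjc (b k) + xminus (fun _ => 0) x t n k).
  apply/matrixP => i v; rewrite !mxE; apply: eq_psi => k k0.
  rewrite xminus_conj xplus_factor; last by have := ltn_ord i; lia.
  rewrite !rmorphD /= -addrA -xminus_conj; congr (_ + _ + _).
  by case: (odd k); [rewrite fmorph_div rmorphXn rmorph_nat | rewrite rmorph0].
have cJ0 : conjc c != 0 by rewrite conjc_eq0.
by rewrite E1 E2 (det_oddrows_atanh _ _ _ _ _ _ c0 cJ0) -seedJ.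
Qed.
End Factor.

Lemma det_core_rows (N p n : nat) (J : 'I_N -> 'I_N.*2) : N = (p + n)%N -> injective J ->
  (forall j, exists2 i, (i < N)%N & J j = core p i :> nat) ->
  exists2 K : C, K != 0 & forall x t k,
    \det ((\matrix_(j < N, v < N.*2) psi s (xplus (fun _ => 0) x t k) (J j) v) *m
          (\matrix_(j < N, v < N.*2) psi s (xminus (fun _ => 0) x t k) (J j) v)^T)
    = K * tau n (fun _ => 0) x t k.
Proof.
move=> NE; subst N; move: J.
have -> : ((p + n).*2 = p + (p + n.*2))%N by lia.
move=> J J_inj J_core.
exists ((\prod_(i < p) 2%:R ^- i) ^+ 2 * (2%:R ^- p) ^+ n ^+ 2).
  have nz q : (2%:R ^- q : C) != 0 by rewrite invr_eq0 expf_neq0.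
  rewrite mulf_neq0 ?expf_neq0 //; apply/prodf_neq0 => i _; exact: nz.
move=> x t k; rewrite (@det_core_perm _ s p n _ (fun j => J j)).
- rewrite (det_corerows (@svec_odd R)) -tauE //; lia.
- by move=> i j /val_inj; apply: J_inj.
by move=> j; have [i iN ->] := J_core j; exists (Ordinal iN).
Qed.

Section RatioLimit.
Variables (N p n : nat) (B : R) (eta : R -> R).
Hypothesis NE : N = (p + n)%N.
Let D (u : R * R) := `|u.1| <= B /\ `|u.2| <= B.
Hypothesis eta0 : forall e, 0 < e -> evt D (fun r _ => 0 <= eta r <= e).
Let eta01 := eta0 ltr01.

Let Psip k (u : R * R) := psimx s N.*2 (xplus (fun _ => 0) u.1 u.2 k).
Let Psim k (u : R * R) := psimx s N.*2 (xminus (fun _ => 0) u.1 u.2 k).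

Lemma xplus_appx k j : appx D eta (fun _ u => xplus (fun _ => 0) u.1 u.2 k j)
   (fun _ u => xplus (fun _ => 0) u.1 u.2 k j).
Proof.
have X : appx D eta (fun _ u => u.1%:C) (fun _ u => u.1%:C).
  by apply: (appx_bnd eta01); exists B; apply: evt_all => r u [uB _]; rewrite normcR.
have T : appx D eta (fun _ u => u.2%:C) (fun _ u => u.2%:C).
  by apply: (appx_bnd eta01); exists B; apply: evt_all => r u [_ uB]; rewrite normcR.
rewrite /xplus; case: (j == 1%N).
  by apply: appxD (appx_cst eta01 _); apply: appxD X _; apply: appxZ.
case: (odd j && _); last exact: appx_cst.
apply: appxD (appx_cst eta01 _); apply: appxM (appx_cst eta01 _) => //.
by apply: appxD X _; apply: appxZ.
Qed.

Let xminus_appx k j : appx D eta (fun _ u => xminus (fun _ => 0) u.1 u.2 k j)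
   (fun _ u => xminus (fun _ => 0) u.1 u.2 k j).
Proof.
have H := appxB eta01 (appxJ (xplus_appx 0 j)) (appx_cst eta01 (if j == 1%N then k%:R else 0)).
by apply: (appx_eq H) => r u; rewrite xminus_conj.
Qed.

Let psi_appx (y : R * R -> nat -> C) i v :
  (forall j, appx D eta (fun _ u => y u j) (fun _ u => y u j)) ->
  appx D eta (fun _ u => psi s (y u) i v) (fun _ u => psi s (y u) i v).
Proof.
move=> yy; rewrite /psi; case: (v <= i)%N; last exact: appx_cst.
apply: (appxZ eta01).
apply: (@appx_schur _ _ _ _ eta01 (fun j _ u => y u j + v%:R * s j) (fun j _ u => y u j + v%:R * s j)) => j _.
by apply: appxD (appx_cst eta01 _).
Qed.

Let Psip_appx k : appx_mx D eta (fun _ u => Psip k u) (fun _ u => Psip k u).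
Proof.
move=> i v.
have H := psi_appx i v (fun j => xplus_appx k j).
by apply: (appx_eq H) => r u; rewrite mxE.
Qed.

Let Psim_appx k : appx_mx D eta (fun _ u => Psim k u) (fun _ u => Psim k u).
Proof.
move=> i v.
have H := psi_appx i v (fun j => xminus_appx k j).
by apply: (appx_eq H) => r u; rewrite mxE.
Qed.

(** As x^- is conjugate to x^+ for n = 0 and s is real, tau^(0) is a Gram determinant. Its minor on
    the columns 2j+1 is triangular with diagonal entries 2^-(2j+1), whatever x and t are. *)
Lemma tau_lower : exists2 d : R, 0 < d & forall x t, d <= normc (tau n (fun _ => 0) x t 0).
Proof.
have jn (j : 'I_n) : (j.*2.+1 < n.*2)%N by rewrite ltn_Sdouble.
pose f (j : 'I_n) : 'I_n.*2 := Ordinal (jn j).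
exists ((\prod_(i < n) (2%:R ^- i.*2.+1 : R)) ^+ 2 / n`!%:R).
  by rewrite divr_gt0 ?ltr0n ?fact_gt0 // exprn_gt0 // prodr_gt0 // => i _; rewrite invr_gt0 exprn_gt0.
move=> x t; rewrite (tauE _ _ _ _ (leqnn _)).
have -> : oddrows s n n.*2 (xminus (fun _ => 0) x t 0) = map_mx conjc (oddrows s n n.*2 (xplus (fun _ => 0) x t 0)).
  apply/matrixP => i v; rewrite !mxE /psi; case: ifP => _; last by rewrite rmorph0.
  rewrite rmorphM fmorphV rmorphXn rmorph_nat; congr (_ * _).
  rewrite (rmorph_schur (conjc : {rmorphism C -> C}) _ _ (@natU_num C)); apply: eq_schur => j _ /=.
  have -> : conjc (xplus (fun _ => 0) x t 0 j + v%:R * s j) =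
      conjc (xplus (fun _ => 0) x t 0 j) + conjc v%:R * conjc (s j) by rewrite rmorphD rmorphM.
  by rewrite conjc_nat conj_svec xminus_conj; case: ifP; rewrite subr0.
apply: le_trans (normc_det_gram _ f).
rewrite det_trig; last first.
  by apply/is_trig_mxP => i j ij; rewrite !mxE /psi ifF //=; lia.
rewrite (big_morph _ (@Normc.normcM R) (@Normc.normc1 R)).
rewrite [X in _ <= X ^+ 2 / _](eq_bigr (fun i : 'I_n => 2%:R ^- i.*2.+1)) // => i _.
by rewrite !mxE /psi /= leqnn subnn schur0 mulr1 Normc.normcV normcX normc_nat.
Qed.

Variables (X : R -> 'M[C]_(N, N.*2)) (J : 'I_N -> 'I_N.*2).
Hypothesis J_inj : injective J.
Hypothesis J_core : forall j, exists2 i, (i < N)%N & J j = core p i :> nat.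
Hypothesis XJ : evt D (fun r _ => colsub J (X r) \in unitmx).
Hypothesis Xlim : appx_mx D eta (fun r _ => invmx (colsub J (X r)) *m X r)
  (fun _ _ => \matrix_(j, k) (k == J j)%:R).

Let f k r u := \det ((X r *m Psip k u) *m (map_mx conjc (X r) *m Psim k u)^T).
Let Y r := invmx (colsub J (X r)) *m X r.
Let g k r u := \det ((Y r *m Psip k u) *m (map_mx conjc (Y r) *m Psim k u)^T).

Let fg k : evt D (fun r u => f k r u = \det (colsub J (X r)) * conjc (\det (colsub J (X r))) * g k r u).
Proof.
apply: evt_imp XJ => r u _ uJ; rewrite /f /g.
have XE : X r = colsub J (X r) *m Y r by rewrite mulKVmx.
have := det_mulmx_tr_factor (colsub J (X r)) (map_mx conjc (colsub J (X r)))
  (Y r *m Psip k u) (map_mx conjc (Y r) *m Psim k u).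
rewrite [colsub J (X r) *m _]mulmxA [map_mx conjc (colsub J (X r)) *m _]mulmxA.
by rewrite -map_mxM -XE det_map_mx.
Qed.

(** The large factor |det X_J|^2 and the constant K of [det_core_rows] are common to the indices 0
    and 1 and cancel in the quotient. *)
Lemma tau_ratio_limit : appx D eta (fun r u => f 1 r u / f 0 r u)
  (fun _ u => tau n (fun _ => 0) u.1 u.2 1 / tau n (fun _ => 0) u.1 u.2 0).
Proof.
have [K K0 KE] := det_core_rows NE J_inj J_core.
pose Pi : 'M[C]_(N, N.*2) := \matrix_(j, k) (k == J j)%:R.
have PiE k i j : (Pi *m (k : 'M[C]_(N.*2))) i j = k (J i) j.
  rewrite mxE (bigD1 (J i)) //= mxE eqxx mul1r big1 ?addr0 // => q qJ.
  by rewrite mxE (negbTE qJ) mul0r.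
have YJ : appx_mx D eta (fun r _ => map_mx conjc (Y r)) (fun _ _ => Pi).
  move=> i v; apply: (appx_eq (appxJ (Xlim i v))) => r u; rewrite !mxE //.
  by rewrite conjc_nat.
have gE k : appx D eta (g k) (fun _ u => K * tau n (fun _ => 0) u.1 u.2 k).
  have H := appx_det eta01 (appx_mulmx eta01 (appx_mulmx eta01 Xlim (Psip_appx k))
    (appx_trmx (appx_mulmx eta01 YJ (Psim_appx k)))).
  apply: (appx_eq H) => r u //; rewrite -KE; congr (\det (_ *m _^T));
    by apply/matrixP => i v; rewrite -/Pi PiE !mxE.
have [d d0 dE] := tau_lower.
have Kd : 0 < normc K * d by rewrite mulr_gt0 ?normc_gt0.
have G0 : evt D (fun (_ : R) u => normc K * d <= normc (K * tau n (fun _ => 0) u.1 u.2 0)).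
  by apply: evt_all => _ u _; rewrite Normc.normcM ler_pM2l ?normc_gt0.
have g0 := evt_norm_ge eta0 (gE 0%N) Kd G0.
have Kd2 : 0 < normc K * d / 2 by rewrite divr_gt0.
have G0' : evt D (fun (_ : R) u => normc K * d / 2 <= normc (K * tau n (fun _ => 0) u.1 u.2 0)).
  apply: evt_imp G0 => _ u _; apply: le_trans.
  by rewrite ler_pdivrMr // ler_peMr ?(ltW Kd) // ler1n.
have H := appxM eta01 (gE 1%N) (appxV eta01 Kd2 G0' g0 (gE 0%N)).
apply: (appx_ext H); apply: evt_imp (evt_and (evt_and (fg 0) (fg 1)) (evt_and XJ g0)) => r u _ [[f0 f1] [uJ gd]].
have dJ : \det (colsub J (X r)) != 0 by rewrite -unitfE -unitmxE.
have dJJ : \det (colsub J (X r)) * conjc (\det (colsub J (X r))) != 0.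
  by apply: mulf_neq0; [exact: dJ | rewrite conjc_eq0; exact: dJ].
split; last by rewrite invfM mulrACA (divff K0) mul1r.
by rewrite f0 f1 invfM mulrACA (divff dJJ) mul1r.
Qed.
End RatioLimit.
End Tau.

Lemma eq_seed (F : numFieldType) (b b' : nat -> F) mu N l :
  (forall k, (0 < k < N.*2)%N -> b k = b' k) -> seed b mu N l = seed b' mu N l.
Proof.
move=> bb; apply/matrixP => i k; rewrite !mxE; have iN := ltn_ord i.
by congr (_ + _ * _); case: ifP => // _; apply: eq_schur => j jk; apply: bb; lia.
Qed.

(** * From limits of row spaces to wave patterns *)

Section Patterns.
Variable R : realType.
Local Notation C := R[i].
Local Notation normc := (@Normc.normc R).

Lemma normc_expi (th : R) : normc (expi th) = 1.
Proof. by rewrite /expi /= cos2Dsin2 sqrtr1. Qed.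

Lemma expiN (th : R) : expi th * expi (- th) = 1.
Proof.
rewrite /expi cosN sinN; apply/eqP; rewrite eq_complex /=; simpc.
by apply/andP; split; apply/eqP; rewrite -?(cos2Dsin2 th); ring.
Qed.

Lemma normc_qN_sub N n (a : nat -> C) (x t y z : R) :
  cnorm (qN N a x t - qhat n y z * expi (2%:R * t)) =
  normc (tau N a x t 1 / tau N a x t 0 -
         tau n (fun _ => 0) y z 1 / tau n (fun _ => 0) y z 0).
Proof.
rewrite /cnorm /qhat /qN -[_ * expi (2%:R * z) * _]mulrA expiN mulr1 -mulrBl.
by rewrite Normc.normcM normc_expi mulr1.
Qed.

(** Used with zeta = 0 near (x0, t0), and with zeta = zb om near an outer point. *)
Lemma pattern_limit (N p n : nat) (B : R) (eta : R -> R)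
    (a b : R -> nat -> C) (c zeta : R -> C) (J : 'I_N -> 'I_N.*2) :
  let D (u : R * R) := `|u.1| <= B /\ `|u.2| <= B in
  let X r := seed (b r) (c r)^-1 N N.*2 in
  N = (p + n)%N ->
  (forall e, 0 < e -> evt D (fun r _ => 0 <= eta r <= e)) ->
  evt D (fun r _ => c r != 0) ->
  (forall r k, odd k -> (2 < k < N.*2)%N ->
     a r k + lin k (zeta r + c r) / k`!%:R = c r ^+ k / k%:R + b r k) ->
  (forall r, b r 1%N = zeta r) ->
  (forall r k, ~~ odd k -> b r k = 0) ->
  injective J ->
  (forall j, exists2 i, (i < N)%N & J j = core p i :> nat) ->
  evt D (fun r _ => colsub J (X r) \in unitmx) ->
  appx_mx D eta (fun r _ => invmx (colsub J (X r)) *m X r)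
    (fun _ _ => \matrix_(j, k) (k == J j)%:R) ->
  exists K R0 : R, forall r, R0 <= r -> forall x t,
    `|x - complex.Re (zeta r + c r)| <= B -> `|t - complex.Im (zeta r + c r) / 2| <= B ->
    cnorm (qN N (a r) x t - qhat n (x - complex.Re (zeta r + c r))
       (t - complex.Im (zeta r + c r) / 2) * expi (2%:R * t)) <= K * eta r.
Proof.
move=> D X NE eta0 c0 aE b1 be J_inj J_core XJ Xlim.
have [K [K0 H]] := tau_ratio_limit NE eta0 J_inj J_core XJ Xlim.
have [R0 HR] := evt_and H c0.
exists K, R0 => r rR x t xB tB.
have [[_ HK] cr0] := HR r rR (x - complex.Re (zeta r + c r), t - complex.Im (zeta r + c r) / 2) (conj xB tB).
rewrite normc_qN_sub; apply: le_trans HK; rewrite /=.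
have E k := @tau_seed R N (a r) (b r) (c r) (zeta r) cr0 (aE r) (b1 r) (be r)
  (x - complex.Re (zeta r + c r)) (t - complex.Im (zeta r + c r) / 2) k.
have cc : (c r * conjc (c r)) ^+ N != 0 by rewrite expf_neq0 // mulf_neq0 // conjc_eq0.
rewrite ![complex.Re _ + (_ - _)]addrC ![complex.Im _ / 2 + (_ - _)]addrC !subrK in E.
rewrite !E [((c r * _) ^+ N * _)^-1]invfM mulrACA divff // mul1r lexx //.
Qed.

Section ShiftedOrigin.
Variables (N : nat) (z0 u : C) (kap1 : nat -> C).
Hypothesis N0 : (1 < N)%N.
Hypothesis z00 : z0 != 0.
Hypothesis u1 : cnorm u = 1.

(* The coefficient of |A| in x_(2j+1)^+ at (x0, t0): the condition (star_j) says that it vanishes. *)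
Definition coef j : C := ((cRe (z0 * u))%:C + 2%:R ^+ (2 * j) * 'i * (cIm (z0 * u))%:C)
  / (2 * j).+1`!%:R + kap1 j * u.

Let A (r : R) : C := r%:C * u.
Let a (r : R) (k : nat) : C := if odd k && (3 <= k <= (2 * N - 1))%N
     then z0 ^+ (2 * k./2).+1 / (2 * k./2).+1%:R * A r ^+ k + kap1 k./2 * A r else 0.
Let c r := z0 * A r.

Lemma u_neq0 : u != 0.
Proof. by rewrite -normc_gt0 -[normc u]/(cnorm u) u1. Qed.

Lemma star_coef j : (kap1 j = - ((cRe (z0 * u))%:C + 2%:R ^+ (2 * j) * 'i * (cIm (z0 * u))%:C)
              / (2 * j).+1`!%:R * u^-1) <-> coef j = 0.
Proof.
rewrite /coef; set x := _ + _ * (cIm _)%:C; rewrite [- x / _]mulNr.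
set q := x / _; split => [->|/eqP].
  by rewrite mulNr mulNr divfK ?u_neq0 // subrr.
by rewrite addrC addr_eq0 => /eqP E; rewrite -E mulfK ?u_neq0.
Qed.

Lemma linE k (z : C) : lin k.+1 z = (complex.Re z)%:C + 2%:R ^+ k * 'i * (complex.Im z)%:C.
Proof.
rewrite /lin fmorph_div rmorph_nat; congr (_ + _).
have n2 : 2%:R != 0 :> C by rewrite pnatr_eq0.
by rewrite exprS; field.
Qed.

Lemma linR k (r : R) z : lin k (r%:C * z) = r%:C * lin k z.
Proof.
rewrite /lin; case: z => x y; have -> : r%:C * (x +i* y) = (r * x) +i* (r * y).
  by apply/eqP; rewrite eq_complex /= !(mul0r, mulr0, subr0, addr0) !eqxx.
by rewrite /= -mulrA !rmorphM /= mulrDr; congr (_ + _); ring.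
Qed.

Lemma lin0 k : lin k (0 : C) = 0.
Proof. by have := linR k 0 (0 : C); rewrite rmorph0 !mul0r. Qed.

(** What remains at the centre zeta + z0 A once artanh(z0 A eps) is removed. The contributions of z0
    A to x_k^+ and of kap1 A add up to [coef] times r. *)
Definition shift_param (zeta : C) (r : R) k : C :=
  if k == 1%N then zeta
  else if odd k then lin k zeta / k`!%:R + coef k./2 * r%:C else 0.

Lemma shift_paramE zeta r k : odd k -> (2 < k < N.*2)%N ->
  a r k + lin k (zeta + c r) / k`!%:R = c r ^+ k / k%:R + shift_param zeta r k.
Proof.
move=> ok /andP [k2 kN]; have kE : k = (2 * k./2).+1 by rewrite mul2n -{1}(odd_double_half k) ok.
have k1 : (k == 1%N) = false by rewrite gtn_eqF // ltnW.
have kN' : (k <= 2 * N - 1)%N by lia.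
rewrite /a ok k2 kN' /shift_param k1 ok /=.
rewrite linD /c /A [z0 * (_ * _)]mulrCA linR [X in lin X (z0 * u)]kE linE /coef.
rewrite -kE /cRe /cIm !exprMn; ring.
Qed.

Lemma c_neq0 : forall r, 1 <= r -> c r != 0.
Proof.
move=> r r1; rewrite /c /A !mulf_neq0 ?u_neq0 // -normc_gt0 normcR normr_gt0 gt_eqF //.
exact: lt_le_trans r1.
Qed.

Section Near.
Variable m : nat.
Hypothesis m0 : (0 < m)%N.
Hypothesis star : forall j, (1 <= j < m)%N -> coef j = 0.
Hypothesis cm0 : coef m != 0.

Lemma near_pattern B : 0 < B -> exists K R0 : R, forall r : R, R0 <= r ->
  forall x t : R, `|x - cRe (c r)| <= B -> `|t - cIm (c r) / 2| <= B ->
  cnorm (qN N (a r) x t - qhat (N0of (N - 1) m) (x - cRe (c r)) (t - cIm (c r) / 2)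
     * expi (2%:R * t)) <= K / r.
Proof.
move=> B0; pose D (u : R * R) := `|u.1| <= B /\ `|u.2| <= B.
pose T := m.*2.+1.
have Jlt (j : 'I_N) : (wtinv m j < N.*2)%N.
  by apply: leq_ltn_trans (wtinv_le m0 j) _; rewrite ltn_double.
pose J (j : 'I_N) : 'I_N.*2 := Ordinal (Jlt j).
have J_inj : injective J.
  by move=> i j /(congr1 val) /= /(can_inj (wtinvK m0)) /val_inj.
pose om r : C := (r `^ (T%:R^-1))%:C.
have omT : evt D (fun r _ => om r ^+ T = r%:C).
  apply: evt_imp (evt_ge D 0) => r _ _ r0.
  by rewrite /om -rmorphXn /= -powR_mulrn ?powR_ge0 // -powRrM mulVf ?pnatr_eq0 // powRr1.
have D0 : exists u, D u by exists (0, 0); split; rewrite normr0 ltW.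
have nu := @near_unit R _ D m N N.*2 m0 om coef (z0 * u)^-1 J omT cm0 (fun _ => erefl).
have nr := @near_rows R _ D m N N.*2 m0 om coef (z0 * u)^-1 J D0 omT cm0 (fun _ => erefl).
have nE : N0of (N - 1) m = (let r := N.-1 %% T in if r <= m then r else m.*2 - r)%N.
  by rewrite /N0of mul2n subn1.
have core_J (j : 'I_N) := wtinv_core m0 (ltn_ord j) (ltnW N0).
have nN : (N0of (N - 1) m <= N)%N by rewrite nE; have [] := core_J (Ordinal (ltnW N0)).
have seedE r : 1 <= r -> seed (shift_param 0 r) (c r)^-1 N N.*2 =
    seed (near_param m coef r) ((z0 * u)^-1 / r%:C) N N.*2.
  move=> r1; rewrite /c /A mulrCA invfM [_^-1 * _^-1]mulrC; apply: eq_seed => k /andP [k0 _].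
  rewrite /shift_param /near_param lin0 mul0r add0r.
  case: eqP => [->|k1]; first by rewrite ifF //; lia.
  case: (boolP (odd k)) => //= ok; case: (leqP T k) => // kT.
  by rewrite star ?mul0r //; rewrite /T in kT; lia.
have be r k : ~~ odd k -> shift_param 0 r k = 0.
  by move=> ok; rewrite /shift_param (negbTE ok); case: eqP ok => // ->.
have XJ : evt D (fun r _ => colsub J (seed (shift_param 0 r) (c r)^-1 N N.*2) \in unitmx).
  by apply: evt_imp (evt_and nu (evt_ge D 1)) => r _ _ [h r1]; rewrite seedE.
have Xlim : appx_mx D (fun r => r^-1)
    (fun r _ => invmx (colsub J (seed (shift_param 0 r) (c r)^-1 N N.*2)) *m
       seed (shift_param 0 r) (c r)^-1 N N.*2) (fun _ _ => \matrix_(j, k) (k == J j)%:R).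
  move=> j k; apply: (appx_ext (nr j k)); apply: evt_imp (evt_ge D 1) => r _ _ r1.
  by rewrite seedE.
have Jcore (j : 'I_N) : exists2 i, (i < N)%N & J j = core (N - N0of (N - 1) m) i :> nat.
  by have [_] := core_J j; rewrite -nE.
have c0 : evt D (fun r _ => c r != 0) by apply: evt_imp (evt_ge _ 1) => r _ _; apply: c_neq0.
have [K [R0 HK]] := pattern_limit (esym (subnK nN)) (@inv_eta0 R _ D) c0
  (fun r k => @shift_paramE 0 r k) (fun _ => erefl) be J_inj Jcore XJ Xlim.
exists K, R0 => r rR x t xB tB; have := HK r rR x t; rewrite !add0r; exact.
Qed.
End Near.
End ShiftedOrigin.
End Patterns.

Lemma mup1_deriv_neq0 (F : fieldType) (p : {poly F}) x :
  p != 0 -> mup x p = 1%N -> p^`().[x] != 0.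
Proof.
move=> p0 mx; have : ('X - x%:P) ^+ 1 %| p by rewrite -mup_geq // mx.
rewrite expr1 => /dvdpP [q pE].
rewrite pE derivM derivXsubC mulr1 hornerD hornerM hornerXsubC subrr mulr0 add0r.
apply/negP => qx; have : ('X - x%:P) ^+ 2 %| p.
  by rewrite pE expr2 dvdp_mul // dvdp_XsubCl.
by rewrite -mup_geq // mx.
Qed.

(** * First-order waves at the outer points *)

Section Far.
Variable R : realType.
Local Notation C := R[i].
Local Notation normc := (@Normc.normc R).
Variables (N : nat) (z0 u : C) (kap1 : nat -> C) (m : nat).
Hypothesis N0 : (1 < N)%N.
Hypothesis z00 : z0 != 0.
Hypothesis u1 : cnorm u = 1.
Hypothesis m0 : (0 < m)%N.
Hypothesis mN : (m.*2.+1 < N.*2)%N.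
Local Notation T := m.*2.+1.
Local Notation coef := (coef z0 u kap1).
Hypothesis star : forall j, (1 <= j < m)%N -> coef j = 0.
Hypothesis cm0 : coef m != 0.

Definition yv_param : C := - (2%:R ^+ (2 * m) / (2 * m).+1%:R).

Lemma yv_param_neq0 : yv_param != 0.
Proof. by rewrite /yv_param oppr_eq0 mulf_neq0 ?invr_eq0 ?expf_neq0 ?pnatr_eq0. Qed.

Let A (r : R) : C := r%:C * u.
Let a (r : R) (k : nat) : C := if odd k && (3 <= k <= (2 * N - 1))%N
     then z0 ^+ (2 * k./2).+1 / (2 * k./2).+1%:R * A r ^+ k + kap1 k./2 * A r else 0.
Let c r := z0 * A r.
(** Normalized so that the parameter coef m * r of degree 2m+1, divided by om^(2m+1) = W, is exactly
    the kappa_m of the Yablonskii-Vorob'ev polynomial. *)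
Let W r : C := - ((2 * m).+1%:R / 2%:R ^+ (2 * m)) * (coef m * r%:C).

Variables (rt : C -> C) (zb : C).
Hypothesis rtE : forall w, rt w ^+ (2 * m).+1 = w.
Hypothesis zb0 : zb != 0.
Hypothesis Dzb : root (\det (theta_mx m yv_param N N)) zb.
Hypothesis D'zb : (\det (theta_mx m yv_param N N))^`().[zb] != 0.

Let om r := rt (W r).
Let zeta r := zb * om r.
Let K0 : R := normc (- ((2 * m).+1%:R / 2%:R ^+ (2 * m)) * coef m).

Let K0_gt0 : 0 < K0.
Proof.
by rewrite normc_gt0 mulf_neq0 // oppr_eq0 mulf_neq0 ?invr_eq0 ?expf_neq0 ?pnatr_eq0.
Qed.

Section Bound.
Variables (B : R) (B0 : 0 < B).
Let D (u : R * R) := `|u.1| <= B /\ `|u.2| <= B.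

Let omT r : om r ^+ T = W r.
Proof. by rewrite -[RHS]rtE mul2n. Qed.

Let om_norm : evt D (fun r _ => normc (om r) ^+ T = K0 * r).
Proof.
apply: evt_imp (evt_ge D 0) => r _ _ r0.
by rewrite -normcX omT /W mulrA Normc.normcM normcR ger0_norm.
Qed.

Let om_ge := root_large K0_gt0 (ltn0Sn m.*2) om_norm.
Let om1 := om_ge 1.

Let eta r := (normc (om r))^-2.

Let eta0 e : 0 < e -> evt D (fun r _ => 0 <= eta r <= e).
Proof. exact: (root_inv_eta0 K0_gt0 (ltn0Sn m.*2) om_norm 1). Qed.

Let eta01 := eta0 ltr01.

Let y0 j : C := if j == 1%N then zb else if j == T then yv_param else 0.

Let om_neq0 r q : 1 <= normc (om r) -> om r ^+ q != 0.
Proof. by move=> h; rewrite expf_neq0 // -normc_gt0 (lt_le_trans ltr01). Qed.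

(** zeta is of order om, so the quotient is of order om^(1-j); degree 3 fixes the exponent 2 of the
    error. *)
Let lin_part j : (2 < j)%N ->
  appx D eta (fun r _ => lin j (zeta r) / j`!%:R / om r ^+ j) (fun _ _ => 0).
Proof.
move=> j2; apply: (@appx_O _ _ _ _ eta01 _ ((1 + 2 ^+ j) * normc zb)).
apply: evt_imp om1 => r _ _ o1; have o0 : 0 < normc (om r) := lt_le_trans ltr01 o1.
rewrite !Normc.normcM !Normc.normcV normcX normc_nat.
apply: (@le_trans _ _ (normc (lin j (zeta r)) / normc (om r) ^+ j)).
  rewrite ler_wpM2r ?invr_ge0 ?exprn_ge0 ?normc_ge0 // ler_piMr ?normc_ge0 //.
  by rewrite invf_le1 ?ltr0n ?fact_gt0 // ler1n fact_gt0.
rewrite ler_pdivrMr ?exprn_gt0 //; apply: le_trans (normc_lin _ _) _.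
rewrite /zeta Normc.normcM !mulrA -[leRHS]mulrA ler_wpM2l ?mulr_ge0 ?normc_ge0 ?addr_ge0 ?exprn_ge0 //.
rewrite /eta -(subnK (_ : 2 <= j)%N) ?(ltnW j2) // exprD mulrCA mulVf ?mulr1 ?expf_neq0 ?gt_eqF //.
by rewrite -{1}[normc (om r)]expr1 ler_weXn2l //; lia.
Qed.

Let coef_part j : odd j -> (2 < j)%N ->
  appx D eta (fun r _ => coef j./2 * r%:C / om r ^+ j) (fun _ _ => y0 j).
Proof.
move=> oj j2; have j1 : (j == 1%N) = false by rewrite gtn_eqF // ltnW.
rewrite /y0 j1; have [->|jT] := eqVneq j T.
  have Th : T./2 = m by rewrite /= uphalf_double.
  apply: (appx_ext (appx_cst eta01 yv_param)); apply: evt_imp (evt_ge D 1) => r _ _ r1.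
  have r0 : r%:C != 0 by rewrite -normc_gt0 normcR normr_gt0 gt_eqF // (lt_le_trans ltr01).
  rewrite Th omT /W; split => //; have k0 := cm0.
  rewrite /yv_param; have h1 : (2 * m).+1%:R != 0 :> C by rewrite pnatr_eq0.
  have h2 : 2%:R ^+ (2 * m) != 0 :> C by rewrite expf_neq0 // pnatr_eq0.
  move: h1 h2; move: ((2 * m).+1%:R) (2%:R ^+ (2 * m)) => p q p0 q0.
  by field; rewrite p0 q0 k0 r0.
case: (ltnP j T) => jT'.
  apply: (appx_eq (appx_cst eta01 0)) => // r _.
  by rewrite star ?mul0r //; lia.
have jT2 : (T.+2 <= j)%N by lia.
apply: (@appx_O _ _ _ _ eta01 _ (normc (coef j./2) / K0)).
apply: evt_imp (evt_and (evt_and om1 om_norm) (evt_ge D 0)) => r _ _ [H r0]; case: H => o1 oT.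
have o0 : 0 < normc (om r) := lt_le_trans ltr01 o1.
rewrite !Normc.normcM Normc.normcV normcX normcR ger0_norm // -!mulrA ler_wpM2l ?normc_ge0 //.
rewrite (_ : r / _ = K0^-1 * (normc (om r) ^+ T / normc (om r) ^+ j)); last first.
  by rewrite oT mulrA mulKf // gt_eqF.
rewrite ler_pM2l ?invr_gt0 // ler_pdivrMr ?exprn_gt0 // mulrC ler_pdivlMr ?exprn_gt0 //.
by rewrite -exprD ler_weXn2l // addn2.
Qed.

Let param_limit j : (0 < j < N.*2)%N ->
  appx D eta (fun r _ => shift_param z0 u kap1 (zeta r) r j / om r ^+ j) (fun _ _ => y0 j).
Proof.
move=> /andP [j0 jN]; have [->|j1] := eqVneq j 1%N.
  apply: (appx_ext (appx_cst eta01 zb)); apply: evt_imp om1 => r _ _ o1.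
  by rewrite /shift_param /zeta /= expr1 mulfK // -[om r]expr1 om_neq0.
case: (boolP (odd j)) => oj; last first.
  apply: (appx_eq (appx_cst eta01 0)) => r _.
    by rewrite /shift_param (negbTE j1) (negbTE oj) mul0r.
  by rewrite /y0 (negbTE j1); case: eqP oj => // ->; rewrite /= odd_double.
have j2 : (2 < j)%N by move: j0 j1 oj; case: j {jN} => [|[|[|]]].
have H := appxD (lin_part j2) (coef_part oj j2).
by apply: (appx_eq H) => r _; rewrite ?add0r // /shift_param (negbTE j1) oj mulrDl.
Qed.

Let muE : evt D (fun r _ => (c r)^-1 * om r ^+ T =
  (z0 * u)^-1 * (- ((2 * m).+1%:R / 2%:R ^+ (2 * m)) * coef m)).
Proof.
apply: evt_imp (evt_ge D 1) => r _ _ r1.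
have r0 : r%:C != 0 by rewrite -normc_gt0 normcR normr_gt0 gt_eqF // (lt_le_trans ltr01).
rewrite omT /W /c /A; have u0 := u_neq0 u1; move: (- _) (coef m) => v k.
by field; rewrite z00 u0 r0.
Qed.

Let X r := seed (shift_param z0 u kap1 (zeta r) r) (c r)^-1 N N.*2.
Let X0 : 'M[C]_(N, N.*2) := \matrix_(i, k) if (k <= i.*2)%N then schur y0 (i.*2 - k) else 0.

Let XW : appx_mx D eta
  (fun r _ => \matrix_(i < N, k < N.*2) (X r i k * om r ^+ k / om r ^+ i.*2)) (fun _ _ => X0).
Proof. by move=> i k; apply: (far_seed m0 om1 muE param_limit). Qed.

Let Jnat j := if j.+1 == N then N else j.

Let Jlt (j : 'I_N) : (Jnat j < N.*2)%N.
Proof. by rewrite /Jnat; have := ltn_ord j; case: eqP => ? ?; lia. Qed.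

Let J (j : 'I_N) : 'I_N.*2 := Ordinal (Jlt j).

Let J_inj : injective J.
Proof.
move=> i j /(congr1 val) /= E; apply: val_inj; move: E; rewrite /Jnat /=.
by have := ltn_ord i; have := ltn_ord j; case: eqP => ?; case: eqP => ? ? ? ?; lia.
Qed.

Let detJ : \det (colsub J X0) != 0.
Proof.
move: D'zb; rewrite deriv_theta_det ?(ltnW N0) ?yv_param_neq0 //.
rewrite -[_.[zb]]/(horner_eval zb _) -det_map_mx; congr (\det _ != 0).
apply/matrixP => i v; rewrite !mxE /= -/(Jnat v) /horner_eval.
by case: ifP => _; rewrite ?horner0 // horner_theta.
Qed.

Let I0lt (j : 'I_N) : (j < N.*2)%N.
Proof. by have := ltn_ord j; lia. Qed.

Let detI : \det (colsub (fun j : 'I_N => Ordinal (I0lt j)) X0) = 0.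
Proof.
have /eqP <- := Dzb; rewrite -[RHS]/(horner_eval zb _) -det_map_mx; congr (\det _).
apply/matrixP => i v; rewrite !mxE /= /horner_eval.
by case: ifP => _; rewrite ?horner0 // horner_theta.
Qed.

(** The only column outside J that is lighter than one of J is N-1, against N. Cramer's rule makes
    the limit entry the quotient of the minors in [detI] and [detJ]: 0 because zb is a root, with a
    nonzero denominator because the root is simple. *)
Let wJ j (k : 'I_N.*2) : (forall j', k != J j') ->
  (id (J j) < id k)%N \/
  [/\ id (J j) = (id k).+1 :> nat, (invmx (colsub J X0) *m X0) j k = 0 &
     evt D (fun r _ => eta r * normc (om r) ^+ 2 <= 1)].
Proof.
move=> kJ; have jN := ltn_ord j.
have kN : (k.+1 = N)%N \/ (N < k)%N.
  case: (ltngtP k.+1 N) => kN; [|right|by left].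
    have := kJ (Ordinal (ltnW kN)); rewrite -val_eqE /= /Jnat /= ifF ?eqxx //; lia.
  have NN := ltnSn N.-1; rewrite prednK ?(ltnW N0) // in NN.
  have Np : (N.-1 < N)%N by rewrite prednK // ltnW.
  have := kJ (Ordinal Np); rewrite -val_eqE /= /Jnat /= prednK ?eqxx ?(ltnW N0) //.
  by move=> /eqP ?; lia.
rewrite /= /Jnat; case: eqP => jE; last by left; lia.
case: kN => kN; last by left.
right; split; first by lia; last first.
- have uJ : colsub J X0 \in unitmx by rewrite unitmxE unitfE.
  pose Y := invmx (colsub J X0) *m X0.
  have YJ i v : Y i (J v) = (i == v)%:R.
    transitivity ((invmx (colsub J X0) *m colsub J X0) i v).
      by rewrite !mxE; apply: eq_bigr => q _; rewrite !mxE.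
    by rewrite mulVmx // mxE.
  have XY : X0 = colsub J X0 *m Y by rewrite mulKVmx.
  rewrite -/Y; clearbody Y.
  pose I0 (v : 'I_N) : 'I_N.*2 := Ordinal (I0lt v).
  have : \det (colsub J X0 *m colsub I0 Y) = 0.
    rewrite -[RHS]detI; congr (\det _); apply/matrixP => i v.
    by rewrite [in RHS]mxE [in RHS]XY !mxE; apply: eq_bigr => q _; rewrite [colsub I0 _ _ _]mxE.
  (* Replacing column N of J by N-1 in Y leaves a triangular matrix with unit diagonal except at j,
     so its determinant is the entry sought. *)
  rewrite det_mulmx => /eqP; rewrite mulf_eq0 (negbTE detJ) /= -det_tr det_trig; last first.
    apply/is_trig_mxP => v i vi; rewrite !mxE.
    have -> : I0 v = J v by apply: val_inj; rewrite /= /Jnat ifF //; have := ltn_ord i; lia.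
    by rewrite YJ -val_eqE /= gtn_eqF.
  rewrite (bigD1 j) //= big1 ?mulr1.
    rewrite !mxE => /eqP; congr (Y _ _ = 0); apply: val_inj => /=; lia.
  move=> v vj; rewrite !mxE.
  have -> : I0 v = J v.
    apply: val_inj; rewrite /= /Jnat ifF //; apply/eqP => vN; case/eqP: vj.
    by apply: val_inj; apply: succn_inj; rewrite vN jE.
  by rewrite YJ eqxx.
apply: evt_imp om1 => r _ _ o1; rewrite /eta mulVf //.
by rewrite expf_neq0 // gt_eqF // (lt_le_trans ltr01).
Qed.

Let Jcore (j : 'I_N) : exists2 i, (i < N)%N & J j = core N.-1 i :> nat.
Proof.
exists j => //=; rewrite /Jnat /core; have := ltn_ord j; case: eqP => jE jN.
  by rewrite ifF; lia.
by rewrite ifT //; lia.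
Qed.

Lemma far_pattern : exists K R0 : R, forall r : R, R0 <= r ->
  forall x t : R, `|x - cRe (zeta r + c r)| <= B -> `|t - cIm (zeta r + c r) / 2| <= B ->
  cnorm (qN N (a r) x t - qhat 1 (x - cRe (zeta r + c r)) (t - cIm (zeta r + c r) / 2)
     * expi (2%:R * t)) <= K * r `^ (- (1 / (2 * m).+1%:R)).
Proof.
have XJ := @colsub_unit R _ D eta eta0 N N.*2 X X0 om id (fun i => i.*2) J om1 XW detJ.
have Xlim := @row_limit R _ D eta eta0 N N.*2 X X0 om id (fun i => i.*2) J om1 XW detJ J_inj wJ.
have eta0' e : 0 < e -> evt D (fun r _ => 0 <= (normc (om r))^-1 <= e).
  by move/(root_inv_eta0 K0_gt0 (ltn0Sn m.*2) om_norm 0); apply: evt_imp => r _ _; rewrite expr1.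
have be r k : ~~ odd k -> shift_param z0 u kap1 (zeta r) r k = 0.
  by move=> ok; rewrite /shift_param (negbTE ok); case: eqP ok => // ->.
have c0 : evt D (fun r _ => c r != 0) by apply: evt_imp (evt_ge _ 1) => r _ _; apply: c_neq0.
have NE : N = (N.-1 + 1)%N by rewrite addn1 prednK // ltnW.
have aE r k : odd k -> (2 < k < N.*2)%N -> a r k + lin k (zeta r + c r) / k`!%:R =
    c r ^+ k / k%:R + shift_param z0 u kap1 (zeta r) r k by exact: shift_paramE.
have [K [R0 HK]] := pattern_limit NE eta0' c0 aE (fun _ => erefl) be J_inj Jcore XJ Xlim.
pose s : R := (2 * m).+1%:R^-1.
(* |om| = (K0 r)^(1/(2m+1)), so passing from |om|^-1 to the power of r costs the constant
   K0^(-1/(2m+1)). *)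
exists (K * (K0 `^ s)^-1), (Num.max R0 (Num.max 0 1)) => r.
rewrite !ge_max => /andP [rR /andP [r0 r1]] x t xB tB.
apply: le_trans (HK r rR x t xB tB) _; rewrite -mulrA le_eqVlt; apply/orP; left; apply/eqP.
congr (_ * _); rewrite -/s div1r powRN -invfM; congr (_^-1).
apply: (@pexpIrn _ T) => //; rewrite ?nnegrE ?mulr_ge0 ?powR_ge0 ?normc_ge0 //.
have P v : 0 <= v -> (v `^ s) ^+ T = v.
  by move=> v0; rewrite -powR_mulrn ?powR_ge0 // -powRrM /s mul2n mulVf ?pnatr_eq0 // powRr1.
rewrite exprMn !P ?(ltW K0_gt0) //.
by rewrite -normcX omT /W mulrA Normc.normcM normcR ger0_norm.
Qed.
End Bound.
End Far.

Lemma sum_core_cast (N p n : nat) (J : 'I_N -> nat) : N = (p + n)%N -> injective J ->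
  (forall j, exists2 i, (i < N)%N & J j = core p i) ->
  (\sum_j J j)%N = ((n * n.+1)./2 + \sum_(j < N) j)%N.
Proof.
move=> NE; subst N => J_inj J_core; apply: sum_core => // j.
by have [i iN ->] := J_core j; exists (Ordinal iN).
Qed.

Lemma complex_eq (R : realType) (x y : R[i]) :
  complex.Re x = complex.Re y -> complex.Im x = complex.Im y -> x = y.
Proof. by case: x y => a b [c d] /= -> ->. Qed.

Lemma lin_eq0 (R : realType) k (z : R[i]) : lin k z = 0 -> z = 0.
Proof.
rewrite /lin; case: z => x y /=.
have -> : x%:C + 2%:R ^+ k * 'i * (y / 2)%:C = Complex x (2%:R ^+ k * (y / 2)).
  have -> : 2%:R ^+ k = (2%:R ^+ k)%:C :> R[i] by rewrite rmorphXn rmorph_nat.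
  by apply: complex_eq; rewrite /= !(mul0r, mulr0, mulr1, subr0, addr0, add0r, sub0r, oppr0).
move=> [-> /eqP]; rewrite mulf_eq0 expf_eq0 pnatr_eq0 andbF /= mulf_eq0 invr_eq0 pnatr_eq0 orbF.
by move=> /eqP ->.
Qed.

(** * Degree and roots of the Yablonskii-Vorob'ev polynomials *)

Section YVRoots.
Variables (R : realType) (m M : nat).
Hypothesis m0 : (0 < m)%N.
Local Notation Q := (YV R m M).
Local Notation D := (\det (theta_mx m (yv_param R m) M.+1 M.+1)).

Lemma cN_neq0 : (cN M)%:R != 0 :> R[i].
Proof.
rewrite pnatr_eq0 -lt0n /cN prodn_gt0 // => i.
suff H n : (0 < dfact n)%N /\ (0 < dfact n.+1)%N by case: (H (2 * i - 1)%N).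
by elim: n => [|n [IH1 IH2]] //; split => //; rewrite /= muln_gt0.
Qed.

(** The first row of the larger matrix is (theta_0, 0, .., 0) = (1, 0, .., 0). Expanding along it
    leaves the indices 2(i+1) - (j+1) = 2i + 1 - j of the Adler-Moser matrix. *)
Lemma YV_theta : Q = (cN M)%:R *: D.
Proof.
rewrite /YV /AdlerMoser; congr (_ *: _).
set kap := fun j : nat => _.
have tE k : theta_poly kap k = theta m (yv_param R m) k.
  apply: eq_schur => l _; case: eqP => // l1.
  case: eqP => [->|lT]; first by rewrite /= odd_double /kap uphalf_double eqxx.
  case: (boolP (odd l)) => // ol; rewrite /kap ifF ?polyC0 //; apply/eqP => E; apply: lT.
  by rewrite -[l]odd_double_half ol E.
rewrite [RHS](expand_det_row _ ord0) (bigD1 ord0) //= big1 ?addr0 => [|v v0].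
  rewrite mxE /= subnn /theta schur0 mul1r /cofactor expr0 mul1r.
  congr (\det _); apply/matrixP => i j; rewrite !mxE /= /bump /= !add1n mul2n.
  by rewrite doubleS ltnS subSS tE.
by rewrite mxE /= leqn0 ifF ?mul0r //; apply/negbTE; rewrite -val_eqE in v0.
Qed.

Lemma root_YV z : root Q z = root D z.
Proof. by rewrite YV_theta rootZ ?cN_neq0. Qed.

Lemma mup_YV z : mup z Q = mup z D.
Proof.
rewrite YV_theta -mul_polyC mupMr // rootC; exact: cN_neq0.
Qed.

Lemma size_YV : size Q = ((M * M.+1)./2).+1.
Proof.
rewrite YV_theta size_scale ?cN_neq0 // size_theta_det ?yv_param_neq0 //; congr _.+1.
have H q : ((\sum_(i < q.+1) i).*2 = q * q.+1)%N.
  by elim: q => [|q IH]; [rewrite big_ord1 | rewrite big_ord_recr /= doubleD IH; lia].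
by rewrite -H doubleK.
Qed.

Lemma mup0_YV : mup 0 Q = ((N0of M m * (N0of M m).+1)./2)%N.
Proof.
rewrite mup_YV.
have Jlt (j : 'I_M.+1) : (wtinv m j < (M.+1).*2)%N.
  by apply: leq_ltn_trans (wtinv_le m0 j) _; rewrite ltn_double.
have core_J (j : 'I_M.+1) := wtinv_core m0 (ltn_ord j) (ltn0Sn M).
have nE : N0of M m = (let r := M %% m.*2.+1 in if r <= m then r else m.*2 - r)%N.
  by rewrite /N0of mul2n.
have := @mup_theta_det _ m (yv_param R m) m0 (yv_param_neq0 R m) M.+1 _ (fun j => Ordinal (Jlt j)) (leqnn _) (fun _ => erefl).
rewrite /= (@sum_core_cast M.+1 (M.+1 - N0of M m) (N0of M m) (fun j => wtinv m j)).
- by move/eqP; rewrite eqn_add2r => /eqP.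
- by rewrite subnK // nE; have [] := core_J ord0.
- by move=> i j /(can_inj (wtinvK m0)) /val_inj.
by move=> j; have [_] := core_J j; rewrite -nE.
Qed.

(** R[i] is algebraically closed, so the nonzero roots counted with multiplicity number the degree
    minus the multiplicity of 0; simplicity makes this a count of distinct roots. *)
Lemma YV_roots : (forall z, z != 0 -> root Q z -> mup z Q = 1%N) ->
  exists zs : seq R[i], [/\ uniq zs, forall z, (z \in zs) = (z != 0) && root Q z
    & size zs = Gammaof M m].
Proof.
move=> simple.
have Q0 : Q != 0 by rewrite -size_poly_gt0 size_YV.
have [rs QE] := closed_field_poly_normal (Q : {poly R[i]}).
have lc0 : lead_coef Q != 0 by rewrite lead_coef_eq0.
have mupE z : mup z Q = count_mem z rs.
  by rewrite QE -mul_polyC mupMr ?rootC // mu_prod_XsubC.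
have rootE z : root Q z = (z \in rs) by rewrite QE rootZ // root_prod_XsubC.
have srs : size rs = ((M * M.+1)./2)%N.
  by apply: succn_inj; rewrite -size_YV QE size_scale // size_prod_XsubC.
exists [seq z <- rs | z != 0]; split.
- apply: count_mem_uniq => z; rewrite count_filter mem_filter /=.
  case: (eqVneq z 0) => [->|z0] /=.
    by rewrite (eq_count (a2 := pred0)) ?count_pred0 // => x /=; case: eqP.
  rewrite (eq_count (a2 := pred1 z)); last by move=> x /=; case: eqP => //= ->.
  case: (boolP (z \in rs)) => zr; last by apply/count_memPn.
  by rewrite -mupE simple // rootE.
- by move=> z; rewrite mem_filter rootE.
rewrite size_filter; have := count_predC (pred1 (0 : R[i])) rs.
rewrite -mupE mup0_YV srs /Gammaof => E.
rewrite (eq_count (a2 := predC (pred1 0))); last by move=> z.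
rewrite divn2; move: E; move: (count _ _) => q.
have e1 : odd (M * M.+1) = false by rewrite oddM /= andbN.
have e2 : odd (N0of M m * (N0of M m).+1) = false by rewrite oddM /= andbN.
by move: (M * M.+1)%N (N0of M m * (N0of M m).+1)%N e1 e2 => x y; lia.
Qed.
End YVRoots.

(* A = r * u with r > 0 real, |u| = 1 (u = e^{i arg A}); |A| = r -> oo. *)
Theorem theorem3 (R : realType) (N : nat) (z0 u : R[i]) (kap1 : nat -> R[i]) :
  (3 <= N)%N -> z0 != 0 -> cnorm u = 1 ->
  (* standing assumption on Theta_N with kappa_j = z0^(2j+1)/(2j+1) *)
  (let Th := AdlerMoser (fun j => z0 ^+ (2 * j).+1 / (2 * j).+1%:R) N in
   Th != 0 /\ mup z0 Th = (N * (N - 1) %/ 2)%N /\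
   exists ws : seq R[i], [/\ uniq ws, size ws = N, z0 \notin ws
                           & forall w, w \in ws -> mup w Th = 1%N]) ->
  kap1 (N - 1)%N = 0 ->
  let kap := fun j : nat => z0 ^+ (2 * j).+1 / (2 * j).+1%:R in
  let A := fun r : R => r%:C * u in
  let a := fun r : R => fun k : nat =>
     if odd k && (3 <= k <= (2 * N - 1))%N
     then kap k./2 * A r ^+ k + kap1 k./2 * A r else 0 in
  let x0 := fun r : R => cRe (z0 * A r) in
  let t0 := fun r : R => cIm (z0 * A r) / 2 in
  let star := fun j : nat =>
     kap1 j = - ((cRe (z0 * u))%:C + 2%:R ^+ (2 * j) * 'i * (cIm (z0 * u))%:C)
              / (2 * j).+1`!%:R * u^-1 in
  (* (1) *)
  ((forall j, (1 <= j <= N - 2)%N -> star j) ->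
   forall B : R, 0 < B -> exists K R0 : R, forall r : R, R0 <= r ->
     forall x t : R, `|x - x0 r| <= B -> `|t - t0 r| <= B ->
       cnorm (qN N (a r) x t - qhat (N - 1) (x - x0 r) (t - t0 r) * expi (2%:R * t))
         <= K / r)
  /\
  (* (2) *)
  (forall m : nat, (1 <= m <= N - 2)%N ->
   (forall j, (1 <= j < m)%N -> star j) -> ~ star m ->
   let Q := YV R m (N - 1) in
   (forall z, z != 0 -> root Q z -> mup z Q = 1%N) ->
   forall rt : R[i] -> R[i], (forall w, rt w ^+ (2 * m).+1 = w) ->
   let W := fun r : R =>
     - ((2 * m).+1%:R / 2%:R ^+ (2 * m)) *
       (((cRe (z0 * A r))%:C + 2%:R ^+ (2 * m) * 'i * (cIm (z0 * A r))%:C)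
          / (2 * m).+1`!%:R + kap1 m * A r) in
   let xt := fun r zb => cRe (zb * rt (W r) + z0 * A r) in
   let tt := fun r zb => cIm (zb * rt (W r) + z0 * A r) / 2 in
   [/\ (forall zb, zb != 0 -> root Q zb ->
         forall B : R, 0 < B -> exists K R0 : R, forall r : R, R0 <= r ->
         forall x t : R, `|x - xt r zb| <= B -> `|t - tt r zb| <= B ->
           cnorm (qN N (a r) x t - qhat 1 (x - xt r zb) (t - tt r zb) * expi (2%:R * t))
             <= K * r `^ (- (1 / (2 * m).+1%:R))),
       (forall B : R, 0 < B -> exists K R0 : R, forall r : R, R0 <= r ->
         forall x t : R, `|x - x0 r| <= B -> `|t - t0 r| <= B ->
           cnorm (qN N (a r) x t - qhat (N0of (N - 1) m) (x - x0 r) (t - t0 r)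
                                     * expi (2%:R * t))
             <= K / r)
     & exists zs : seq R[i],
         [/\ uniq zs, (forall z, (z \in zs) = (z != 0) && root Q z),
             size zs = Gammaof (N - 1) m
           & exists R0 : R, forall r : R, R0 <= r ->
               {in zs &, injective (fun zb => (xt r zb, tt r zb))}]]).
Proof.
move=> N3 z00 u1 _ kapN kap A a x0 t0 star.
have N1 : (1 < N)%N by apply: ltnW.
have starE j : star j <-> coef z0 u kap1 j = 0 by apply: star_coef.
split=> [stars B B0|m /andP [m0 mN] stars nstar Q simple rt rtE W xt tt].
  have M0 : (0 < N - 1)%N by lia.
  have stars' j : (1 <= j < N - 1)%N -> coef z0 u kap1 j = 0.
    by move=> jN; apply/starE/stars; lia.
  (* In the last degree kap1 is 0, so [coef] is a multiple of [lin] at z0 u, and [lin] has trivial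
     kernel. *)
  have cM0 : coef z0 u kap1 (N - 1) != 0.
    rewrite /coef kapN mul0r addr0 mulf_neq0 ?invr_eq0 ?pnatr_eq0 -?lt0n ?fact_gt0 //.
    rewrite -linE; apply/negP => /eqP /lin_eq0 /eqP.
    by rewrite mulf_eq0 (negbTE z00) (negbTE (u_neq0 u1)).
  have NN : N0of (N - 1) (N - 1) = (N - 1)%N.
    by rewrite /N0of modn_small ?leqnn //; lia.
  by have := near_pattern N1 z00 u1 M0 stars' cM0 B0; rewrite NN.
have cm0 : coef z0 u kap1 m != 0 by apply/eqP => /starE.
have stars' j : (1 <= j < m)%N -> coef z0 u kap1 j = 0 by move=> jm; apply/starE/stars.
have WE r : W r = - ((2 * m).+1%:R / 2%:R ^+ (2 * m)) * (coef z0 u kap1 m * r%:C).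
  rewrite /W /coef /A; congr (_ * _).
  rewrite -!linE mulrCA linR; ring.
have NE : N = (N - 1).+1 by lia.
split.
- move=> zb zb0 Qzb B B0.
  have mN2 : (m.*2.+1 < N.*2)%N by lia.
  have Dzb := Qzb; rewrite /Q root_YV // -NE in Dzb.
  have D'zb : (\det (theta_mx m (yv_param R m) N N))^`().[zb] != 0.
    rewrite NE; apply: mup1_deriv_neq0; last by rewrite -mup_YV //; apply: simple.
    by rewrite -size_poly_gt0 size_theta_det // yv_param_neq0.
  have [K [R0 HK]] := far_pattern N1 z00 u1 m0 mN2 stars' cm0 rtE zb0 Dzb D'zb B0.
  exists K, R0 => r rR x t; rewrite /xt /tt WE; exact: HK.
- move=> B B0; exact: (near_pattern N1 z00 u1 m0 stars' cm0 B0).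
have [zs [uz zE sz]] := YV_roots m0 simple.
(* For r >= 1 the number W r is nonzero, hence so is its root, and zb -> zb rt (W r) + z0 A is
   injective. *)
exists zs; split => //; exists 1 => r r1 z1 z2 _ _ [].
rewrite /xt /tt => e1 e2.
have om0 : rt (W r) != 0.
  have : rt (W r) ^+ (2 * m).+1 != 0.
    rewrite rtE WE !mulf_neq0 ?oppr_eq0 ?mulf_neq0 ?invr_eq0 ?expf_neq0 ?pnatr_eq0 //.
    by rewrite -normc_gt0 normcR normr_gt0 gt_eqF // (lt_le_trans ltr01).
  by rewrite expf_eq0.
apply: (mulIf om0); apply: (addIr (z0 * A r)); apply: complex_eq; first exact: e1.
by apply: (mulIf (x := 2^-1)) e2; rewrite invr_eq0 pnatr_eq0.
Qed.
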